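(* Let $(H,\alpha)$ be a monoidal Hom-Hopf algebra over a commutative ring $k$. The category ${}^{H}_{H}\widetilde{\mathcal{H}}(\mathcal{M}_k)^{H}_{H}$ of bicovariant $(H,\alpha)$-Hom-bimodules, with tensor product $\otimes_H$, associativity constraint $\tilde a_{M,N,P}((m\otimes_Hn)\otimes_Hp)=\mu(m)\otimes_H(n\otimes_H\pi^{-1}(p))$, unit object $(H,\alpha)$, unit constraints $\tilde l_M(h\otimes_Hm)=hm$, $\tilde r_M(m\otimes_Hh)=mh$, and prebraiding $$c_{M,N}:M\otimes_HN\to N\otimes_HM,\quad c_{M,N}(m\otimes_Hn)=m_{(-1)}P_R(n_{[0]})\otimes_HP_L(m_{(0)})n_{[1]},$$ is a prebraided tensor category. It is a braided monoidal category if $(H,\alpha)$ has an invertible antipode.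
   Context: Conventions: $k$ is a commutative ring, $\otimes=\otimes_k$, Sweedler notation without summation signs. $\widetilde{\mathcal{H}}(\mathcal{M}_k)$ is the category of pairs $(M,\mu)$, $M$ a $k$-module, $\mu$ a $k$-linear automorphism of $M$; morphisms $f:(M,\mu)\to(N,\nu)$ are $k$-linear maps with $\nu f=f\mu$; $(M,\mu)\otimes(N,\nu)=(M\otimes N,\mu\otimes\nu)$. A monoidal Hom-Hopf algebra $(H,\alpha)$ is an object of $\widetilde{\mathcal{H}}(\mathcal{M}_k)$ with a $k$-bilinear product, an element $1_H$, and $k$-linear maps $\Delta(h)=h_1\otimes h_2$, $\varepsilon:H\to k$, $S:H\to H$ (antipode) such that $\alpha(ab)=\alpha(a)\alpha(b)$, $\alpha(1_H)=1_H$, $\alpha(a)(bc)=(ab)\alpha(c)$, $a1_H=1_Ha=\alpha(a)$; $\Delta(\alpha(c))=\alpha(c_1)\otimes\alpha(c_2)$, $\varepsilon\alpha=\varepsilon$, $\alpha^{-1}(c_1)\otimes\Delta(c_2)=c_{11}\otimes(c_{12}\otimes\alpha^{-1}(c_2))$, $c_1\varepsilon(c_2)=\alpha^{-1}(c)=\varepsilon(c_1)c_2$; $\Delta(ab)=\Delta(a)\Delta(b)$, $\Delta(1_H)=1_H\otimes1_H$, $\varepsilon(ab)=\varepsilon(a)\varepsilon(b)$, $\varepsilon(1_H)=1$; $S\alpha=\alpha S$ and $S(h_1)h_2=\varepsilon(h)1_H=h_1S(h_2)$. All actions and coactions are morphisms in $\widetilde{\mathcal{H}}(\mathcal{M}_k)$.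 Hom-bimodule $(M,\mu)$: $\alpha(g)(hm)=(gh)\mu(m)$, $1_Hm=\mu(m)$, $(mg)\alpha(h)=\mu(m)(gh)$, $m1_H=\mu(m)$, $(gm)\alpha(h)=\alpha(g)(mh)$. Left Hom-comodule, $\rho(m)=m_{(-1)}\otimes m_{(0)}$: $\Delta(m_{(-1)})\otimes\mu^{-1}(m_{(0)})=(\alpha^{-1}(m_{(-1)})\otimes m_{(0)(-1)})\otimes m_{(0)(0)}$, $\varepsilon(m_{(-1)})m_{(0)}=\mu^{-1}(m)$. Right Hom-comodule, $\sigma(m)=m_{[0]}\otimes m_{[1]}$: $\mu^{-1}(m_{[0]})\otimes\Delta(m_{[1]})=m_{[0][0]}\otimes(m_{[0][1]}\otimes\alpha^{-1}(m_{[1]}))$, $m_{[0]}\varepsilon(m_{[1]})=\mu^{-1}(m)$. A bicovariant Hom-bimodule is a Hom-bimodule with a left Hom-coaction $\rho$ and a right Hom-coaction $\sigma$ such that $\rho((hm)\alpha(g))=\Delta(\alpha(h))(\rho(m)\Delta(g))$, $\sigma((hm)\alpha(g))=\Delta(\alpha(h))(\sigma(m)\Delta(g))$ (componentwise actions) and $m_{(-1)}\otimes(m_{(0)[0]}\otimes m_{(0)[1]})=\alpha(m_{[0](-1)})\otimes(m_{[0](0)}\otimes\alpha^{-1}(m_{[1]}))$. Morphisms are morphisms in $\widetilde{\mathcal{H}}(\mathcal{M}_k)$ that are $H$-linear and $H$-colinear on both sides. $P_L(m)=S(m_{(-1)})m_{(0)}$, $P_R(m)=m_{[0]}S(m_{[1]})$.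 $M\otimes_HN$ is the coequalizer (quotient) of $M\otimes N$ by the relations $mh\otimes n=\mu(m)\otimes h\nu^{-1}(n)$, with automorphism $\mu\otimes_H\nu$ and $h(m\otimes_Hn)=\alpha^{-1}(h)m\otimes_H\nu(n)$, $(m\otimes_Hn)h=\mu(m)\otimes_Hn\alpha^{-1}(h)$, $\rho(m\otimes_Hn)=m_{(-1)}n_{(-1)}\otimes(m_{(0)}\otimes_Hn_{(0)})$, $\sigma(m\otimes_Hn)=(m_{[0]}\otimes_Hn_{[0]})\otimes m_{[1]}n_{[1]}$. $(H,\alpha)$ is a bicovariant bimodule via its product and coproduct. Prebraided means a natural family $c$ of morphisms satisfying both hexagon axioms but not required to be invertible; braided means $c$ is moreover invertible. *)

(* Defs.v *)
From HB Require Import structures.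
From mathcomp Require Import all_boot all_algebra.
From mathcomp Require Import boolp.

Set Implicit Arguments.
Unset Strict Implicit.
Unset Printing Implicit Defensive.

Import GRing.Theory.
Local Open Scope quotient_scope.
Local Open Scope ring_scope.

(** Everything is stated over [k : comPzRingType], so the zero ring is allowed;
  the library's [{bilinear _ -> _ -> _}] requires a nonzero ring. *)

Definition bilin (k : comPzRingType) (M N P : lmodType k) (f : M -> N -> P) :=
  (forall m, linear (f m)) /\ (forall n, linear (f^~ n)).

(** [M (x) N] is the quotient of the formal finite sums [seq (M * N)] by the
  least congruence making [(m, n)] bilinear. *)
Section Tensor.
Variables (k : comPzRingType) (M N : lmodType k).
Implicit Types (s t u v : seq (M * N)) (a : k).

Inductive teq : seq (M * N) -> seq (M * N) -> Prop :=
| teq_refl s : teq s s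
| teq_sym s t : teq s t -> teq t s
| teq_trans s t u : teq s t -> teq t u -> teq s u
| teq_cat s t u v : teq s t -> teq u v -> teq (s ++ u) (t ++ v)
| teq_catC s t : teq (s ++ t) (t ++ s)
| teq_addl m m' n : teq [:: (m + m', n)] [:: (m, n); (m', n)]
| teq_addr m n n' : teq [:: (m, n + n')] [:: (m, n); (m, n')]
| teq_scale a m n : teq [:: (a *: m, n)] [:: (m, a *: n)]
| teq_zero n : teq [:: (0, n)] [::].

Definition teqb s t : bool := `[< teq s t >].

Lemma teqb_equiv : equiv_class_of teqb.
Proof.
split.
- by move=> s; apply/asboolP; exact: teq_refl.
- by move=> s t; apply/asboolP/asboolP; exact: teq_sym.
- by move=> s t u /asboolP h1 /asboolP h2; apply/asboolP; exact: teq_trans h1 h2.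
Qed.

Canonical teqb_equivrel := EquivRelPack teqb_equiv.

Definition tens : Type := {eq_quot teqb}.
HB.instance Definition _ := Choice.on tens.
HB.instance Definition _ := EqQuotient.on tens.

Lemma tens_eqP s t : reflect (teq s t) (\pi_tens s == \pi_tens t).
Proof.
apply: (iffP idP) => [|h].
  by rewrite eqmodE => /asboolP.
by rewrite eqmodE; apply/asboolP.
Qed.

Definition tscale_seq a s := [seq (a *: p.1, p.2) | p <- s].

Lemma teq_scale_seq a s t : teq s t -> teq (tscale_seq a s) (tscale_seq a t).
Proof.
elim=> {s t}.
- by move=> s; exact: teq_refl.
- by move=> s t _; exact: teq_sym.
- by move=> s t u _ h1 _; exact: teq_trans h1.
- by move=> s t u v _ h1 _ h2; rewrite /tscale_seq !map_cat; exact: teq_cat.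
- by move=> s t; rewrite /tscale_seq !map_cat; exact: teq_catC.
- by move=> m m' n /=; rewrite scalerDr; exact: teq_addl.
- by move=> m n n' /=; exact: teq_addr.
- by move=> b m n /=; rewrite scalerA mulrC -scalerA; exact: teq_scale.
- by move=> n /=; rewrite scaler0; exact: teq_zero.
Qed.

Definition tadd (x y : tens) : tens := \pi_tens (repr x ++ repr y).
Definition tscale a (x : tens) : tens := \pi_tens (tscale_seq a (repr x)).
Definition tzero : tens := (\pi_tens [::]).
Definition topp (x : tens) : tens := tscale (- 1) x.

Lemma teq_repr s : teq (repr (\pi_tens s)) s.
Proof. by apply/tens_eqP; rewrite reprK. Qed.

Lemma tadd_pi s t : tadd (\pi_tens s) (\pi_tens t) = (\pi_tens (s ++ t)).
Proof. by apply/eqP/tens_eqP; apply: teq_cat; exact: teq_repr. Qed.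

Lemma tscale_pi a s : tscale a (\pi_tens s) = (\pi_tens (tscale_seq a s)).
Proof. by apply/eqP/tens_eqP; apply: teq_scale_seq; exact: teq_repr. Qed.

Lemma tens_piP (x : tens) : exists s, x = (\pi_tens s).
Proof. by exists (repr x); rewrite reprK. Qed.

Lemma taddA : associative tadd.
Proof.
move=> x y z; have [[s ->] [t ->] [u ->]] := And3 (tens_piP x) (tens_piP y) (tens_piP z).
by rewrite !tadd_pi catA.
Qed.

Lemma taddC : commutative tadd.
Proof.
move=> x y; have [[s ->] [t ->]] := conj (tens_piP x) (tens_piP y).
by rewrite !tadd_pi; apply/eqP/tens_eqP; exact: teq_catC.
Qed.

Lemma tadd0 : left_id tzero tadd.
Proof. by move=> x; have [s ->] := tens_piP x; rewrite tadd_pi. Qed.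

Lemma tscaleDl_seq a b s :
  teq (tscale_seq (a + b) s) (tscale_seq a s ++ tscale_seq b s).
Proof.
elim: s => [|[m n] s IH] /=; first exact: teq_refl.
rewrite scalerDl -cat1s.
apply: (@teq_trans _ ([:: (a *: m, n); (b *: m, n)] ++
                      (tscale_seq a s ++ tscale_seq b s))).
  by apply: teq_cat IH; exact: teq_addl.
rewrite -[_ :: (_ ++ _)]/([:: (a *: m, n)] ++ _) -[[:: _; _] ++ _]/([:: (a *: m, n)] ++ _).
apply: teq_cat; first exact: teq_refl.
rewrite -[X in teq X _]/(([:: (b *: m, n)] ++ tscale_seq a s) ++ tscale_seq b s).
rewrite -[X in teq _ X]/(tscale_seq a s ++ ([:: (b *: m, n)] ++ tscale_seq b s)) catA.
by apply: teq_cat; [exact: teq_catC | exact: teq_refl].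
Qed.

Lemma tscale_seq0 s : teq (tscale_seq 0 s) [::].
Proof.
elim: s => [|[m n] s IH] /=; first exact: teq_refl.
rewrite scale0r -cat1s -[X in teq _ X](cats0 [::]).
by apply: teq_cat IH; exact: teq_zero.
Qed.

Lemma tscale1 : left_id 1 tscale.
Proof.
move=> x; have [s ->] := tens_piP x; rewrite tscale_pi; congr (\pi_tens _).
by rewrite /tscale_seq -[RHS]map_id; apply: eq_map => -[m n] /=; rewrite scale1r.
Qed.

Lemma tscaleDl x a b : tscale (a + b) x = tadd (tscale a x) (tscale b x).
Proof.
have [s ->] := tens_piP x; rewrite !tscale_pi tadd_pi.
by apply/eqP/tens_eqP; exact: tscaleDl_seq.
Qed.

Lemma taddN : left_inverse tzero topp tadd.
Proof.
move=> x; rewrite /topp -[X in tadd _ X]tscale1 -tscaleDl addNr.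
have [s ->] := tens_piP x; rewrite tscale_pi.
by apply/eqP/tens_eqP; exact: tscale_seq0.
Qed.

HB.instance Definition _ := GRing.isZmodule.Build tens taddA taddC tadd0 taddN.

Lemma tscaleA a b x : tscale a (tscale b x) = tscale (a * b) x.
Proof.
have [s ->] := tens_piP x; rewrite !tscale_pi /tscale_seq -map_comp.
by congr (\pi_tens _); apply: eq_map => -[m n] /=; rewrite scalerA.
Qed.

Lemma tscaleDr : right_distributive tscale +%R.
Proof.
move=> a x y; have [[s ->] [t ->]] := conj (tens_piP x) (tens_piP y).
rewrite -[_ + _]/(tadd _ _) -[X in _ = X]/(tadd _ _) tadd_pi !tscale_pi tadd_pi.
by rewrite /tscale_seq map_cat.
Qed.

HB.instance Definition _ :=
  GRing.Zmodule_isLmodule.Build k tens tscaleA tscale1 tscaleDr tscaleDl.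

Definition tpure (m : M) (n : N) : tens := (\pi_tens [:: (m, n)]).

Lemma tpure_bilin : bilin tpure.
Proof.
split=> [m a n n' | n a m m'] /=.
  rewrite -[RHS]/(tadd (tscale _ _) _) tscale_pi tadd_pi [tscale_seq _ _]/=.
  apply/eqP/tens_eqP; apply: teq_trans (teq_addr _ _ _) _.
  apply: (@teq_cat [:: _] [:: _] [:: _] [:: _]); last exact: teq_refl.
  by apply: teq_sym; exact: teq_scale.
rewrite -[RHS]/(tadd (tscale _ _) _) tscale_pi tadd_pi [tscale_seq _ _]/=.
by apply/eqP/tens_eqP; exact: teq_addl.
Qed.

Lemma tens_sum (x : tens) : x = \sum_(p <- repr x) tpure p.1 p.2.
Proof.
rewrite -{1}[x]reprK; elim: (repr x) => [|[m n] s IH]; first by rewrite big_nil.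
by rewrite big_cons -IH -[RHS]/(tadd _ _) tadd_pi.
Qed.

(** Sweedler notation: [\sw_(a, b <- x) E a b] evaluates the bilinear
  expression [E] on the tensor [x], written as an arbitrary sum of pure
  tensors. Independence of the representative, hence the universal property of
  the tensor product, is [sw_tpure] and [sw_linear] below; it holds for
  bilinear [E] only, the value being meaningless otherwise. *)
Definition sw (P : lmodType k) (x : tens) (f : M -> N -> P) : P :=
  \sum_(p <- repr x) f p.1 p.2.

Section Universal.
Variables (P : lmodType k) (f : M -> N -> P).
Hypothesis bf : bilin f.

Lemma bilinDr m n n' : f m (n + n') = f m n + f m n'.
Proof. by have := bf.1 m 1 n n'; rewrite !scale1r. Qed.

Lemma bilinDl m m' n : f (m + m') n = f m n + f m' n.
Proof. by have := bf.2 n 1 m m'; rewrite !scale1r. Qed.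

Lemma bilin0r m : f m 0 = 0.
Proof. by apply: (addrI (f m 0)); rewrite -bilinDr !addr0. Qed.

Lemma bilin0l n : f 0 n = 0.
Proof. by apply: (addrI (f 0 n)); rewrite -bilinDl !addr0. Qed.

Lemma bilinZr a m n : f m (a *: n) = a *: f m n.
Proof. by have := bf.1 m a n 0; rewrite !addr0 bilin0r addr0. Qed.

Lemma bilinZl a m n : f (a *: m) n = a *: f m n.
Proof. by have := bf.2 n a m 0; rewrite !addr0 bilin0l addr0. Qed.

Lemma teq_sum s t : teq s t ->
  \sum_(p <- s) f p.1 p.2 = \sum_(p <- t) f p.1 p.2.
Proof.
elim=> {s t}.
- by [].
- by move=> s t _ ->.
- by move=> s t u _ -> _ ->.
- by move=> s t u v _ h1 _ h2; rewrite !big_cat h1 h2.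
- by move=> s t; rewrite !big_cat /= addrC.
- by move=> m m' n; rewrite !big_cons big_nil /= !addr0 bilinDl.
- by move=> m n n'; rewrite !big_cons big_nil /= !addr0 bilinDr.
- by move=> a m n; rewrite !big_cons big_nil /= !addr0 bilinZl bilinZr.
- by move=> n; rewrite !big_cons big_nil /= addr0 bilin0l.
Qed.

Lemma sw_pi s : sw (\pi_tens s) f = \sum_(p <- s) f p.1 p.2.
Proof. exact: teq_sum (teq_repr s). Qed.

Lemma sw_tpure m n : sw (tpure m n) f = f m n.
Proof. by rewrite sw_pi big_seq1. Qed.

Lemma sw_linear : linear (fun x => sw x f).
Proof.
move=> a x y; have [[s ->] [t ->]] := conj (tens_piP x) (tens_piP y).
rewrite -[_ + _]/(tadd (tscale _ _) _) tscale_pi tadd_pi !sw_pi big_cat big_map /=.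
rewrite scaler_sumr; congr (_ + _); apply: eq_bigr => -[m n] _ /=.
by rewrite bilinZl.
Qed.

End Universal.
End Tensor.

Section SweedlerTheory.
Variables (k : comPzRingType) (M N P Q : lmodType k).

Lemma eq_sw (f g : M -> N -> P) x :
  (forall m n, f m n = g m n) -> sw x f = sw x g.
Proof. by move=> e; apply: eq_bigr => p _. Qed.

Lemma linear_sw (g : P -> Q) (f : M -> N -> P) x : linear g ->
  g (sw x f) = sw x (fun m n => g (f m n)).
Proof.
move=> lg; pose lin := GRing.isLinear.Build k P Q *:%R g lg.
pose g' : {linear P -> Q} := HB.pack g lin.
by rewrite -[g]/(g' : P -> Q) /sw raddf_sum.
Qed.

Lemma linear_sw_param (f : P -> M -> N -> Q) x :
  (forall m n, linear (fun p => f p m n)) -> linear (fun p => sw x (f p)).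
Proof.
move=> lf a p q; rewrite /sw scaler_sumr -big_split /=.
by apply: eq_bigr => u _; rewrite lf.
Qed.

End SweedlerTheory.

Lemma sw_sw (k : comPzRingType) (M N M' N' P : lmodType k)
  (f : M -> N -> tens M' N') (g : M' -> N' -> P) x : bilin g ->
  sw (sw x f) g = sw x (fun m n => sw (f m n) g).
Proof. by move=> bg; rewrite (linear_sw _ _ (sw_linear bg)). Qed.

Lemma bilin_tpure_lin (k : comPzRingType) (M N M' N' : lmodType k)
  (f : M -> M') (g : N -> N') :
  linear f -> linear g -> bilin (fun m n => tpure (f m) (g n)).
Proof.
move=> lf lg; split=> [m a n n' | n a m m'] /=.
  by rewrite lg (tpure_bilin _ _).1.
by rewrite lf; exact: (tpure_bilin _ _).2.
Qed.

Declare Scope hom_scope.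
Delimit Scope hom_scope with hom.
Local Open Scope hom_scope.

Notation "m ⊗ n" := (tpure m n) (at level 40, left associativity) : hom_scope.
Notation "\sw_ ( a , b <- x ) E" := (sw x (fun a b => E))
  (at level 41, a name, b name, x at level 60, E at level 41,
   format "\sw_ ( a ,  b  <-  x )  E") : hom_scope.

Section Quotient.
Variables (k : comPzRingType) (V : lmodType k) (A : V -> Prop).

Inductive spanned : V -> Prop :=
| spanned0 : spanned 0
| spanned_lin a u v : A u -> spanned v -> spanned (a *: u + v).

Lemma spannedP a u v : spanned u -> spanned v -> spanned (a *: u + v).
Proof.
move=> hu hv; elim: hu => [|b w u' hw _ IH]; first by rewrite scaler0 add0r.
by rewrite scalerDr scalerA -addrA; apply: spanned_lin.
Qed.

Definition qeq (u v : V) : bool := `[< spanned (u - v) >].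

Lemma qeq_equiv : equiv_class_of qeq.
Proof.
have sym u v : qeq u v -> qeq v u.
  move=> /asboolP h; apply/asboolP.
  by have := spannedP (-1) h spanned0; rewrite addr0 scaleN1r opprB.
split.
- by move=> u; apply/asboolP; rewrite subrr; exact: spanned0.
- by move=> u v; apply/idP/idP; exact: sym.
- move=> u v w /asboolP h1 /asboolP h2; apply/asboolP.
  by have := spannedP 1 h1 h2; rewrite scale1r addrA subrK.
Qed.

Canonical qeq_equivrel := EquivRelPack qeq_equiv.

Definition quot : Type := {eq_quot qeq}.
HB.instance Definition _ := Choice.on quot.
HB.instance Definition _ := EqQuotient.on quot.

Definition qproj (v : V) : quot := (\pi_quot v).

Lemma qproj_eqP u v : qproj u = qproj v <-> spanned (u - v).
Proof.
split=> [/eqP|h]; first by rewrite eqmodE => /asboolP.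
by apply/eqP; rewrite eqmodE; apply/asboolP.
Qed.

Definition qzero : quot := qproj 0.
Definition qadd (x y : quot) : quot := qproj (repr x + repr y).
Definition qopp (x : quot) : quot := qproj (- repr x).
Definition qscale a (x : quot) : quot := qproj (a *: repr x).

Lemma qrepr v : spanned (repr (qproj v) - v).
Proof. by apply/qproj_eqP; rewrite /qproj reprK. Qed.

Lemma quotP (x : quot) : exists v, x = qproj v.
Proof. by exists (repr x); rewrite /qproj reprK. Qed.

Lemma qaddE u v : qadd (qproj u) (qproj v) = qproj (u + v).
Proof.
apply/qproj_eqP; have := spannedP 1 (qrepr u) (qrepr v).
by rewrite scale1r opprD addrACA.
Qed.

Lemma qscaleE a v : qscale a (qproj v) = qproj (a *: v).
Proof.
apply/qproj_eqP; have := spannedP a (qrepr v) spanned0.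
by rewrite addr0 scalerBr.
Qed.

Lemma qoppE v : qopp (qproj v) = qproj (- v).
Proof. by rewrite -scaleN1r -qscaleE /qscale scaleN1r. Qed.

Lemma qaddA : associative qadd.
Proof.
move=> x y z; have [[s ->] [t ->] [u ->]] := And3 (quotP x) (quotP y) (quotP z).
by rewrite !qaddE addrA.
Qed.

Lemma qaddC : commutative qadd.
Proof.
by move=> x y; have [[s ->] [t ->]] := conj (quotP x) (quotP y); rewrite !qaddE addrC.
Qed.

Lemma qadd0 : left_id qzero qadd.
Proof. by move=> x; have [s ->] := quotP x; rewrite qaddE add0r. Qed.

Lemma qaddN : left_inverse qzero qopp qadd.
Proof. by move=> x; have [s ->] := quotP x; rewrite qoppE qaddE addNr. Qed.

HB.instance Definition _ := GRing.isZmodule.Build quot qaddA qaddC qadd0 qaddN.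

Lemma qscaleA a b x : qscale a (qscale b x) = qscale (a * b) x.
Proof. by have [s ->] := quotP x; rewrite !qscaleE scalerA. Qed.

Lemma qscale1 : left_id 1 qscale.
Proof. by move=> x; have [s ->] := quotP x; rewrite qscaleE scale1r. Qed.

Lemma qscaleDr : right_distributive qscale +%R.
Proof.
move=> a x y; have [[s ->] [t ->]] := conj (quotP x) (quotP y).
by rewrite -[_ + _]/(qadd _ _) -[RHS]/(qadd _ _) qaddE !qscaleE qaddE scalerDr.
Qed.

Lemma qscaleDl x a b : qscale (a + b) x = qscale a x + qscale b x.
Proof.
have [s ->] := quotP x.
by rewrite -[RHS]/(qadd _ _) !qscaleE qaddE scalerDl.
Qed.

HB.instance Definition _ :=
  GRing.Zmodule_isLmodule.Build k quot qscaleA qscale1 qscaleDr qscaleDl.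

Lemma qproj_linear : linear qproj.
Proof. by move=> a u v; rewrite -[RHS]/(qadd (qscale _ _) _) qscaleE qaddE. Qed.

End Quotient.

Record lin_aut (k : comPzRingType) (M : lmodType k) := LinAut {
  aut :> {linear M -> M};
  autV : {linear M -> M};
  autK : cancel aut autV;
  autVK : cancel autV aut }.

Record homHopf (k : comPzRingType) := HomHopf {
  hcar :> lmodType k;
  alpha : lin_aut hcar;
  hmul : hcar -> hcar -> hcar;
  hone : hcar;
  Delta : {linear hcar -> tens hcar hcar};
  eps : {scalar hcar};
  antipode : {linear hcar -> hcar};
  hmul_bilin : bilin hmul;
  alphaM : forall a b, alpha (hmul a b) = hmul (alpha a) (alpha b);
  alpha1 : alpha hone = hone;
  hmulA : forall a b c, hmul (alpha a) (hmul b c) = hmul (hmul a b) (alpha c);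
  hmulr1 : forall a, hmul a hone = alpha a;
  hmul1r : forall a, hmul hone a = alpha a;
  Delta_alpha : forall c,
    Delta (alpha c) = \sw_(c1, c2 <- Delta c) (alpha c1 ⊗ alpha c2);
  eps_alpha : forall c, eps (alpha c) = eps c;
  DeltaA : forall c,
    \sw_(c1, c2 <- Delta c) (autV alpha c1 ⊗ Delta c2)
    = \sw_(c1, c2 <- Delta c) \sw_(c11, c12 <- Delta c1)
        (c11 ⊗ (c12 ⊗ autV alpha c2));
  eps_r : forall c, \sw_(c1, c2 <- Delta c) (eps c2 *: c1) = autV alpha c;
  eps_l : forall c, \sw_(c1, c2 <- Delta c) (eps c1 *: c2) = autV alpha c;
  DeltaM : forall a b,
    Delta (hmul a b)
    = \sw_(a1, a2 <- Delta a) \sw_(b1, b2 <- Delta b)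
        (hmul a1 b1 ⊗ hmul a2 b2);
  Delta1 : Delta hone = hone ⊗ hone;
  epsM : forall a b, eps (hmul a b) = eps a * eps b;
  eps1 : eps hone = 1;
  antipode_alpha : forall h, antipode (alpha h) = alpha (antipode h);
  antipode_l : forall h,
    \sw_(h1, h2 <- Delta h) hmul (antipode h1) h2 = eps h *: hone;
  antipode_r : forall h,
    \sw_(h1, h2 <- Delta h) hmul h1 (antipode h2) = eps h *: hone }.

Arguments alpha {k} _.
Arguments hone {k} _.
Arguments antipode {k} _.
Arguments Delta {k _}.
Arguments eps {k _}.

Notation "a ∙ b" := (hmul a b) (at level 39, left associativity) : hom_scope.

(** [mu] is the structure automorphism of [M], [l] and [r] the left and
  right actions, [rho] and [sigma] the left and right coactions. *)
Section HomStructures.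
Variables (k : comPzRingType) (H : homHopf k) (M : lmodType k) (mu : lin_aut M).
Variables (l : H -> M -> M) (r : M -> H -> M).
Variables (rho : {linear M -> tens H M}) (sigma : {linear M -> tens M H}).
Local Notation α := (alpha H).
Local Notation α' := (autV (alpha H)).

Definition hom_bimodule : Prop :=
  [/\ [/\ bilin l, bilin r,
          (forall h m, mu (l h m) = l (α h) (mu m)) &
          (forall m h, mu (r m h) = r (mu m) (α h))],
      (forall g h m, l (α g) (l h m) = l (g ∙ h) (mu m))
        /\ (forall m, l (hone H) m = mu m),
      (forall m g h, r (r m g) (α h) = r (mu m) (g ∙ h))
        /\ (forall m, r m (hone H) = mu m) &
      forall g m h, r (l g m) (α h) = l (α g) (r m h)].

Definition left_hom_comodule : Prop :=
  [/\ (forall m, rho (mu m) = \sw_(h, x <- rho m) (α h ⊗ mu x)),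
      (forall m, \sw_(h, x <- rho m) (Delta h ⊗ autV mu x)
               = \sw_(h, x <- rho m) \sw_(g, y <- rho x) ((α' h ⊗ g) ⊗ y)) &
      (forall m, \sw_(h, x <- rho m) (eps h *: x) = autV mu m)].

Definition right_hom_comodule : Prop :=
  [/\ (forall m, sigma (mu m) = \sw_(x, h <- sigma m) (mu x ⊗ α h)),
      (forall m, \sw_(x, h <- sigma m) (autV mu x ⊗ Delta h)
               = \sw_(x, h <- sigma m) \sw_(y, g <- sigma x) (y ⊗ (g ⊗ α' h))) &
      (forall m, \sw_(x, h <- sigma m) (eps h *: x) = autV mu m)].

Definition bicovariant : Prop :=
  [/\ (forall h m g, rho (r (l h m) (α g))
        = \sw_(h1, h2 <- Delta (α h)) \sw_(b, x <- rho m) \sw_(g1, g2 <- Delta g)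
            (h1 ∙ (b ∙ g1) ⊗ l h2 (r x g2))),
      (forall h m g, sigma (r (l h m) (α g))
        = \sw_(h1, h2 <- Delta (α h)) \sw_(x, b <- sigma m) \sw_(g1, g2 <- Delta g)
            (l h1 (r x g1) ⊗ h2 ∙ (b ∙ g2))) &
      (forall m,
          \sw_(b, x <- rho m) \sw_(y, c <- sigma x) (b ⊗ (y ⊗ c))
        = \sw_(x, c <- sigma m) \sw_(b, y <- rho x) (α b ⊗ (y ⊗ α' c)))].

End HomStructures.

Record bicov_struct (k : comPzRingType) (H : homHopf k) (M : lmodType k) :=
  BicovStruct {
    s_mu : lin_aut M;
    s_lact : H -> M -> M;
    s_ract : M -> H -> M;
    s_rho : {linear M -> tens H M};
    s_sigma : {linear M -> tens M H};
    s_bimodule : hom_bimodule s_mu s_lact s_ract;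
    s_left_comodule : left_hom_comodule s_mu s_rho;
    s_right_comodule : right_hom_comodule s_mu s_sigma;
    s_bicovariant : bicovariant s_lact s_ract s_rho s_sigma }.

Record bicov (k : comPzRingType) (H : homHopf k) := Bicov {
  bcar :> lmodType k;
  bstr : bicov_struct H bcar }.

Section Projections.
Variables (k : comPzRingType) (H : homHopf k) (M : bicov H).

Definition mu : lin_aut M := s_mu (bstr M).
Definition lact : H -> M -> M := s_lact (bstr M).
Definition ract : M -> H -> M := s_ract (bstr M).
Definition rho : {linear M -> tens H M} := s_rho (bstr M).
Definition sigma : {linear M -> tens M H} := s_sigma (bstr M).

End Projections.

Arguments mu {k H} M.
Arguments rho {k H} M.
Arguments sigma {k H} M.

Notation "h ▷ m" := (lact h m) (at level 39, left associativity) : hom_scope.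
Notation "m ◁ h" := (ract m h) (at level 39, left associativity) : hom_scope.

Section LeftRightProjections.
Variables (k : comPzRingType) (H : homHopf k) (M : bicov H).

Definition P_L (m : M) : M := \sw_(h, x <- rho M m) (antipode H h ▷ x).
Definition P_R (m : M) : M := \sw_(x, h <- sigma M m) (x ◁ antipode H h).

End LeftRightProjections.

Record bicov_hom (k : comPzRingType) (H : homHopf k) (M N : bicov H) := BicovHom {
  bhom :> {linear M -> N};
  bhom_mu : forall m, mu N (bhom m) = bhom (mu M m);
  bhom_lact : forall h m, bhom (h ▷ m) = h ▷ bhom m;
  bhom_ract : forall m h, bhom (m ◁ h) = bhom m ◁ h;
  bhom_rho : forall m, rho N (bhom m) = \sw_(h, x <- rho M m) (h ⊗ bhom x);
  bhom_sigma : forall m, sigma N (bhom m) = \sw_(x, h <- sigma M m) (bhom x ⊗ h) }.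

Lemma bicov_hom_ext (k : comPzRingType) (H : homHopf k) (M N : bicov H)
  (f g : bicov_hom M N) : f =1 g -> f = g.
Proof.
case: f g => [f f1 f2 f3 f4 f5] [g g1 g2 g3 g4 g5] /= /funext e.
have {}e : f = g.
  case: f g e {f1 f2 f3 f4 f5 g1 g2 g3 g4 g5} => [f [[fa] [fb]]] [g [[ga] [gb]]] /= e.
  by subst g; rewrite (Prop_irrelevance fa ga) (Prop_irrelevance fb gb).
by subst g; congr BicovHom; exact: Prop_irrelevance.
Qed.

Section IdComp.
Variables (k : comPzRingType) (H : homHopf k) (M N P : bicov H).

Lemma bicov_id_rho m : rho M (idfun m) = \sw_(h, x <- rho M m) (h ⊗ idfun x).
Proof. exact: tens_sum. Qed.

Lemma bicov_id_sigma m : sigma M (idfun m) = \sw_(x, h <- sigma M m) (idfun x ⊗ h).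
Proof. exact: tens_sum. Qed.

Definition bicov_id : bicov_hom M M :=
  @BicovHom k H M M idfun (fun _ => erefl) (fun _ _ => erefl) (fun _ _ => erefl)
    bicov_id_rho bicov_id_sigma.

Variables (g : bicov_hom N P) (f : bicov_hom M N).

Lemma bicov_comp_mu m : mu P ((g \o f) m) = (g \o f) (mu M m).
Proof. by rewrite /= -!bhom_mu. Qed.

Lemma bicov_comp_lact h m : (g \o f) (h ▷ m) = h ▷ (g \o f) m.
Proof. by rewrite /= !bhom_lact. Qed.

Lemma bicov_comp_ract m h : (g \o f) (m ◁ h) = (g \o f) m ◁ h.
Proof. by rewrite /= !bhom_ract. Qed.

Lemma bicov_comp_rho m :
  rho P ((g \o f) m) = \sw_(h, x <- rho M m) (h ⊗ (g \o f) x).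
Proof.
have bg : bilin (fun (h : H) x => h ⊗ g x).
  by apply: (@bilin_tpure_lin _ _ _ _ _ id) => [//|]; exact: linearP.
rewrite /= !bhom_rho sw_sw //; apply: eq_sw => h x.
by rewrite sw_tpure.
Qed.

Lemma bicov_comp_sigma m :
  sigma P ((g \o f) m) = \sw_(x, h <- sigma M m) ((g \o f) x ⊗ h).
Proof.
have bg : bilin (fun x (h : H) => g x ⊗ h).
  by apply: (@bilin_tpure_lin _ _ _ _ _ _ id) => [|//]; exact: linearP.
rewrite /= !bhom_sigma sw_sw //; apply: eq_sw => h x.
by rewrite sw_tpure.
Qed.

Definition bicov_comp : bicov_hom M P :=
  @BicovHom k H M P (g \o f) bicov_comp_mu bicov_comp_lact bicov_comp_ract
    bicov_comp_rho bicov_comp_sigma.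

End IdComp.

Section Unit.
Variables (k : comPzRingType) (H : homHopf k).
Local Notation α := (alpha H).
Local Notation α' := (autV (alpha H)).

Lemma unit_bimodule : hom_bimodule α (@hmul k H) (@hmul k H).
Proof.
split.
- by split; [exact: hmul_bilin | exact: hmul_bilin | exact: alphaM | exact: alphaM].
- by split=> [g h m | m]; [rewrite hmulA | rewrite hmul1r].
- by split=> [m g h | m]; [rewrite hmulA | rewrite hmulr1].
- by move=> g m h; rewrite hmulA.
Qed.

Lemma unit_right_comodule : right_hom_comodule α (@Delta k H).
Proof.
by split; [exact: Delta_alpha | exact: DeltaA | exact: eps_r].
Qed.

Let rassoc (a : H) (y : tens H H) := \sw_(b, c <- y) ((a ⊗ b) ⊗ c).

Let rassoc_bilin : bilin rassoc.
Proof.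
split=> [a | y].
  apply: sw_linear; apply: (@bilin_tpure_lin _ _ _ _ _ (tpure a) id) => //.
  exact: (tpure_bilin _ _).1.
apply: linear_sw_param => b c u a a'.
by rewrite (tpure_bilin _ _).2; exact: (tpure_bilin _ _).2.
Qed.

Lemma unit_left_comodule : left_hom_comodule α (@Delta k H).
Proof.
split; [exact: Delta_alpha | move=> c | exact: eps_l].
have /(congr1 (fun z => sw z rassoc)) := DeltaA c.
rewrite !sw_sw //.
rewrite (eq_sw (g := fun c1 c2 => \sw_(g, y <- Delta c2) ((α' c1 ⊗ g) ⊗ y))); last first.
  by move=> c1 c2; rewrite sw_tpure.
move=> ->; apply: eq_sw => c1 c2.
rewrite sw_sw // {1}[Delta c1]tens_sum -/(sw _ _).
rewrite (linear_sw (g := fun t => t ⊗ α' c2)); last exact: (tpure_bilin _ _).2.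
apply: eq_sw => a b; rewrite sw_tpure // /rassoc sw_tpure //.
apply: (@bilin_tpure_lin _ _ _ _ _ (tpure a) id) => //.
exact: (tpure_bilin _ _).1.
Qed.

Lemma unit_bicovariant :
  bicovariant (@hmul k H) (@hmul k H) (@Delta k H) (@Delta k H).
Proof.
have key h m g : Delta ((h ∙ m) ∙ α g) =
    \sw_(h1, h2 <- Delta (α h)) \sw_(b, x <- Delta m) \sw_(g1, g2 <- Delta g)
            (h1 ∙ (b ∙ g1) ⊗ h2 ∙ (x ∙ g2)).
  rewrite -hmulA DeltaM; apply: eq_sw => h1 h2.
  have bh : bilin (fun b1 b2 : H => h1 ∙ b1 ⊗ h2 ∙ b2).
    by apply: bilin_tpure_lin; exact: (hmul_bilin _).1.
  rewrite DeltaM sw_sw //; apply: eq_sw => b x.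
  by rewrite sw_sw //; apply: eq_sw => g1 g2; rewrite sw_tpure.
split=> // m.
pose f (a : H) (y : tens H H) := α a ⊗ y.
have bf : bilin f.
  by apply: (@bilin_tpure_lin _ _ _ _ _ _ id) => [|//]; exact: linearP.
have /(congr1 (fun z => sw z f)) := DeltaA m.
rewrite !sw_sw // => E.
transitivity (\sw_(c1, c2 <- Delta m) sw (α' c1 ⊗ Delta c2) f).
  apply: eq_sw => b x; rewrite sw_tpure // /f autVK {2}[Delta x]tens_sum -/(sw _ _).
  by rewrite (linear_sw (g := tpure b)) //; exact: (tpure_bilin _ _).1.
rewrite E; apply: eq_sw => x c; rewrite sw_sw //.
by apply: eq_sw => b y; rewrite sw_tpure.
Qed.

Definition unit_struct : bicov_struct H H :=
  BicovStruct unit_bimodule unit_left_comodule unit_right_comodule unit_bicovariant.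

Definition unit_bicov : bicov H := Bicov unit_struct.

End Unit.

Arguments unit_bicov {k} H.

Section TensorOverH.
Variables (k : comPzRingType) (H : homHopf k) (M N : bicov H).

Definition tensH_rel (t : tens M N) : Prop :=
  exists m h n, t = (m ◁ h) ⊗ n - mu M m ⊗ (h ▷ autV (mu N) n).

Definition tensH : lmodType k := quot tensH_rel.

Definition tpureH (m : M) (n : N) : tensH := qproj tensH_rel (m ⊗ n).

End TensorOverH.

Arguments tpureH {k H} M N m n.

Notation "m ⊗_[ M , N ] n" := (tpureH M N m n)
  (at level 40, left associativity, format "m  ⊗_[ M ,  N ]  n") : hom_scope.

(** A map out of [tensH M N] is determined by its values on the [m ⊗_[M, N] n],
  so that a structure satisfying the following equations is unique. *)
Definition is_tensH_struct (k : comPzRingType) (H : homHopf k) (M N : bicov H)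
    (B : bicov_struct H (tensH M N)) : Prop :=
  [/\ forall m n, s_mu B (m ⊗_[M, N] n) = mu M m ⊗_[M, N] mu N n,
      forall h m n, s_lact B h (m ⊗_[M, N] n)
        = (autV (alpha H) h ▷ m) ⊗_[M, N] mu N n,
      forall m n h, s_ract B (m ⊗_[M, N] n) h
        = mu M m ⊗_[M, N] (n ◁ autV (alpha H) h),
      forall m n, s_rho B (m ⊗_[M, N] n)
        = \sw_(a, x <- rho M m) \sw_(b, y <- rho N n)
            (a ∙ b ⊗ (x ⊗_[M, N] y)) &
      forall m n, s_sigma B (m ⊗_[M, N] n)
        = \sw_(x, a <- sigma M m) \sw_(y, b <- sigma N n)
            ((x ⊗_[M, N] y) ⊗ a ∙ b)].

Record category := Category {
  obj :> Type;
  hom : obj -> obj -> Type;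
  idm : forall X, hom X X;
  comp : forall X Y Z, hom Y Z -> hom X Y -> hom X Z;
  comp_idl : forall X Y (f : hom X Y), comp (idm Y) f = f;
  comp_idr : forall X Y (f : hom X Y), comp f (idm X) = f;
  compA : forall W X Y Z (h : hom Y Z) (g : hom X Y) (f : hom W X),
    comp h (comp g f) = comp (comp h g) f }.

Arguments hom {_} X Y.
Arguments idm {_} X.

Notation "g ∘ f" := (comp g f) (at level 40, left associativity) : hom_scope.

Record iso (C : category) (X Y : C) := Iso {
  fwd :> hom X Y;
  bwd : hom Y X;
  fwdK : bwd ∘ fwd = idm X;
  bwdK : fwd ∘ bwd = idm Y }.

Definition is_iso (C : category) (X Y : C) (f : hom X Y) : Prop :=
  exists g : hom Y X, g ∘ f = idm X /\ f ∘ g = idm Y.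

Record monoidal_on (C : category) (ten : C -> C -> C) (I : C) := MonoidalOn {
  tmor : forall X X' Y Y', hom X X' -> hom Y Y' -> hom (ten X Y) (ten X' Y');
  assoc : forall X Y Z, iso (ten (ten X Y) Z) (ten X (ten Y Z));
  lunit : forall X, iso (ten I X) X;
  runit : forall X, iso (ten X I) X;
  tmor_id : forall X Y, tmor (idm X) (idm Y) = idm (ten X Y);
  tmor_comp : forall X X' X'' Y Y' Y''
      (f' : hom X' X'') (f : hom X X') (g' : hom Y' Y'') (g : hom Y Y'),
    tmor (f' ∘ f) (g' ∘ g) = tmor f' g' ∘ tmor f g;
  assoc_nat : forall X X' Y Y' Z Z' (f : hom X X') (g : hom Y Y') (h : hom Z Z'),
    assoc X' Y' Z' ∘ tmor (tmor f g) h = tmor f (tmor g h) ∘ assoc X Y Z;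
  lunit_nat : forall X Y (f : hom X Y), lunit Y ∘ tmor (idm I) f = f ∘ lunit X;
  runit_nat : forall X Y (f : hom X Y), runit Y ∘ tmor f (idm I) = f ∘ runit X;
  pentagon : forall W X Y Z,
    tmor (idm W) (assoc X Y Z) ∘ assoc W (ten X Y) Z ∘ tmor (assoc W X Y) (idm Z)
    = assoc W X (ten Y Z) ∘ assoc (ten W X) Y Z;
  triangle : forall X Y,
    tmor (idm X) (lunit Y) ∘ assoc X I Y = tmor (runit X) (idm Y) }.

Record prebraiding (C : category) (ten : C -> C -> C) (I : C)
    (B : monoidal_on ten I) := Prebraiding {
  braid :> forall X Y, hom (ten X Y) (ten Y X);
  braid_nat : forall X X' Y Y' (f : hom X X') (g : hom Y Y'),
    braid X' Y' ∘ tmor B f g = tmor B g f ∘ braid X Y;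
  hexagon1 : forall X Y Z,
    assoc B Y Z X ∘ braid X (ten Y Z) ∘ assoc B X Y Z
    = tmor B (idm Y) (braid X Z) ∘ assoc B Y X Z ∘ tmor B (braid X Y) (idm Z);
  hexagon2 : forall X Y Z,
    bwd (assoc B Z X Y) ∘ braid (ten X Y) Z ∘ bwd (assoc B X Y Z)
    = tmor B (braid X Z) (idm Y) ∘ bwd (assoc B X Z Y)
        ∘ tmor B (idm X) (braid Y Z) }.

Definition is_braiding (C : category) (ten : C -> C -> C) (I : C)
    (B : monoidal_on ten I) (c : prebraiding B) : Prop :=
  forall X Y, is_iso (c X Y).

Section BicovCategory.
Variables (k : comPzRingType) (H : homHopf k).

Lemma bicov_comp_idl (M N : bicov H) (f : bicov_hom M N) :
  bicov_comp (bicov_id N) f = f.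
Proof. exact: bicov_hom_ext. Qed.

Lemma bicov_comp_idr (M N : bicov H) (f : bicov_hom M N) :
  bicov_comp f (bicov_id M) = f.
Proof. exact: bicov_hom_ext. Qed.

Lemma bicov_compA (M N P Q : bicov H)
  (h : bicov_hom P Q) (g : bicov_hom N P) (f : bicov_hom M N) :
  bicov_comp h (bicov_comp g f) = bicov_comp (bicov_comp h g) f.
Proof. exact: bicov_hom_ext. Qed.

Definition BicovCat : category :=
  Category bicov_comp_idl bicov_comp_idr bicov_compA.

End BicovCategory.

Arguments BicovCat {k} H.

(* Main.v *)
From HB Require Import structures.
Require Import Defs.
From mathcomp Require Import all_boot all_algebra.
From mathcomp Require Import boolp.

(** The structure automorphisms can be removed. Put [a ⋅ b = α^-1 (a b)],
  [Δ' = Δ α], [h ⊳ m = μ^-1 (h m)], [m ⊲ h = μ^-1 (m h)], [ρ' = ρ μ], [σ' = σ μ].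
  Then [H] becomes an ordinary Hopf algebra, [M] an ordinary bicovariant
  bimodule, and with [m ⊠ n = μ^-1 m ⊗_H ν^-1 n] the Hom-tensor product, its
  constraints and [c] take their ordinary form.

  In the ordinary setting [m = m_(-1) P_L(m_(0))] and [n = P_R(n_[0]) n_[1]],
  so [M ⊠ N] is generated as a bimodule by the [w ⊠ e] with [w] left invariant
  ([ρ w = 1 ⊗ w]) and [e] right invariant, and [c] is the bimodule map with
  [c (w ⊠ e) = e ⊠ w]. Colinearity, naturality and the hexagons need only be
  checked on such generators. If the antipode is bijective, the same construction
  over the co-opposite Hopf algebra, whose antipode is [S^-1], gives a bimodule
  map with [e ⊠ w |-> w ⊠ e], which is the inverse of [c]. *)

Set Implicit Arguments.
Unset Strict Implicit.
Unset Printing Implicit Defensive.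

Import GRing.Theory.
Local Open Scope ring_scope.
Local Open Scope hom_scope.

(** * Multilinearity and Sweedler sums *)

(** The explicit formula for [c] is the delicate point only where it must respect the balancing
    relation. There [P_L] turns the right action on [m] into an adjoint action, [P_R] does the same
    with the left action on [n], and both release the same factor [S h_2], once on each side of the
    tensor sign. After linearity is checked, the proofs use only the value on generators.

    A generator [w ⊠ e] is not mapped to generators by the coactions, but the two coactions commute:
    the second legs of [ρ e] may be taken right invariant, those of [σ w] left invariant. Invariants
    of one side are closed under [⊠], so in a triple product one can take two invariants of the same
    side next to each other, and each hexagon then compares two permutations of three vectors.

    Tensor products are treated through their universal property. One and the same quotient is
    thereby the tensor product over the given Hopf algebra, over the reversed one with the factors
    exchanged, and over the co-opposite one; left and right statements, as well as [c] and its
    inverse, come from a single proof each. *)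

Section Multilinear.
Variable k : comPzRingType.
Implicit Types M N P Q R : lmodType k.

Definition trilin M N P Q (f : M -> N -> P -> Q) :=
  [/\ forall n p, linear (fun m => f m n p),
      forall m p, linear (fun n => f m n p) &
      forall m n, linear (f m n)].

Lemma linear_id M : linear (fun x : M => x).
Proof. by []. Qed.

Lemma linear_comp M N P (g : N -> P) (f : M -> N) :
  linear g -> linear f -> linear (fun x => g (f x)).
Proof. by move=> lg lf a x y; rewrite lf lg. Qed.

Lemma bilin_compl M N P Q (op : N -> P -> Q) (f : M -> N) z :
  bilin op -> linear f -> linear (fun x => op (f x) z).
Proof. by move=> [_ b] lf; exact: (linear_comp (b z)). Qed.

Lemma bilin_compr M N P Q (op : P -> N -> Q) (f : M -> N) z :
  bilin op -> linear f -> linear (fun x => op z (f x)).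
Proof. by move=> [b _] lf; exact: (linear_comp (b z)). Qed.

Lemma bilin_linr M N P (op : M -> N -> P) z : bilin op -> linear (op z).
Proof. by case. Qed.

Lemma trilin_comp1 M N P Q R (op : M -> N -> P -> Q) (f : R -> M) y z :
  trilin op -> linear f -> linear (fun x => op (f x) y z).
Proof. by move=> [b _ _] lf; exact: (linear_comp (b y z)). Qed.

Lemma trilin_comp2 M N P Q R (op : M -> N -> P -> Q) (f : R -> N) y z :
  trilin op -> linear f -> linear (fun x => op y (f x) z).
Proof. by move=> [_ b _] lf; exact: (linear_comp (b y z)). Qed.

Lemma trilin_comp3 M N P Q R (op : M -> N -> P -> Q) (f : R -> P) y z :
  trilin op -> linear f -> linear (fun x => op y z (f x)).
Proof. by move=> [_ _ b] lf; exact: (linear_comp (b y z)). Qed.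

Lemma scalel_linear M N (e : {scalar M}) (n : N) : linear (fun x => e x *: n).
Proof. by move=> a x y; rewrite linearP scalerDl scalerA. Qed.

Lemma scaler_linear N (c : k) : linear (fun x : N => c *: x).
Proof. by move=> a x y; rewrite scalerDr !scalerA mulrC. Qed.

Lemma linear_sw_arg M N P Q (x : M -> tens N P) (f : N -> P -> Q) :
  linear x -> bilin f -> linear (fun m => sw (x m) f).
Proof. by move=> lx bf; exact: (linear_comp (sw_linear bf)). Qed.

Definition mklin M N (f : M -> N) (lf : linear f) : {linear M -> N} :=
  HB.pack f (GRing.isLinear.Build k M N *:%R f lf).

End Multilinear.

Create HintDb multilin.
#[export] Hint Extern 1 (bilin (@tpure ?k ?M ?N)) => exact (@tpure_bilin k M N) : multilin.


(* Decides multilinearity by recursion on the term, in which the variable must occur exactly once. *)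
Ltac lin_known := solve [assumption | exact: linearP | auto with multilin nocore].
Ltac lin :=
  cbv beta;
  lazymatch goal with
  | |- trilin _ => split=> ? ?; lin
  | |- bilin _ => first [lin_known | split=> ?; lin]
  | |- GRing.linear_for _ (fun x => x) => exact: linear_id
  | |- GRing.linear_for _ (fun x => sw _ _) =>
      tryif apply: linear_sw_param then move=> ? ?; lin
      else (apply: linear_sw_arg; lin)
  | |- GRing.linear_for _ (fun x => _ *: _) =>
      tryif apply: (linear_comp (scaler_linear _)) then lin
      else (apply: (linear_comp (scalel_linear _ _)); lin)
  | |- GRing.linear_for _ (fun x => _ _) =>
      first [ apply: bilin_compr; [lin_known | lin]
            | apply: bilin_compl; [lin_known | lin]
            | apply: linear_comp; [lin_known | lin]
            | apply: trilin_comp3; [assumption | lin]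
            | apply: trilin_comp2; [assumption | lin]
            | apply: trilin_comp1; [assumption | lin]]
  | |- GRing.linear_for ?s ?f =>
      first [ lin_known | apply: bilin_linr; lin_known
            | change (GRing.linear_for s (fun x => f x)); lin]
  end.

Section Flip.
Variables (k : comPzRingType) (M N : lmodType k).

Definition flip_fun (x : tens M N) : tens N M := \sw_(a, b <- x) (b ⊗ a).

Lemma flip_linear : linear flip_fun.
Proof. by rewrite /flip_fun; lin. Qed.

Definition flip : {linear tens M N -> tens N M} := mklin flip_linear.

Lemma sw_flip (P : lmodType k) (f : N -> M -> P) (x : tens M N) :
  bilin f -> \sw_(b, a <- flip x) f b a = \sw_(a, b <- x) f b a.
Proof.
move=> bf; rewrite /flip /= /flip_fun sw_sw //.
by apply: eq_sw => a b; rewrite sw_tpure.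
Qed.

End Flip.

(* Sweedler variables are bound, so plain [rewrite] does not reach terms that mention them. This
   rewrites the left-hand side under [n] nested sums and leaves the resulting equation as the
   goal. *)
Tactic Notation "sw_at" int_or_var(n) tactic3(tac) :=
  etransitivity; [do n (apply: eq_sw => ? ?); tac; reflexivity | cbv beta].

Lemma flipK (k : comPzRingType) (M N : lmodType k) : cancel (flip M N) (flip N M).
Proof.
move=> x; rewrite [LHS]sw_flip; last by lin.
by rewrite [RHS]tens_sum.
Qed.

Lemma flip_tpure (k : comPzRingType) (M N : lmodType k) (m : M) (n : N) :
  flip M N (m ⊗ n) = n ⊗ m.
Proof. by rewrite /= /flip_fun sw_tpure //; lin. Qed.

Section MoreSw.
Variables (k : comPzRingType).
Implicit Types M N P Q : lmodType k.

Lemma exchange_sw M N M' N' P (x : tens M N) (y : tens M' N')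
  (f : M -> N -> M' -> N' -> P) :
  \sw_(a, b <- x) \sw_(c, d <- y) f a b c d =
  \sw_(c, d <- y) \sw_(a, b <- x) f a b c d.
Proof. exact: exchange_big. Qed.

Lemma tens_id M N (x : tens M N) : \sw_(a, b <- x) (a ⊗ b) = x.
Proof. by rewrite [RHS]tens_sum. Qed.

Lemma bilin_swl M N M' N' P (op : M -> N -> P) (x : tens M' N') f z :
  bilin op -> op (sw x f) z = \sw_(a, b <- x) op (f a b) z.
Proof. by move=> [_ b]; rewrite (linear_sw _ _ (b z)). Qed.

Lemma bilin_swr M N M' N' P (op : M -> N -> P) (x : tens M' N') f z :
  bilin op -> op z (sw x f) = \sw_(a, b <- x) op z (f a b).
Proof. by move=> [b _]; rewrite (linear_sw _ _ (b z)). Qed.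

Lemma linear_scale M N (f : M -> N) c x : linear f -> f (c *: x) = c *: f x.
Proof. by move=> lf; rewrite -[f]/(mklin lf : M -> N) linearZ. Qed.

Lemma scaler_swr M N P (c : k) (f : M -> N -> P) (x : tens M N) :
  c *: sw x f = \sw_(a, b <- x) (c *: f a b).
Proof. by rewrite (linear_sw (g := *:%R c)) //; exact: scaler_linear. Qed.

End MoreSw.

(* Coassociativity is stated applied to trilinear maps: it then rewrites inside Sweedler sums and passes to opposite structures by permuting arguments. *)
Record hopf (k : comPzRingType) := Hopf {
  hopf_car :> lmodType k;
  mul : hopf_car -> hopf_car -> hopf_car;
  unt : hopf_car;
  cop : {linear hopf_car -> tens hopf_car hopf_car};
  cou : {scalar hopf_car};
  anti : {linear hopf_car -> hopf_car};
  mul_bilin : bilin mul;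
  hopfA : forall a b c, mul a (mul b c) = mul (mul a b) c;
  hopf1l : forall a, mul unt a = a;
  hopf1r : forall a, mul a unt = a;
  copA : forall (P : lmodType k) (f : hopf_car -> hopf_car -> hopf_car -> P) h,
    trilin f ->
    \sw_(a, b <- cop h) \sw_(c, d <- cop a) f c d b
    = \sw_(a, b <- cop h) \sw_(c, d <- cop b) f a c d;
  cou_l : forall h, \sw_(a, b <- cop h) (cou a *: b) = h;
  cou_r : forall h, \sw_(a, b <- cop h) (cou b *: a) = h;
  cop_mul : forall a b, cop (mul a b) =
    \sw_(a1, a2 <- cop a) \sw_(b1, b2 <- cop b) (mul a1 b1 ⊗ mul a2 b2);
  cop_one : cop unt = unt ⊗ unt;
  cou_mul : forall a b, cou (mul a b) = cou a * cou b;
  cou_one : cou unt = 1;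
  anti_l : forall h, \sw_(a, b <- cop h) mul (anti a) b = cou h *: unt;
  anti_r : forall h, \sw_(a, b <- cop h) mul a (anti b) = cou h *: unt }.

Arguments cop {k _}.
Arguments cou {k _}.
Arguments unt {k} _.
Arguments anti {k} _.
#[export] Hint Extern 1 (bilin (@mul ?k ?K)) => exact (@mul_bilin k K) : multilin.

Notation "a ⋅ b" := (mul a b) (at level 39, left associativity) : hom_scope.

Record bimod (k : comPzRingType) (K : hopf k) := Bimod {
  bimod_car :> lmodType k;
  bl : K -> bimod_car -> bimod_car;
  br : bimod_car -> K -> bimod_car;
  brho : {linear bimod_car -> tens K bimod_car};
  bsigma : {linear bimod_car -> tens bimod_car K};
  bl_bilin : bilin bl;
  br_bilin : bilin br;
  blA : forall g h m, bl g (bl h m) = bl (g ⋅ h) m;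
  bl1 : forall m, bl (unt K) m = m;
  brA : forall m g h, br (br m g) h = br m (g ⋅ h);
  br1 : forall m, br m (unt K) = m;
  blrA : forall g m h, br (bl g m) h = bl g (br m h);
  brhoA : forall (P : lmodType k) (f : K -> K -> bimod_car -> P) m, trilin f ->
    \sw_(h, x <- brho m) \sw_(a, b <- cop h) f a b x
    = \sw_(h, x <- brho m) \sw_(g, y <- brho x) f h g y;
  brho_cou : forall m, \sw_(h, x <- brho m) (cou h *: x) = m;
  bsigmaA : forall (P : lmodType k) (f : bimod_car -> K -> K -> P) m, trilin f ->
    \sw_(x, h <- bsigma m) \sw_(a, b <- cop h) f x a b
    = \sw_(x, h <- bsigma m) \sw_(y, g <- bsigma x) f y g h;
  bsigma_cou : forall m, \sw_(x, h <- bsigma m) (cou h *: x) = m;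
  brho_l : forall h m, brho (bl h m) =
    \sw_(h1, h2 <- cop h) \sw_(a, x <- brho m) (h1 ⋅ a ⊗ bl h2 x);
  brho_r : forall m h, brho (br m h) =
    \sw_(a, x <- brho m) \sw_(h1, h2 <- cop h) (a ⋅ h1 ⊗ br x h2);
  bsigma_l : forall h m, bsigma (bl h m) =
    \sw_(h1, h2 <- cop h) \sw_(x, a <- bsigma m) (bl h1 x ⊗ h2 ⋅ a);
  bsigma_r : forall m h, bsigma (br m h) =
    \sw_(x, a <- bsigma m) \sw_(h1, h2 <- cop h) (br x h1 ⊗ a ⋅ h2);
  brho_sigma : forall (P : lmodType k) (f : K -> bimod_car -> K -> P) m, trilin f ->
    \sw_(h, x <- brho m) \sw_(y, g <- bsigma x) f h y g
    = \sw_(x, g <- bsigma m) \sw_(h, y <- brho x) f h y g }.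

Arguments brho {k K} _.
Arguments bsigma {k K} _.
Arguments brhoA {k K} _ {P}.
Arguments bsigmaA {k K} _ {P}.
#[export] Hint Extern 1 (bilin (@bl ?k ?K ?M)) => exact (@bl_bilin k K M) : multilin.
#[export] Hint Extern 1 (bilin (@br ?k ?K ?M)) => exact (@br_bilin k K M) : multilin.

Notation "h ⊳ m" := (bl h m) (at level 39, left associativity) : hom_scope.
Notation "m ⊲ h" := (br m h) (at level 39, left associativity) : hom_scope.

(** * Structure equations evaluated by multilinear maps *)

Section Applied.
Variables (k : comPzRingType) (K : hopf k).
Implicit Types P Q : lmodType k.

Lemma sw_cop_mul P (f : K -> K -> P) a b : bilin f ->
  \sw_(c, d <- cop (a ⋅ b)) f c d =
  \sw_(a1, a2 <- cop a) \sw_(b1, b2 <- cop b) f (a1 ⋅ b1) (a2 ⋅ b2).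
Proof.
move=> bf; rewrite cop_mul sw_sw //; apply: eq_sw => ? ?.
by rewrite sw_sw //; apply: eq_sw => ? ?; rewrite sw_tpure.
Qed.

Lemma sw_cou_l P (f : K -> P) h : linear f ->
  \sw_(a, b <- cop h) (cou a *: f b) = f h.
Proof.
move=> lf; rewrite -[in RHS](cou_l h) (linear_sw _ _ lf).
by apply: eq_sw => a b; rewrite (linear_scale _ _ lf).
Qed.

Lemma sw_cou_r P (f : K -> P) h : linear f ->
  \sw_(a, b <- cop h) (cou b *: f a) = f h.
Proof.
move=> lf; rewrite -[in RHS](cou_r h) (linear_sw _ _ lf).
by apply: eq_sw => a b; rewrite (linear_scale _ _ lf).
Qed.

Variable M : bimod K.

Lemma sw_brho_cou P (f : M -> P) m : linear f ->
  \sw_(a, b <- brho M m) (cou a *: f b) = f m.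
Proof.
move=> lf; rewrite -[in RHS](brho_cou m) (linear_sw _ _ lf).
by apply: eq_sw => a b; rewrite (linear_scale _ _ lf).
Qed.

Lemma sw_brho_l P (f : K -> M -> P) h m : bilin f ->
  \sw_(b, y <- brho M (h ⊳ m)) f b y =
  \sw_(h1, h2 <- cop h) \sw_(a, x <- brho M m) f (h1 ⋅ a) (h2 ⊳ x).
Proof.
move=> bf; rewrite brho_l sw_sw //; apply: eq_sw => ? ?.
by rewrite sw_sw //; apply: eq_sw => ? ?; rewrite sw_tpure.
Qed.

Lemma sw_brho_r P (f : K -> M -> P) h m : bilin f ->
  \sw_(b, y <- brho M (m ⊲ h)) f b y =
  \sw_(a, x <- brho M m) \sw_(h1, h2 <- cop h) f (a ⋅ h1) (x ⊲ h2).
Proof.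
move=> bf; rewrite brho_r sw_sw //; apply: eq_sw => ? ?.
by rewrite sw_sw //; apply: eq_sw => ? ?; rewrite sw_tpure.
Qed.

Lemma sw_bsigma_l P (f : M -> K -> P) h m : bilin f ->
  \sw_(y, b <- bsigma M (h ⊳ m)) f y b =
  \sw_(h1, h2 <- cop h) \sw_(x, a <- bsigma M m) f (h1 ⊳ x) (h2 ⋅ a).
Proof.
move=> bf; rewrite bsigma_l sw_sw //; apply: eq_sw => ? ?.
by rewrite sw_sw //; apply: eq_sw => ? ?; rewrite sw_tpure.
Qed.

Lemma sw_bsigma_r P (f : M -> K -> P) h m : bilin f ->
  \sw_(y, b <- bsigma M (m ⊲ h)) f y b =
  \sw_(x, a <- bsigma M m) \sw_(h1, h2 <- cop h) f (x ⊲ h1) (a ⋅ h2).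
Proof.
move=> bf; rewrite bsigma_r sw_sw //; apply: eq_sw => ? ?.
by rewrite sw_sw //; apply: eq_sw => ? ?; rewrite sw_tpure.
Qed.

End Applied.

(** * The antipode reverses products *)

Section Antipode.
Variables (k : comPzRingType) (K : hopf k).
Local Notation S := (anti K).
Local Notation mulb := (@mul_bilin k K).

Lemma anti_one : S (unt K) = unt K.
Proof.
have := anti_l (unt K); rewrite cop_one sw_tpure; last by lin.
by rewrite hopf1r cou_one scale1r.
Qed.

(** In the convolution algebra of maps from [K ⊗ K] to [K], the map sending [a ⊗ b] to [S b ⋅ S a]
    is a right inverse of the product: [e ⋅ S f] collapses first, then [c ⋅ S d]. *)
Lemma mul_anti_mul a b :
  \sw_(c, d <- cop a) \sw_(e, f <- cop b) ((c ⋅ e) ⋅ (S f ⋅ S d))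
  = cou a *: (cou b *: unt K).
Proof.
transitivity (\sw_(c, d <- cop a) (cou b *: (c ⋅ S d))).
  apply: eq_sw => c d; transitivity ((c ⋅ (\sw_(e, f <- cop b) (e ⋅ S f))) ⋅ S d).
    rewrite (bilin_swr _ _ _ mulb) (bilin_swl _ _ _ mulb).
    by apply: eq_sw => e f; rewrite !hopfA.
  by rewrite anti_r (bilinZr mulb) hopf1r (bilinZl mulb).
by rewrite -scaler_swr anti_r !scalerA mulrC.
Qed.

(* Both sides are convolution inverses of the product. *)
Lemma anti_mul a b : S (a ⋅ b) = S b ⋅ S a.
Proof.
transitivity (\sw_(a1, a2 <- cop a) \sw_(b1, b2 <- cop b)
    \sw_(c, d <- cop a2) \sw_(e, f <- cop b2)
    (S (a1 ⋅ b1) ⋅ ((c ⋅ e) ⋅ (S f ⋅ S d)))).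
  rewrite -[LHS](@sw_cou_r k K _ (fun a : K => S (a ⋅ b))); last by lin.
  apply: eq_sw => a1 a2.
  rewrite -[S _](@sw_cou_r k K _ (fun b : K => S (a1 ⋅ b))); last by lin.
  rewrite scaler_swr; apply: eq_sw => b1 b2.
  transitivity (S (a1 ⋅ b1) ⋅ (cou a2 *: (cou b2 *: unt K))).
    by rewrite !(bilinZr mulb) hopf1r.
  rewrite -mul_anti_mul (bilin_swr _ _ _ mulb); apply: eq_sw => c d.
  by rewrite (bilin_swr _ _ _ mulb).
transitivity (\sw_(a1, a2 <- cop a) \sw_(b1, b2 <- cop b)
    \sw_(c, d <- cop a1) \sw_(e, f <- cop b1)
    ((S (c ⋅ e) ⋅ (d ⋅ f)) ⋅ (S b2 ⋅ S a2))).
  sw_at 1 (rewrite exchange_sw).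
  rewrite -(copA (f := fun a1 c d : K => \sw_(b1, b2 <- cop b)
    \sw_(e, f <- cop b2) (S (a1 ⋅ b1) ⋅ ((c ⋅ e) ⋅ (S f ⋅ S d))))); last by lin.
  apply: eq_sw => a1 a2; rewrite [RHS]exchange_sw; apply: eq_sw => c d.
  rewrite -(copA (f := fun b1 e f : K => (S (c ⋅ b1) ⋅ ((d ⋅ e) ⋅ (S f ⋅ S a2))))); last by lin.
  by do 2 (apply: eq_sw => ? ?); rewrite !hopfA.
rewrite -[RHS](@sw_cou_l k K _ (fun a : K => S b ⋅ S a)); last by lin.
apply: eq_sw => a1 a2.
rewrite -[S b ⋅ _](@sw_cou_l k K _ (fun b : K => S b ⋅ S a2)); last by lin.
rewrite scaler_swr; apply: eq_sw => b1 b2.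
transitivity ((\sw_(x, y <- cop (a1 ⋅ b1)) S x ⋅ y) ⋅ (S b2 ⋅ S a2)).
  rewrite sw_cop_mul; last by lin.
  rewrite (bilin_swl _ _ _ mulb); apply: eq_sw => c d.
  by rewrite (bilin_swl _ _ _ mulb).
by rewrite anti_l cou_mul !(bilinZl mulb) hopf1l scalerA.
Qed.

End Antipode.

(* Reversing products and coproducts exchanges left and right, with the same antipode. *)
Section Rev.
Variables (k : comPzRingType) (K : hopf k).

Let mul' (a b : K) : K := b ⋅ a.

Let mul'_bilin : bilin mul'.
Proof. by split=> ?; rewrite /mul'; lin. Qed.

Let cop' : {linear K -> tens K K} := flip K K \o cop.

Let sw_cop' (P : lmodType k) (f : K -> K -> P) h :
  bilin f -> \sw_(a, b <- cop' h) f a b = \sw_(a, b <- @cop k K h) f b a.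
Proof. by move=> bf; rewrite /cop' /= sw_flip. Qed.

(** Left transparent, so that the carrier and the operations convert to those of [K]. Statements
    about [K] are then read off from statements about the reversed algebra by conversion. *)
Definition hopf_rev : hopf k.
Proof.
refine (@Hopf k K mul' (unt K) cop' cou (anti K) mul'_bilin _ _ _ _ _ _ _ _ _ _ _ _).
- by move=> a b c; rewrite /mul' hopfA.
- by move=> a; exact: hopf1r.
- by move=> a; exact: hopf1l.
- move=> P f h tf.
  rewrite !sw_cop'; try by lin.
  sw_at 1 (rewrite sw_cop'; last by lin).
  rewrite -(copA (f := fun b d c => f c d b)); last by lin.
  by symmetry; sw_at 1 (rewrite sw_cop'; last by lin).
- by move=> h; rewrite sw_cop' ?cou_r //; lin.
- by move=> h; rewrite sw_cop' ?cou_l //; lin.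
- move=> a b; rewrite /cop' /mul' /= cop_mul /flip_fun.
  rewrite sw_sw; last by lin.
  sw_at 1 (rewrite sw_sw; last by lin).
  sw_at 2 (rewrite sw_tpure; last by lin).
  rewrite sw_sw; last by lin.
  symmetry.
  sw_at 1 (rewrite sw_tpure; last by lin).
  sw_at 1 (rewrite sw_sw; last by lin).
  sw_at 2 (rewrite sw_tpure; last by lin).
  by rewrite exchange_sw.
- by rewrite /cop' /= /flip_fun cop_one sw_tpure //; lin.
- by move=> a b; rewrite /mul' cou_mul mulrC.
- exact: cou_one.
- by move=> h; rewrite sw_cop' ?anti_r //; lin.
- by move=> h; rewrite sw_cop' ?anti_l //; lin.
Defined.

Variable M : bimod K.

Let rho' : {linear M -> tens K M} := flip M K \o bsigma M.
Let sigma' : {linear M -> tens M K} := flip K M \o brho M.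

Let sw_rho' (P : lmodType k) (f : K -> M -> P) m :
  bilin f -> \sw_(a, x <- rho' m) f a x = \sw_(x, a <- bsigma M m) f a x.
Proof. by move=> bf; rewrite /rho' /= sw_flip. Qed.

Let sw_sigma' (P : lmodType k) (f : M -> K -> P) m :
  bilin f -> \sw_(x, a <- sigma' m) f x a = \sw_(a, x <- brho M m) f x a.
Proof. by move=> bf; rewrite /sigma' /= sw_flip. Qed.

Let rho'_l : forall (h : K) m, rho' (m ⊲ h) =
    \sw_(h1, h2 <- cop' h) \sw_(a, x <- rho' m) (mul' h1 a ⊗ x ⊲ h2).
Proof.
move=> h m; rewrite -[LHS]tens_id sw_rho'; last by lin.
  rewrite sw_bsigma_r; last by lin.
  rewrite sw_cop'; last by lin.
  by rewrite exchange_sw; apply: eq_sw => h2 h1; rewrite sw_rho' //; lin.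
Qed.

Let rho'_r : forall m (h : K), rho' (h ⊳ m) =
    \sw_(a, x <- rho' m) \sw_(h1, h2 <- cop' h) (mul' a h1 ⊗ h2 ⊳ x).
Proof.
move=> m h; rewrite -[LHS]tens_id sw_rho'; last by lin.
  rewrite sw_bsigma_l; last by lin.
  rewrite sw_rho'; last by lin.
  by rewrite exchange_sw; apply: eq_sw => h2 h1; rewrite sw_cop' //; lin.
Qed.

Let sigma'_l : forall (h : K) m, sigma' (m ⊲ h) =
    \sw_(h1, h2 <- cop' h) \sw_(x, a <- sigma' m) (x ⊲ h1 ⊗ mul' h2 a).
Proof.
move=> h m; rewrite -[LHS]tens_id sw_sigma'; last by lin.
  rewrite sw_brho_r; last by lin.
  rewrite sw_cop'; last by lin.
  by rewrite exchange_sw; apply: eq_sw => h2 h1; rewrite sw_sigma' //; lin.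
Qed.

Let sigma'_r : forall m (h : K), sigma' (h ⊳ m) =
    \sw_(x, a <- sigma' m) \sw_(h1, h2 <- cop' h) (h1 ⊳ x ⊗ mul' a h2).
Proof.
move=> m h; rewrite -[LHS]tens_id sw_sigma'; last by lin.
  rewrite sw_brho_l; last by lin.
  rewrite sw_sigma'; last by lin.
  by rewrite exchange_sw; apply: eq_sw => h2 h1; rewrite sw_cop' //; lin.
Qed.

Definition bimod_rev : bimod hopf_rev.
Proof.
refine (@Bimod k hopf_rev M (fun (h : K) (m : M) => m ⊲ h) (fun (m : M) (h : K) => h ⊳ m) rho' sigma'
  _ _ _ _ _ _ _ _ _ _ _ _ _ _ _ _).
- by have [? ?] := @br_bilin k K M; split.
- by have [? ?] := @bl_bilin k K M; split.
- by move=> g h m; rewrite brA.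
- by move=> m; rewrite br1.
- by move=> m g h; rewrite blA.
- by move=> m; rewrite bl1.
- by move=> g m h; rewrite blrA.
- move=> P f m tf.
  rewrite !sw_rho'; try by lin.
  sw_at 1 (rewrite sw_cop'; last by lin).
  rewrite (bsigmaA (K := K) M (fun x b a => f a b x)); last by lin.
  by symmetry; sw_at 1 (rewrite sw_rho'; last by lin).
- by move=> m; rewrite sw_rho' ?bsigma_cou //; lin.
- move=> P f m tf.
  rewrite !sw_sigma'; try by lin.
  sw_at 1 (rewrite sw_cop'; last by lin).
  rewrite (brhoA (K := K) M (fun b a x => f x a b)); last by lin.
  by symmetry; sw_at 1 (rewrite sw_sigma'; last by lin).
- by move=> m; rewrite sw_sigma' ?brho_cou //; lin.
- exact: rho'_l.
- exact: rho'_r.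
- exact: sigma'_l.
- exact: sigma'_r.
- move=> P f m tf.
  rewrite sw_rho' ?sw_sigma'; try by lin.
  sw_at 1 (rewrite sw_sigma'; last by lin).
  rewrite -(brho_sigma (b := M) (f := fun h y g => f g y h)); last by lin.
  by symmetry; sw_at 1 (rewrite sw_rho'; last by lin).
Defined.

Lemma sw_cop_rev (P : lmodType k) (f : K -> K -> P) h : bilin f ->
  \sw_(a, b <- @cop k hopf_rev h) f a b = \sw_(a, b <- @cop k K h) f b a.
Proof. exact: (@sw_cop' P f h). Qed.

Lemma sw_brho_rev (P : lmodType k) (f : K -> M -> P) m : bilin f ->
  \sw_(a, x <- brho bimod_rev m) f a x = \sw_(x, a <- bsigma M m) f a x.
Proof. exact: (@sw_rho' P f m). Qed.

End Rev.

Arguments hopf_rev {k} K.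
Arguments bimod_rev {k K} M.

(** * Invariants *)

Section LeftInvariants.
Variables (k : comPzRingType) (K : hopf k) (M : bimod K).
Local Notation S := (anti K).

Definition PL (m : M) : M := \sw_(h, x <- brho M m) (S h ⊳ x).
Definition PR (m : M) : M := \sw_(x, h <- bsigma M m) (x ⊲ S h).

Lemma PL_linear : linear PL.
Proof. by rewrite /PL; lin. Qed.

Definition linv (m : M) := brho M m = unt K ⊗ m.
Definition rinv (m : M) := bsigma M m = m ⊗ unt K.

(** [S (h1 ⋅ a)] is [S a ⋅ S h1], which brings [S h1] next to [h2], where they cancel. *)
Lemma PL_l h m : PL (h ⊳ m) = cou h *: PL m.
Proof.
rewrite /PL sw_brho_l; last by lin.
rewrite exchange_sw scaler_swr; apply: eq_sw => a x.
transitivity (S a ⊳ ((\sw_(h1, h2 <- cop h) (S h1 ⋅ h2)) ⊳ x)).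
  rewrite (bilin_swl _ _ _ (@bl_bilin _ _ M)) (bilin_swr _ _ _ (@bl_bilin _ _ M)).
  by apply: eq_sw => h1 h2; rewrite anti_mul !blA hopfA.
by rewrite anti_l (bilinZl (@bl_bilin _ _ M)) bl1 (bilinZr (@bl_bilin _ _ M)).
Qed.

(** [PL] carries the right action to the right adjoint action. The factor [S h1] that appears here
    is what makes the prebraiding balanced. *)
Lemma PL_r m h : PL (m ⊲ h) = \sw_(h1, h2 <- cop h) (S h1 ⊳ (PL m ⊲ h2)).
Proof.
rewrite {1}/PL sw_brho_r; last by lin.
rewrite exchange_sw; apply: eq_sw => h1 h2.
rewrite /PL (bilin_swl _ _ _ (@br_bilin _ _ M)) (bilin_swr _ _ _ (@bl_bilin _ _ M)).
by apply: eq_sw => a x; rewrite anti_mul blrA !blA.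
Qed.

(** By coassociativity the coefficients are [a ⋅ S b] over the coproduct of the first leg, and the
    antipode reduces them to the counit. *)
Lemma PL_dec m : \sw_(a, x <- brho M m) (a ⊳ PL x) = m.
Proof.
transitivity (\sw_(h, x <- brho M m) \sw_(a, b <- cop h) (a ⊳ (S b ⊳ x))).
  rewrite (brhoA _ (fun a b x => a ⊳ (S b ⊳ x))); last by lin.
  by apply: eq_sw => a x; rewrite (bilin_swr _ _ _ (@bl_bilin _ _ M)).
rewrite -[RHS]brho_cou; apply: eq_sw => h x.
transitivity ((\sw_(a, b <- cop h) (a ⋅ S b)) ⊳ x).
  rewrite (bilin_swl _ _ _ (@bl_bilin _ _ M)).
  by apply: eq_sw => a b; rewrite blA.
by rewrite anti_r (bilinZl (@bl_bilin _ _ M)) bl1.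
Qed.

(** The operation that turns [u] into the map sending [m] to the sum of [L a (u x)] over the
    coaction of [m] is injective: it is undone by the same sum with [S a] in place of [a]. Comparing
    after this operation spares [linv_PL] the coproduct of an antipode. *)
Lemma coaction_cancel (W : lmodType k) (L : K -> W -> W) (f g : M -> W) m :
  bilin L -> (forall h h' w, L h (L h' w) = L (h ⋅ h') w) ->
  (forall w, L (unt K) w = w) -> linear f -> linear g ->
  (forall m, \sw_(a, x <- brho M m) L a (f x) = \sw_(a, x <- brho M m) L a (g x)) ->
  f m = g m.
Proof.
move=> bL LA L1.
have expand (u : M -> W) : linear u ->
    u m = \sw_(a, x <- brho M m) L (S a) (\sw_(b, y <- brho M x) L b (u y)).
  move=> lu; rewrite -[LHS](sw_brho_cou (f := u)) //.
  transitivity (\sw_(h, x <- brho M m) \sw_(a, b <- cop h) L (S a) (L b (u x))).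
    apply: eq_sw => h x; rewrite -[u x in LHS]L1 -(bilinZl bL) -anti_l.
    by rewrite (bilin_swl _ _ _ bL); apply: eq_sw => a b; rewrite LA.
  rewrite (brhoA _ (fun a b x => L (S a) (L b (u x)))); last by lin.
  by apply: eq_sw => a x; rewrite (bilin_swr _ _ _ bL).
move=> lf lg fg; rewrite (expand f) // (expand g) //.
by apply: eq_sw => a x; rewrite fg.
Qed.

(** The diagonal action of [K] on [K ⊗ M], for which the left coaction is left linear. *)
Definition ldiag (h : K) (t : tens K M) : tens K M :=
  \sw_(h1, h2 <- cop h) \sw_(a, x <- t) (h1 ⋅ a ⊗ h2 ⊳ x).

Lemma ldiag_bilin : bilin ldiag.
Proof. by split=> ?; rewrite /ldiag; lin. Qed.

Lemma ldiagA h h' t : ldiag h (ldiag h' t) = ldiag (h ⋅ h') t.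
Proof.
rewrite /ldiag sw_cop_mul; last by lin.
apply: eq_sw => h1 h2; rewrite sw_sw; last by lin.
apply: eq_sw => h1' h2'; rewrite sw_sw; last by lin.
by apply: eq_sw => a x; rewrite sw_tpure; [rewrite hopfA blA | lin].
Qed.

Lemma ldiag1 t : ldiag (unt K) t = t.
Proof.
rewrite /ldiag cop_one sw_tpure; last by lin.
by sw_at 1 (rewrite hopf1l bl1); rewrite tens_id.
Qed.

(** Acted on diagonally by the first leg of the coaction, [brho M (PL m)] and [unt K ⊗ PL m] both
    become [brho M m]: the first by linearity of the coaction, the second by coassociativity, and
    each with [PL_dec]. *)
Lemma linv_PL m : linv (PL m).
Proof.
apply: (coaction_cancel (L := ldiag) (f := fun m => brho M (PL m))
  (g := fun m => unt K ⊗ PL m)).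
- exact: ldiag_bilin.
- exact: ldiagA.
- exact: ldiag1.
- by have lPL := PL_linear; lin.
- by have lPL := PL_linear; lin.
move=> {}m; have lPL := PL_linear.
transitivity (brho M m).
  rewrite -[in RHS](PL_dec m) (linear_sw _ _ (linearP _)).
  by apply: eq_sw => a x; rewrite brho_l.
transitivity (\sw_(h, x <- brho M m) \sw_(a, b <- cop h) (a ⊗ b ⊳ PL x)); last first.
  apply: eq_sw => a x; apply: eq_sw => b y.
  by rewrite sw_tpure ?hopf1r //; lin.
rewrite (brhoA _ (fun a b x => a ⊗ b ⊳ PL x)); last by lin.
rewrite -[LHS]tens_id; apply: eq_sw => a x.
by rewrite -[in LHS](PL_dec x) (bilin_swr _ _ _ (@tpure_bilin _ _ _)).
Qed.

Lemma PL_linv m : linv m -> PL m = m.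
Proof. by move=> h; rewrite /PL h sw_tpure ?anti_one ?bl1 //; lin. Qed.

Lemma PR_linear : linear PR.
Proof. by rewrite /PR; lin. Qed.

(** The left coaction of a right invariant vector has right invariant second legs. Single legs
    depend on the representative of the tensor, so this is expressed by the freedom to insert [PR].
    The coactions commute, and on [m ⊗ unt K] the inserted action is that of [S 1 = 1]. *)
Lemma sw_brho_PR (P : lmodType k) (f : K -> M -> P) m : bilin f -> rinv m ->
  \sw_(h, x <- brho M m) f h (PR x) = \sw_(h, x <- brho M m) f h x.
Proof.
move=> bf h.
transitivity (\sw_(h, x <- brho M m) \sw_(y, g <- bsigma M x) f h (y ⊲ S g)).
  by apply: eq_sw => a x; rewrite (bilin_swr _ _ _ bf).
rewrite (brho_sigma (b := M) (f := fun h y g => f h (y ⊲ S g))); last by lin.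
rewrite h sw_tpure; last by lin.
by apply: eq_sw => a x; rewrite anti_one br1.
Qed.

End LeftInvariants.

Arguments PL {k K} M.
Arguments PR {k K} M.
#[export] Hint Extern 1 (GRing.linear_for _ (@PL ?k ?K ?M)) => exact (@PL_linear k K M) : multilin.
#[export] Hint Extern 1 (GRing.linear_for _ (@PR ?k ?K ?M)) => exact (@PR_linear k K M) : multilin.

(** * Right invariants, by reversal *)

Section RightInvariants.
Variables (k : comPzRingType) (K : hopf k) (M : bimod K).
Local Notation S := (anti K).

Lemma PR_rev m : PR M m = PL (bimod_rev M) m.
Proof. by symmetry; apply: (@sw_brho_rev _ _ M _ (fun h x => x ⊲ S h)); lin. Qed.

Lemma rinv_rev (m : M) : rinv m <-> linv (M := bimod_rev M) m.
Proof.
rewrite /rinv /linv -[brho _ _]/(flip M K (bsigma M m)); split=> [-> | h].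
  exact: flip_tpure.
by rewrite -[LHS]flipK h; exact: flip_tpure.
Qed.

Lemma PR_r m h : PR M (m ⊲ h) = cou h *: PR M m.
Proof. by rewrite !PR_rev; exact: (@PL_l _ _ (bimod_rev M) h m). Qed.

Lemma PR_l h m : PR M (h ⊳ m) = \sw_(h1, h2 <- cop h) ((h1 ⊳ PR M m) ⊲ S h2).
Proof.
rewrite !PR_rev; etransitivity; first exact: (@PL_r _ _ (bimod_rev M) m h).
rewrite (@sw_cop_rev _ K _ (fun h1 h2 : K => (h2 ⊳ PL (bimod_rev M) m : M) ⊲ S h1)) //.
by lin.
Qed.

Lemma PR_dec m : \sw_(x, a <- bsigma M m) (PR M x ⊲ a) = m.
Proof.
have b : bilin (fun (a : K) (x : M) => (PL (bimod_rev M) x : M) ⊲ a).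
  split=> x; first exact: (bilin_compl _ (@br_bilin _ _ M) (@PL_linear _ _ (bimod_rev M))).
  exact: (br_bilin M).1.
have := sw_brho_rev m b; rewrite (@PL_dec _ _ (bimod_rev M) m) => E; rewrite [RHS]E.
by apply: eq_sw => x a; rewrite PR_rev.
Qed.

Lemma rinv_PR m : rinv (PR M m).
Proof. by apply/rinv_rev; rewrite PR_rev; exact: linv_PL. Qed.

Lemma PR_rinv m : rinv m -> PR M m = m.
Proof. by move=> /rinv_rev h; rewrite PR_rev PL_linv. Qed.

Lemma sw_bsigma_PL (P : lmodType k) (f : M -> K -> P) m : bilin f -> linv m ->
  \sw_(x, h <- bsigma M m) f (PL M x) h = \sw_(x, h <- bsigma M m) f x h.
Proof.
move=> bf h.
transitivity (\sw_(x, h <- bsigma M m) \sw_(g, y <- brho M x) f (S g ⊳ y) h).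
  by apply: eq_sw => x a; rewrite (bilin_swl _ _ _ bf).
rewrite -(brho_sigma (b := M) (f := fun g y h => f (S g ⊳ y) h)); last by lin.
rewrite h sw_tpure; last by lin.
by apply: eq_sw => a x; rewrite anti_one bl1.
Qed.

End RightInvariants.

(** * Tensor product over a Hopf algebra *)

(** The universal property is kept as a predicate on a given [T], so that [T] can be reused when [K]
    is reversed or replaced by its co-opposite. [bt_ext] takes bare functions with proofs of
    linearity because it is applied to composite expressions in Sweedler notation. *)
Record balanced_tensor (k : comPzRingType) (K : hopf k) (M N : bimod K)
    (T : lmodType k) (tp : M -> N -> T) : Prop := BalancedTensor {
  bt_bilin : bilin tp;
  bt_bal : forall m h n, tp (m ⊲ h) n = tp m (h ⊳ n);
  bt_lift : forall (P : lmodType k) (f : M -> N -> P), bilin f ->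
    (forall m h n, f (m ⊲ h) n = f m (h ⊳ n)) ->
    exists g : {linear T -> P}, forall m n, g (tp m n) = f m n;
  bt_ext : forall (P : lmodType k) (f g : T -> P), linear f -> linear g ->
    (forall m n, f (tp m n) = g (tp m n)) -> f =1 g }.

(** Separated from the coactions of the tensor product: the construction of [c], its linearity and
    its inverse require only the compatibility of the actions. *)
Record act_tensor (k : comPzRingType) (K : hopf k) (M N MN : bimod K)
    (tp : M -> N -> MN) : Prop := ActTensor {
  at_bt :> balanced_tensor tp;
  at_l : forall h m n, h ⊳ tp m n = tp (h ⊳ m) n;
  at_r : forall m n h, tp m n ⊲ h = tp m (n ⊲ h) }.

Record bimod_tensor (k : comPzRingType) (K : hopf k) (M N MN : bimod K)
    (tp : M -> N -> MN) : Prop := BimodTensor {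
  bmt_at :> act_tensor tp;
  bmt_rho : forall m n, brho MN (tp m n) =
    \sw_(a, x <- brho M m) \sw_(b, y <- brho N n) (a ⋅ b ⊗ tp x y);
  bmt_sigma : forall m n, bsigma MN (tp m n) =
    \sw_(x, a <- bsigma M m) \sw_(y, b <- bsigma N n) (tp x y ⊗ a ⋅ b) }.

(** * Left action and left coaction on a tensor product *)

Section LeftStructure.
Variables (k : comPzRingType) (K : hopf k) (M N : bimod K) (T : lmodType k).
Variables (tp : M -> N -> T) (HT : balanced_tensor tp).
Let tb := bt_bilin HT.

Lemma lift_l h : exists g : {linear T -> T}, forall m n, g (tp m n) = tp (h ⊳ m) n.
Proof.
apply: (bt_lift HT (f := fun m n => tp (h ⊳ m) n)); first by lin.
by move=> m g n; rewrite -blrA (bt_bal HT).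
Qed.

Definition tens_l h (x : T) : T := projT1 (cid (lift_l h)) x.

Lemma tens_l_linear h : linear (tens_l h).
Proof. exact: linearP. Qed.

Lemma tens_lE h m n : tens_l h (tp m n) = tp (h ⊳ m) n.
Proof. exact: (projT2 (cid (lift_l h))). Qed.

(** Every [tens_l h] is chosen separately from an existence statement; linearity in [h] is recovered
    from uniqueness. *)
Lemma tens_l_bilin : bilin tens_l.
Proof.
split=> [h | x a h h' /=]; first exact: tens_l_linear.
apply: (bt_ext HT (f := tens_l (a *: h + h'))
  (g := fun x => a *: tens_l h x + tens_l h' x)) => [||m n].
- exact: tens_l_linear.
- move=> b y z; rewrite !tens_l_linear !scalerDr !scalerA [b * a]mulrC.
  by rewrite addrACA.
by rewrite !tens_lE (bl_bilin M).2 tb.2.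
Qed.

#[local] Hint Extern 1 (bilin _) => exact: tens_l_bilin : multilin.

Lemma tens_lA g h x : tens_l g (tens_l h x) = tens_l (g ⋅ h) x.
Proof.
apply: (bt_ext HT (f := fun x => tens_l g (tens_l h x))) => [||m n]; try by lin.
by rewrite !tens_lE blA.
Qed.

Lemma tens_l1 x : tens_l (unt K) x = x.
Proof.
apply: (bt_ext HT (g := id)) => [||m n]; try by lin.
by rewrite !tens_lE bl1.
Qed.

Lemma lift_rho : exists g : {linear T -> tens K T}, forall m n, g (tp m n) =
   \sw_(a, x <- brho M m) \sw_(b, y <- brho N n) (a ⋅ b ⊗ tp x y).
Proof.
apply: (bt_lift HT (f := fun m n =>
  \sw_(a, x <- brho M m) \sw_(b, y <- brho N n) (a ⋅ b ⊗ tp x y))); first by lin.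
move=> m h n; rewrite sw_brho_r; last by lin.
apply: eq_sw => a x; rewrite sw_brho_l; last by lin.
by do 2 (apply: eq_sw => ? ?); rewrite hopfA (bt_bal HT).
Qed.

Definition tens_rho : {linear T -> tens K T} := projT1 (cid lift_rho).

Lemma tens_rhoE m n : tens_rho (tp m n) =
   \sw_(a, x <- brho M m) \sw_(b, y <- brho N n) (a ⋅ b ⊗ tp x y).
Proof. exact: (projT2 (cid lift_rho)). Qed.

Lemma sw_tens_rho (P : lmodType k) (f : K -> T -> P) m n : bilin f ->
  \sw_(a, x <- tens_rho (tp m n)) f a x =
  \sw_(a, x <- brho M m) \sw_(b, y <- brho N n) f (a ⋅ b) (tp x y).
Proof.
move=> bf; rewrite tens_rhoE sw_sw //; apply: eq_sw => a x.
by rewrite sw_sw //; apply: eq_sw => b y; rewrite sw_tpure.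
Qed.

(** On [tp m n] the coproduct of [a ⋅ b] splits, and coassociativity of [M] and then of [N]
    applies. *)
Lemma tens_rhoA (P : lmodType k) (f : K -> K -> T -> P) x : trilin f ->
  \sw_(h, y <- tens_rho x) \sw_(a, b <- cop h) f a b y
  = \sw_(h, y <- tens_rho x) \sw_(g, z <- tens_rho y) f h g z.
Proof.
move=> tf; apply: (bt_ext HT
  (f := fun x => \sw_(h, y <- tens_rho x) \sw_(a, b <- cop h) f a b y)
  (g := fun x => \sw_(h, y <- tens_rho x) \sw_(g, z <- tens_rho y) f h g z))
  => [||m n]; try by lin.
rewrite !sw_tens_rho; try by lin.
transitivity (\sw_(a, x <- brho M m) \sw_(a1, a2 <- cop a)
  \sw_(b, y <- brho N n) \sw_(b1, b2 <- cop b) f (a1 ⋅ b1) (a2 ⋅ b2) (tp x y)).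
  apply: eq_sw => a y; rewrite [RHS]exchange_sw.
  by sw_at 1 (rewrite sw_cop_mul; last by lin).
rewrite (brhoA _ (fun a1 a2 x => \sw_(b, y <- brho N n) \sw_(b1, b2 <- cop b)
  f (a1 ⋅ b1) (a2 ⋅ b2) (tp x y))); last by lin.
apply: eq_sw => a y.
symmetry; sw_at 1 (rewrite sw_tens_rho; last by lin).
rewrite exchange_sw; apply: eq_sw => c z.
by rewrite (brhoA _ (fun b1 b2 y => f (a ⋅ b1) (c ⋅ b2) (tp z y))); last by lin.
Qed.

Lemma tens_rho_cou x : \sw_(h, y <- tens_rho x) (cou h *: y) = x.
Proof.
apply: (bt_ext HT (f := fun x => \sw_(h, y <- tens_rho x) (cou h *: y)) (g := id))
  => [||m n]; try by lin.
rewrite sw_tens_rho; last by lin.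
rewrite -[RHS](sw_brho_cou (f := fun m => tp m n)); last by lin.
apply: eq_sw => a y; rewrite -[tp y n](sw_brho_cou (f := fun n => tp y n)); last by lin.
by rewrite scaler_swr; apply: eq_sw => b z; rewrite cou_mul scalerA.
Qed.

Lemma tens_rho_l h x : tens_rho (tens_l h x) =
  \sw_(h1, h2 <- cop h) \sw_(a, y <- tens_rho x) (h1 ⋅ a ⊗ tens_l h2 y).
Proof.
have lb := tens_l_bilin.
apply: (bt_ext HT (f := fun x => tens_rho (tens_l h x)) (g := fun x =>
  \sw_(h1, h2 <- cop h) \sw_(a, y <- tens_rho x) (h1 ⋅ a ⊗ tens_l h2 y)))
  => [||m n]; try by lin.
rewrite tens_lE tens_rhoE sw_brho_l; last by lin.
apply: eq_sw => h1 h2; rewrite sw_tens_rho; last by lin.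
by do 2 (apply: eq_sw => ? ?); rewrite tens_lE hopfA.
Qed.

(** The right action is a parameter because the lemma serves twice: with [tens_r] in [tens_bimod],
    and in [tens_sigma_l] with the left action, which is the right one seen from the reversed
    side. *)
Lemma tens_rho_r (r : T -> K -> T) x h : bilin r ->
  (forall m n h, r (tp m n) h = tp m (n ⊲ h)) ->
  tens_rho (r x h) =
  \sw_(a, y <- tens_rho x) \sw_(h1, h2 <- cop h) (a ⋅ h1 ⊗ r y h2).
Proof.
move=> rb rE.
apply: (bt_ext HT (f := fun x => tens_rho (r x h)) (g := fun x =>
  \sw_(a, y <- tens_rho x) \sw_(h1, h2 <- cop h) (a ⋅ h1 ⊗ r y h2)))
  => [||m n]; try by lin.
rewrite rE tens_rhoE sw_tens_rho; last by lin.
apply: eq_sw => a y; rewrite sw_brho_r; last by lin.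
by do 2 (apply: eq_sw => ? ?); rewrite rE hopfA.
Qed.

End LeftStructure.

(** * The right structure by reversal, and the assembled bimodule *)

Section Structure.
Variables (k : comPzRingType) (K : hopf k) (M N : bimod K) (T : lmodType k).
Variables (tp : M -> N -> T) (HT : balanced_tensor tp).

(** The source of all right-hand structure on [T]: it is the left-hand structure of the reversed [N]
    tensored with the reversed [M]. *)
Lemma balanced_tensor_rev :
  balanced_tensor (M := bimod_rev N) (N := bimod_rev M) (fun n m => tp m n).
Proof.
have [b1 b2] := bt_bilin HT.
split=> [|n h m | P f bf balf | P f g lf lg fg].
- by split.
- exact: esym (bt_bal HT m h n).
- have [||g gE] := bt_lift HT (f := fun m n => f n m).
  + by case: bf.
  + by move=> m h n; exact: esym (balf n h m).
  by exists g => n m; exact: gE.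
- by apply: (bt_ext HT) => // m n; exact: fg.
Qed.

Let HR := balanced_tensor_rev.

Definition tens_r (x : T) (h : K) : T := tens_l HR h x.
Definition tens_sigma : {linear T -> tens T K} := flip K T \o tens_rho HR.

Lemma tens_rE m n h : tens_r (tp m n) h = tp m (n ⊲ h).
Proof. exact: tens_lE HR h n m. Qed.

Lemma tens_r_bilin : bilin tens_r.
Proof. by have [b1 b2] := tens_l_bilin HR; split. Qed.

Lemma tens_rA x g h : tens_r (tens_r x g) h = tens_r x (g ⋅ h).
Proof. exact: tens_lA HR h g x. Qed.

Lemma tens_r1 x : tens_r x (unt K) = x.
Proof. exact: tens_l1 HR x. Qed.

Lemma sw_tens_sigma (P : lmodType k) (f : T -> K -> P) x : bilin f ->
  \sw_(y, a <- tens_sigma x) f y a = \sw_(a, y <- tens_rho HR x) f y a.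
Proof. by move=> bf; rewrite /tens_sigma /= sw_flip. Qed.

Let sw_rho_rev (P : lmodType k) (u : K -> T -> P) m n : bilin u ->
  \sw_(a, y <- tens_rho HR (tp m n)) u a y =
  \sw_(y, b <- bsigma N n) \sw_(x, a <- bsigma M m) u (a ⋅ b) (tp x y).
Proof.
move=> bu; have tb := bt_bilin HT.
have inner (b : K) (y : N) :
    \sw_(a, x <- brho (bimod_rev M) m) u ((a : K) ⋅ b) (tp x y) =
    \sw_(x, a <- bsigma M m) u (a ⋅ b) (tp x y).
  by apply: (sw_brho_rev m (f := fun (a : K) x => u (a ⋅ b) (tp x y))); lin.
have outer : bilin (fun (b : K) (y : N) =>
    \sw_(x, a <- bsigma M m) u (a ⋅ b) (tp x y)) by lin.
rewrite -(sw_brho_rev n outer) (sw_tens_rho HR _ _ bu).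
by apply: eq_sw => b y; exact: inner.
Qed.

Lemma tens_sigmaE m n : tens_sigma (tp m n) =
   \sw_(x, a <- bsigma M m) \sw_(y, b <- bsigma N n) (tp x y ⊗ a ⋅ b).
Proof.
rewrite -[LHS]tens_id sw_tens_sigma; last by lin.
by rewrite sw_rho_rev; [rewrite exchange_sw | lin].
Qed.

Lemma tens_sigmaA (P : lmodType k) (f : T -> K -> K -> P) x : trilin f ->
  \sw_(y, h <- tens_sigma x) \sw_(a, b <- cop h) f y a b
  = \sw_(y, h <- tens_sigma x) \sw_(z, g <- tens_sigma y) f z g h.
Proof.
move=> tf; rewrite !sw_tens_sigma; try by lin.
have tf' : trilin (fun b a y => f y a b) by lin.
have := tens_rhoA HR x tf' => E.
symmetry; sw_at 1 (rewrite sw_tens_sigma; last by lin).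
rewrite -[LHS]E; apply: eq_sw => h y.
by apply: (sw_cop_rev h (f := fun b a => f y a b)); lin.
Qed.

Lemma tens_sigma_cou x : \sw_(y, h <- tens_sigma x) (cou h *: y) = x.
Proof. by rewrite sw_tens_sigma; [exact: tens_rho_cou HR x | lin]. Qed.

Lemma tens_sigma_r x h : tens_sigma (tens_r x h) =
  \sw_(y, a <- tens_sigma x) \sw_(h1, h2 <- cop h) (tens_r y h1 ⊗ a ⋅ h2).
Proof.
have rb := tens_r_bilin; pose rx : tens K T := tens_rho HR x.
have b : bilin (fun h2 h1 : K => \sw_(a, y <- rx) ((a ⋅ h2) ⊗ tens_r y h1)) by lin.
have E : tens_rho HR (tens_r x h) =
    \sw_(h1, h2 <- cop h) \sw_(a, y <- rx) ((a ⋅ h2) ⊗ tens_r y h1).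
  by rewrite -(sw_cop_rev h b); exact: tens_rho_l HR h x.
rewrite sw_tens_sigma; last by lin.
rewrite exchange_sw /tens_sigma /= /flip_fun E sw_sw; last by lin.
apply: eq_sw => h1 h2; rewrite sw_sw; last by lin.
by sw_at 1 (rewrite sw_tpure; last by lin).
Qed.

Lemma tens_sigma_l h x : tens_sigma (tens_l HT h x) =
  \sw_(h1, h2 <- cop h) \sw_(y, a <- tens_sigma x) (tens_l HT h1 y ⊗ h2 ⋅ a).
Proof.
have lb := tens_l_bilin HT; pose rx : tens K T := tens_rho HR x.
have lb' : bilin (fun y (h : hopf_rev K) => tens_l HT h y) by case: lb.
have E : tens_rho HR (tens_l HT h x) =
    \sw_(a, y <- rx) \sw_(h1, h2 <- cop h) ((h2 ⋅ a) ⊗ tens_l HT h1 y).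
  rewrite (tens_rho_r HR x h lb' (fun n m h => tens_lE HT h m n)).
  have inner (a : K) y :
      \sw_(h2, h1 <- @cop k (hopf_rev K) h) (((h2 : K) ⋅ a) ⊗ tens_l HT h1 y) =
      \sw_(h1, h2 <- cop h) ((h2 ⋅ a) ⊗ tens_l HT h1 y).
    by apply: (sw_cop_rev h (f := fun h2 h1 : K => (h2 ⋅ a) ⊗ tens_l HT h1 y)); lin.
  by apply: eq_sw => a y; exact: inner.
rewrite exchange_sw sw_tens_sigma; last by lin.
rewrite /tens_sigma /= /flip_fun E sw_sw; last by lin.
apply: eq_sw => a y; rewrite sw_sw; last by lin.
by sw_at 1 (rewrite sw_tpure; last by lin).
Qed.

(** On [tp m n] the four sums are reordered so that the two coactions of [M] are adjacent, then
    those of [N]; each pair commutes. *)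
Lemma tens_rho_sigma (P : lmodType k) (f : K -> T -> K -> P) x : trilin f ->
  \sw_(h, y <- tens_rho HT x) \sw_(z, g <- tens_sigma y) f h z g
  = \sw_(y, g <- tens_sigma x) \sw_(h, z <- tens_rho HT y) f h z g.
Proof.
have tb := bt_bilin HT.
have sw_sigma (Q : lmodType k) (u : T -> K -> Q) m n : bilin u ->
    \sw_(z, g <- tens_sigma (tp m n)) u z g =
    \sw_(x, a <- bsigma M m) \sw_(y, b <- bsigma N n) u (tp x y) (a ⋅ b).
  move=> bu; rewrite tens_sigmaE sw_sw //; apply: eq_sw => z a.
  by rewrite sw_sw //; apply: eq_sw => y b; rewrite sw_tpure.
move=> tf; apply: (bt_ext HT
  (f := fun x => \sw_(h, y <- tens_rho HT x) \sw_(z, g <- tens_sigma y) f h z g)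
  (g := fun x => \sw_(y, g <- tens_sigma x) \sw_(h, z <- tens_rho HT y) f h z g))
  => [||m n]; try by lin.
rewrite sw_tens_rho ?sw_sigma; try by lin.
transitivity (\sw_(a, x <- brho M m) \sw_(x', a' <- bsigma M x)
  \sw_(b, y <- brho N n) \sw_(y', b' <- bsigma N y)
    f (a ⋅ b) (tp x' y') (a' ⋅ b')).
  apply: eq_sw => a z; rewrite [RHS]exchange_sw; apply: eq_sw => b y.
  by rewrite sw_sigma; last by lin.
rewrite (brho_sigma (b := M) (f := fun a x' a' =>
  \sw_(b, y <- brho N n) \sw_(y', b' <- bsigma N y)
    f (a ⋅ b) (tp x' y') (a' ⋅ b'))); last by lin.
apply: eq_sw => z a'.
symmetry; sw_at 1 (rewrite sw_tens_rho; last by lin).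
rewrite exchange_sw; apply: eq_sw => a x'.
by rewrite (brho_sigma (b := N) (f := fun b y' b' =>
   f (a ⋅ b) (tp x' y') (a' ⋅ b'))); last by lin.
Qed.

Definition tens_bimod : bimod K.
Proof.
refine (@Bimod k K T (tens_l HT) tens_r (tens_rho HT) tens_sigma
  _ _ _ _ _ _ _ _ _ _ _ _ _ _ _ _).
- exact: tens_l_bilin.
- exact: tens_r_bilin.
- exact: tens_lA.
- exact: tens_l1.
- exact: tens_rA.
- exact: tens_r1.
- move=> g x h; have lb := tens_l_bilin HT; have rb := tens_r_bilin.
  apply: (bt_ext HT (f := fun x => tens_r (tens_l HT g x) h)
    (g := fun x => tens_l HT g (tens_r x h))) => [||m n]; try by lin.
  by rewrite !(tens_lE, tens_rE).
- exact: tens_rhoA.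
- exact: tens_rho_cou.
- exact: tens_sigmaA.
- exact: tens_sigma_cou.
- exact: tens_rho_l.
- by move=> x h; apply: tens_rho_r => //; [exact: tens_r_bilin | exact: tens_rE].
- exact: tens_sigma_l.
- exact: tens_sigma_r.
- exact: tens_rho_sigma.
Defined.

End Structure.

(** * The prebraiding on ordinary bimodules *)

Section Generators.
Variables (k : comPzRingType) (K : hopf k) (M N MN : bimod K).
Variables (tp : M -> N -> MN) (HT : act_tensor tp).

Lemma tens_dec m n : tp m n = \sw_(a, x <- brho M m) \sw_(y, b <- bsigma N n)
  ((a ⊳ tp (PL M x) (PR N y)) ⊲ b).
Proof.
have tb := bt_bilin HT.
rewrite -[in LHS](PL_dec m) (bilin_swl _ _ _ tb); apply: eq_sw => a x.
rewrite -[in LHS](PR_dec n) (bilin_swr _ _ _ tb); apply: eq_sw => y b.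
by rewrite (at_l HT) (at_r HT).
Qed.

(* The products of a left invariant and a right invariant vector generate the tensor product as a bimodule. *)
Lemma gen_ext (P : lmodType k) (L : K -> P -> P) (R : P -> K -> P)
    (f g : MN -> P) : linear f -> linear g ->
  (forall h x, f (h ⊳ x) = L h (f x)) -> (forall h x, g (h ⊳ x) = L h (g x)) ->
  (forall x h, f (x ⊲ h) = R (f x) h) -> (forall x h, g (x ⊲ h) = R (g x) h) ->
  (forall m n, linv m -> rinv n -> f (tp m n) = g (tp m n)) -> f =1 g.
Proof.
move=> lf lg fL gL fR gR fg; apply: (bt_ext HT) => // m n.
rewrite tens_dec !(linear_sw _ _ lf) !(linear_sw _ _ lg); apply: eq_sw => a x.
rewrite !(linear_sw _ _ lf) !(linear_sw _ _ lg); apply: eq_sw => y b.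
by rewrite fR gR fL gL fg; [| exact: linv_PL | exact: rinv_PR].
Qed.

End Generators.

Section BraidMap.
Variables (k : comPzRingType) (K : hopf k) (M N MN NM : bimod K).
Variables (tp : M -> N -> MN) (tp' : N -> M -> NM).
Hypotheses (HT : act_tensor tp) (HT' : act_tensor tp').
Let tb := bt_bilin HT.
Let tb' := bt_bilin HT'.

Definition braid_fun m n := \sw_(a, x <- brho M m) \sw_(y, b <- bsigma N n)
  tp' (a ⊳ PR N y) (PL M x ⊲ b).

Lemma braid_fun_bilin : bilin braid_fun.
Proof. by rewrite /braid_fun; lin. Qed.

(** Both sides are the sum of [F] over the threefold coproduct of [h]. On the left, [PL_r] produces
    an antipode factor that crosses [tp'] to the other side; on the right, [PR_l] produces it there
    directly. *)
Lemma braid_fun_bal m h n : braid_fun (m ⊲ h) n = braid_fun m (h ⊳ n).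
Proof.
pose F a x y b h1 h2 h3 :=
  tp' (((a ⋅ h1) ⊳ PR N y) ⊲ anti K h2) ((PL M x ⊲ h3) ⊲ b).
rewrite /braid_fun sw_brho_r; last by lin.
apply: eq_sw => a x.
transitivity (\sw_(y, b <- bsigma N n) \sw_(h1, h2 <- cop h) \sw_(h3, h4 <- cop h2)
  F a x y b h1 h3 h4).
  rewrite [RHS]exchange_sw; apply: eq_sw => h1 h2; apply: eq_sw => y b.
  rewrite PL_r (bilin_swl _ _ _ (@br_bilin _ _ M)) (bilin_swr _ _ _ tb').
  by apply: eq_sw => h3 h4; rewrite /F (bt_bal HT') blrA.
rewrite sw_bsigma_l; last by lin.
rewrite [RHS]exchange_sw; apply: eq_sw => y b.
rewrite -(copA (f := fun h1 h3 h4 => F a x y b h1 h3 h4)); last by rewrite /F; lin.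
apply: eq_sw => h1 h2.
rewrite PR_l (bilin_swr _ _ _ (@bl_bilin _ _ N)) (bilin_swl _ _ _ tb').
by apply: eq_sw => h3 h4; rewrite /F -blrA blA brA.
Qed.

Lemma braid_exists : exists c : {linear MN -> NM},
  forall m n, c (tp m n) = braid_fun m n.
Proof. exact: (bt_lift HT braid_fun_bilin braid_fun_bal). Qed.

Variable c : {linear MN -> NM}.
Hypothesis cE : forall m n, c (tp m n) = braid_fun m n.

(** The coaction splits [h]: its first leg multiplies the coefficient [a], and by [PL_l] the second
    leg is reduced to its counit. *)
Lemma braid_l h x : c (h ⊳ x) = h ⊳ c x.
Proof.
apply: (bt_ext HT (f := fun x => c (h ⊳ x)) (g := fun x => h ⊳ c x))
  => [||m n]; try by lin.
rewrite (at_l HT) !cE /braid_fun sw_brho_l; last by lin.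
rewrite exchange_sw (bilin_swr _ _ _ (@bl_bilin _ _ NM)); apply: eq_sw => a x'.
rewrite (bilin_swr _ _ _ (@bl_bilin _ _ NM)) exchange_sw; apply: eq_sw => y b.
rewrite -[RHS](sw_cou_r (f := fun h => h ⊳ tp' (a ⊳ PR N y) (PL M x' ⊲ b))); last by lin.
apply: eq_sw => h1 h2.
by rewrite PL_l (bilinZl (@br_bilin _ _ M)) (bilinZr tb') (at_l HT') blA.
Qed.

Lemma braid_r x h : c (x ⊲ h) = c x ⊲ h.
Proof.
apply: (bt_ext HT (f := fun x => c (x ⊲ h)) (g := fun x => c x ⊲ h))
  => [||m n]; try by lin.
rewrite (at_r HT) !cE /braid_fun (bilin_swl _ _ _ (@br_bilin _ _ NM)).
apply: eq_sw => a x'; rewrite sw_bsigma_r; last by lin.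
rewrite (bilin_swl _ _ _ (@br_bilin _ _ NM)); apply: eq_sw => y b.
rewrite -[RHS](sw_cou_l (f := fun h => tp' (a ⊳ PR N y) (PL M x' ⊲ b) ⊲ h)); last by lin.
apply: eq_sw => h1 h2.
by rewrite PR_r (bilinZr (@bl_bilin _ _ N)) (bilinZl tb') (at_r HT') brA.
Qed.

Lemma braid_inv m n : linv m -> rinv n -> c (tp m n) = tp' n m.
Proof.
move=> lm rn; rewrite cE /braid_fun lm sw_tpure; last by lin.
rewrite rn sw_tpure; last by lin.
by rewrite bl1 br1 PL_linv ?PR_rinv.
Qed.

End BraidMap.

(** * Colinearity of the prebraiding *)

Section BraidColinear.
Variables (k : comPzRingType) (K : hopf k) (M N MN NM : bimod K).
Variables (tp : M -> N -> MN) (tp' : N -> M -> NM).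
Hypotheses (HT : bimod_tensor tp) (HT' : bimod_tensor tp').
Variable c : {linear MN -> NM}.
Hypotheses (cl : forall h x, c (h ⊳ x) = h ⊳ c x).
Hypotheses (cr : forall x h, c (x ⊲ h) = c x ⊲ h).
Hypotheses (cE : forall m n, linv m -> rinv n -> c (tp m n) = tp' n m).
Let tb := bt_bilin HT.
Let tb' := bt_bilin HT'.

Lemma sw_bmt_rho (P : lmodType k) (f : K -> MN -> P) m n : bilin f ->
  \sw_(h, x <- brho MN (tp m n)) f h x =
  \sw_(a, x <- brho M m) \sw_(b, y <- brho N n) f (a ⋅ b) (tp x y).
Proof.
move=> bf; rewrite (bmt_rho HT) sw_sw //; apply: eq_sw => a x.
by rewrite sw_sw //; apply: eq_sw => b y; rewrite sw_tpure.
Qed.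

Lemma sw_bmt_sigma (P : lmodType k) (f : MN -> K -> P) m n : bilin f ->
  \sw_(x, h <- bsigma MN (tp m n)) f x h =
  \sw_(x, a <- bsigma M m) \sw_(y, b <- bsigma N n) f (tp x y) (a ⋅ b).
Proof.
move=> bf; rewrite (bmt_sigma HT) sw_sw //; apply: eq_sw => a x.
by rewrite sw_sw //; apply: eq_sw => b y; rewrite sw_tpure.
Qed.

(** Both sides are bimodule maps into [K ⊗ NM] for the diagonal actions [L] and [R], so generators
    suffice. There the coaction of [n] yields terms [tp m y], and [sw_brho_PR] makes [y] right
    invariant so that [cE] applies to them as well. *)
Lemma braid_rho x : brho NM (c x) = \sw_(h, y <- brho MN x) (h ⊗ c y).
Proof.
apply: (gen_ext HT (f := fun x => brho NM (c x))
  (g := fun x => \sw_(h, y <- brho MN x) (h ⊗ c y))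
  (L := fun h t => \sw_(h1, h2 <- cop h) \sw_(a, x <- t) (h1 ⋅ a ⊗ h2 ⊳ x))
  (R := fun t h => \sw_(a, x <- t) \sw_(h1, h2 <- cop h) (a ⋅ h1 ⊗ x ⊲ h2)))
  => [|| h {}x | h {}x | {}x h | {}x h | m n lm rn]; try by lin.
- by rewrite cl brho_l.
- rewrite sw_brho_l; last by lin.
  apply: eq_sw => h1 h2; rewrite sw_sw; last by lin.
  by apply: eq_sw => a y; rewrite sw_tpure ?cl //; lin.
- by rewrite cr brho_r.
- rewrite sw_brho_r ?sw_sw; try by lin.
  apply: eq_sw => a y; rewrite sw_tpure; last by lin.
  by apply: eq_sw => h1 h2; rewrite cr.
rewrite cE // (bmt_rho HT') sw_bmt_rho; last by lin.
rewrite lm sw_tpure; last by lin.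
rewrite -(sw_brho_PR (f := fun b y => unt K ⋅ b ⊗ c (tp m y))) //; last by lin.
rewrite -(sw_brho_PR (f := fun b y => \sw_(a, x <- unt K ⊗ m) (b ⋅ a ⊗ tp' y x))) //;
  last by lin.
apply: eq_sw => b y; rewrite sw_tpure; last by lin.
by rewrite cE //; [rewrite hopf1r hopf1l | exact: rinv_PR].
Qed.

Lemma braid_sigma x : bsigma NM (c x) = \sw_(y, h <- bsigma MN x) (c y ⊗ h).
Proof.
apply: (gen_ext HT (f := fun x => bsigma NM (c x))
  (g := fun x => \sw_(y, h <- bsigma MN x) (c y ⊗ h))
  (L := fun h t => \sw_(h1, h2 <- cop h) \sw_(x, a <- t) (h1 ⊳ x ⊗ h2 ⋅ a))
  (R := fun t h => \sw_(x, a <- t) \sw_(h1, h2 <- cop h) (x ⊲ h1 ⊗ a ⋅ h2)))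
  => [|| h {}x | h {}x | {}x h | {}x h | m n lm rn]; try by lin.
- by rewrite cl bsigma_l.
- rewrite sw_bsigma_l; last by lin.
  apply: eq_sw => h1 h2; rewrite sw_sw; last by lin.
  by apply: eq_sw => a y; rewrite sw_tpure ?cl //; lin.
- by rewrite cr bsigma_r.
- rewrite sw_bsigma_r ?sw_sw; try by lin.
  apply: eq_sw => a y; rewrite sw_tpure; last by lin.
  by apply: eq_sw => h1 h2; rewrite cr.
rewrite cE // (bmt_sigma HT') sw_bmt_sigma; last by lin.
rewrite rn sw_tpure; last by lin.
transitivity (\sw_(x, a <- bsigma M m) (tp' n (PL M x) ⊗ a)).
  rewrite (sw_bsigma_PL (f := fun x a => tp' n x ⊗ a)) //; last by lin.
  by apply: eq_sw => y a; rewrite hopf1l.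
rewrite -(sw_bsigma_PL
  (f := fun x a => \sw_(y, b <- n ⊗ unt K) (c (tp x y) ⊗ a ⋅ b))) //; last by lin.
apply: eq_sw => y a; rewrite sw_tpure; last by lin.
by rewrite hopf1r cE //; exact: linv_PL.
Qed.

End BraidColinear.

(** * The co-opposite Hopf algebra and its bimodules *)

Section CoOpposite.
Variables (k : comPzRingType) (K : hopf k) (T : {linear K -> K}).
Hypotheses (antiK : cancel (anti K) T) (Kanti : cancel T (anti K)).

Let cop' : {linear K -> tens K K} := flip K K \o cop.

Let sw_cop' (P : lmodType k) (f : K -> K -> P) h :
  bilin f -> \sw_(a, b <- cop' h) f a b = \sw_(a, b <- cop h) f b a.
Proof. by move=> bf; rewrite /cop' /= sw_flip. Qed.

Let antiZ (h : K) : anti K (cou h *: unt K) = cou h *: unt K.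
Proof. by rewrite (linear_scale _ _ (linearP _)) anti_one. Qed.

Definition hopf_cop : hopf k.
Proof.
refine (@Hopf k K (@mul k K) (unt K) cop' cou T (@mul_bilin k K)
  (@hopfA k K) (@hopf1l k K) (@hopf1r k K) _ _ _ _ _ (@cou_mul k K) (cou_one K) _ _).
- move=> P f h tf.
  rewrite !sw_cop'; try by lin.
  sw_at 1 (rewrite sw_cop'; last by lin).
  rewrite -(copA (f := fun b d c => f c d b)); last by lin.
  by symmetry; sw_at 1 (rewrite sw_cop'; last by lin).
- by move=> h; rewrite sw_cop' ?cou_r //; lin.
- by move=> h; rewrite sw_cop' ?cou_l //; lin.
- move=> a b; rewrite -[LHS]tens_id sw_cop'; last by lin.
  rewrite sw_cop_mul ?sw_cop'; try by lin.
  by apply: eq_sw => ? ?; rewrite sw_cop' //; lin.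
- by rewrite /cop' /= /flip_fun cop_one sw_tpure //; lin.
(* The antipode of [K] is injective and reverses products: applied to [T b ⋅ a] it gives [S a ⋅ b],
   which turns this axiom for [T] into [anti_l]. *)
- move=> h; rewrite sw_cop'; last by lin.
  apply: (can_inj antiK); rewrite (linear_sw _ _ (linearP _)) antiZ -anti_l.
  by apply: eq_sw => a b; rewrite anti_mul Kanti.
- move=> h; rewrite sw_cop'; last by lin.
  apply: (can_inj antiK); rewrite (linear_sw _ _ (linearP _)) antiZ -anti_r.
  by apply: eq_sw => a b; rewrite anti_mul Kanti.
Defined.

Variable M : bimod K.

Let rho' : {linear M -> tens K M} := flip M K \o bsigma M.
Let sigma' : {linear M -> tens M K} := flip K M \o brho M.

Let sw_rho' (P : lmodType k) (f : K -> M -> P) m :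
  bilin f -> \sw_(a, x <- rho' m) f a x = \sw_(x, a <- bsigma M m) f a x.
Proof. by move=> bf; rewrite /rho' /= sw_flip. Qed.

Let sw_sigma' (P : lmodType k) (f : M -> K -> P) m :
  bilin f -> \sw_(x, a <- sigma' m) f x a = \sw_(a, x <- brho M m) f x a.
Proof. by move=> bf; rewrite /sigma' /= sw_flip. Qed.

Let rho'_l (h : K) m : rho' (h ⊳ m) =
  \sw_(h1, h2 <- cop' h) \sw_(a, x <- rho' m) (h1 ⋅ a ⊗ h2 ⊳ x).
Proof.
rewrite -[LHS]tens_id sw_rho' ?sw_bsigma_l ?sw_cop'; try by lin.
by apply: eq_sw => h2 h1; rewrite sw_rho' //; lin.
Qed.

Let rho'_r m (h : K) : rho' (m ⊲ h) =
  \sw_(a, x <- rho' m) \sw_(h1, h2 <- cop' h) (a ⋅ h1 ⊗ x ⊲ h2).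
Proof.
rewrite -[LHS]tens_id sw_rho' ?sw_bsigma_r ?sw_rho'; try by lin.
by apply: eq_sw => h2 h1; rewrite sw_cop' //; lin.
Qed.

Let sigma'_l (h : K) m : sigma' (h ⊳ m) =
  \sw_(h1, h2 <- cop' h) \sw_(x, a <- sigma' m) (h1 ⊳ x ⊗ h2 ⋅ a).
Proof.
rewrite -[LHS]tens_id sw_sigma' ?sw_brho_l ?sw_cop'; try by lin.
by apply: eq_sw => h2 h1; rewrite sw_sigma' //; lin.
Qed.

Let sigma'_r m (h : K) : sigma' (m ⊲ h) =
  \sw_(x, a <- sigma' m) \sw_(h1, h2 <- cop' h) (x ⊲ h1 ⊗ a ⋅ h2).
Proof.
rewrite -[LHS]tens_id sw_sigma' ?sw_brho_r ?sw_sigma'; try by lin.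
by apply: eq_sw => h2 h1; rewrite sw_cop' //; lin.
Qed.

Definition bimod_cop : bimod hopf_cop.
Proof.
refine (@Bimod k hopf_cop M (@bl k K M) (@br k K M) rho' sigma'
  _ _ _ _ _ _ _ _ _ _ _ _ _ _ _ _).
- exact: (@bl_bilin k K M).
- exact: (@br_bilin k K M).
- exact: (@blA k K M).
- exact: (@bl1 k K M).
- exact: (@brA k K M).
- exact: (@br1 k K M).
- exact: (@blrA k K M).
- move=> P f m tf.
  rewrite !sw_rho'; try by lin.
  sw_at 1 (rewrite sw_cop'; last by lin).
  rewrite (bsigmaA (K := K) M (fun x b a => f a b x)); last by lin.
  by symmetry; sw_at 1 (rewrite sw_rho'; last by lin).
- by move=> m; rewrite sw_rho' ?bsigma_cou //; lin.
- move=> P f m tf.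
  rewrite !sw_sigma'; try by lin.
  sw_at 1 (rewrite sw_cop'; last by lin).
  rewrite (brhoA (K := K) M (fun b a x => f x a b)); last by lin.
  by symmetry; sw_at 1 (rewrite sw_sigma'; last by lin).
- by move=> m; rewrite sw_sigma' ?brho_cou //; lin.
- exact: rho'_l.
- exact: rho'_r.
- exact: sigma'_l.
- exact: sigma'_r.
- move=> P f m tf.
  rewrite sw_rho' ?sw_sigma'; try by lin.
  sw_at 1 (rewrite sw_sigma'; last by lin).
  rewrite -(brho_sigma (b := M) (f := fun h y g => f g y h)); last by lin.
  by symmetry; sw_at 1 (rewrite sw_rho'; last by lin).
Defined.

Lemma linv_cop (m : M) : linv (M := bimod_cop) m <-> rinv m.
Proof.
rewrite /rinv /linv -[brho _ _]/(flip M K (bsigma M m)); split=> [h | ->].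
  by rewrite -[LHS]flipK h; exact: flip_tpure.
exact: flip_tpure.
Qed.

Lemma rinv_cop (m : M) : rinv (M := bimod_cop) m <-> linv m.
Proof.
rewrite /rinv /linv -[bsigma _ _]/(flip K M (brho M m)); split=> [h | ->].
  by rewrite -[LHS]flipK h; exact: flip_tpure.
exact: flip_tpure.
Qed.

End CoOpposite.

(** * Invertibility when the antipode is bijective *)

Section BraidInverse.
Variables (k : comPzRingType) (K : hopf k) (M N MN NM : bimod K).
Variables (tp : M -> N -> MN) (tp' : N -> M -> NM).
Hypotheses (HT : act_tensor tp) (HT' : act_tensor tp').
Variable c : {linear MN -> NM}.
Hypotheses (cl : forall h x, c (h ⊳ x) = h ⊳ c x).
Hypotheses (cr : forall x h, c (x ⊲ h) = c x ⊲ h).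
Hypotheses (cE : forall m n, linv m -> rinv n -> c (tp m n) = tp' n m).

Lemma can_linear (f : {linear K -> K}) g : cancel f g -> cancel g f -> linear g.
Proof. by move=> fK gK a x y; apply: (can_inj fK); rewrite linearP !gK. Qed.

Lemma braid_bij : bijective (anti K) ->
  exists2 d : {linear NM -> MN}, cancel c d & cancel d c.
Proof.
case=> g antiK Kanti; pose T := mklin (can_linear antiK Kanti).
have TK : cancel (anti K) T := antiK; have KT : cancel T (anti K) := Kanti.
pose cop_ := @bimod_cop k K T TK KT.
(* Passing to the co-opposite algebra leaves the actions unchanged, so the same [tp] and [tp'] are
   tensor products over it. *)
have HC : @act_tensor k _ (cop_ M) (cop_ N) (cop_ MN) tp.
  by case: HT => -[b1 b2 b3 b4] b5 b6; split=> //; split.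
have HC' : @act_tensor k _ (cop_ N) (cop_ M) (cop_ NM) tp'.
  by case: HT' => -[b1 b2 b3 b4] b5 b6; split=> //; split.
have [d dE] := braid_exists HC' HC.
have dl := braid_l HC' HC dE; have dr := braid_r HC' HC dE.
have dI (m : M) (n : N) : linv m -> rinv n -> d (tp' n m) = tp m n.
  move=> lm rn.
  have ln : linv (M := cop_ N) n by apply/linv_cop.
  have rm : rinv (M := cop_ M) m by apply/rinv_cop.
  exact: (braid_inv HC dE ln rm).
exists (d : {linear NM -> MN}).
  apply: (gen_ext HT (f := fun x => d (c x)) (g := id)
    (L := @bl k K MN) (R := @br k K MN)) => //; try by lin.
  - by move=> h x; rewrite cl; exact: dl.
  - by move=> x h; rewrite cr; exact: dr.
  by move=> m n lm rn; rewrite cE // dI.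
(* Here [HC'] is essential: with [HT'] the generators [tp' n m] would have [n] left and [m] right
   invariant. Over the co-opposite algebra the two conditions are exchanged, which is what [dI] and
   [cE] expect. *)
apply: (gen_ext HC' (f := fun x => c (d x : MN)) (g := id)
    (L := @bl k K NM) (R := @br k K NM)) => //; try by lin.
- by move=> h x; rewrite [d _]dl; exact: cl.
- by move=> x h; rewrite [d _]dr; exact: cr.
move=> n m /linv_cop rn /rinv_cop lm.
by rewrite [d _]dI ?cE.
Qed.

End BraidInverse.

(** * Removing the automorphisms *)

Section UntwistHopf.
Variables (k : comPzRingType) (H : homHopf k).
Local Notation α := (alpha H).
Local Notation α' := (autV (alpha H)).
Let bm := @hmul_bilin k H.

Lemma sw_Delta_alpha (P : lmodType k) (f : H -> H -> P) h : bilin f ->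
  \sw_(a, b <- Delta (α h)) f a b = \sw_(a, b <- Delta h) f (α a) (α b).
Proof.
move=> bf; rewrite Delta_alpha sw_sw //; apply: eq_sw => a b.
by rewrite sw_tpure.
Qed.

Lemma sw_DeltaA (P : lmodType k) (F : H -> H -> H -> P) h : trilin F ->
  \sw_(a, b <- Delta h) \sw_(c, d <- Delta b) F (α' a) c d =
  \sw_(a, b <- Delta h) \sw_(c, d <- Delta a) F c d (α' b).
Proof.
move=> tF; pose G a y := \sw_(b, c <- y) F a b c.
have bG : bilin G by rewrite /G; lin.
transitivity (sw (\sw_(a, b <- Delta h) (α' a ⊗ Delta b)) G).
  by rewrite sw_sw //; apply: eq_sw => a b; rewrite sw_tpure.
rewrite DeltaA sw_sw //; apply: eq_sw => a b; rewrite sw_sw //.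
by apply: eq_sw => c d; rewrite sw_tpure // /G sw_tpure //; lin.
Qed.

Lemma alphaVM a b : α' (a ∙ b) = α' a ∙ α' b.
Proof. by apply: (can_inj (autK α)); rewrite alphaM !autVK. Qed.

Definition umul (a b : H) : H := α' (a ∙ b).

Lemma umul_bilin : bilin umul.
Proof. by split=> ?; rewrite /umul; lin. Qed.

Definition ucop : {linear H -> tens H H} := Delta \o α.

Lemma sw_ucop (P : lmodType k) (f : H -> H -> P) h : bilin f ->
  \sw_(a, b <- ucop h) f a b = \sw_(a, b <- Delta h) f (α a) (α b).
Proof. exact: sw_Delta_alpha. Qed.

Definition untwist_hopf : hopf k.
Proof.
refine (@Hopf k H umul (hone H) ucop eps (antipode H) umul_bilin
  _ _ _ _ _ _ _ _ _ (@eps1 k H) _ _).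
- by move=> a b c; rewrite /umul !alphaVM -[a in LHS](autVK α) -!alphaVM
    alphaVM autK -[α' a in LHS](autVK α) !alphaVM hmulA autVK.
- by move=> a; rewrite /umul hmul1r autK.
- by move=> a; rewrite /umul hmulr1 autK.
- move=> P f h tf.
  (* The legs of the inner coproduct receive [α] twice and the remaining outer leg once. Writing the
     latter as [α (α (α' _))] produces the [α'] of Hom-coassociativity. *)
  pose F a b c := f (α (α a)) (α (α b)) (α (α c)).
  have tF : trilin F by rewrite /F; lin.
  rewrite !sw_ucop; try by lin.
  sw_at 1 (rewrite sw_ucop ?sw_Delta_alpha; try by lin).
  symmetry; sw_at 1 (rewrite sw_ucop ?sw_Delta_alpha; try by lin).
  transitivity (\sw_(a, b <- Delta h) \sw_(c, d <- Delta b) F (α' a) c d).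
    by do 2 (apply: eq_sw => ? ?); rewrite /F autVK.
  by rewrite sw_DeltaA //; do 2 (apply: eq_sw => ? ?); rewrite /F autVK.
- move=> h; rewrite sw_ucop; last by lin.
  rewrite -[RHS](autVK α) -eps_l (linear_sw _ _ (linearP _)).
  by apply: eq_sw => a b; rewrite eps_alpha linearZ.
- move=> h; rewrite sw_ucop; last by lin.
  rewrite -[RHS](autVK α) -eps_r (linear_sw _ _ (linearP _)).
  by apply: eq_sw => a b; rewrite eps_alpha linearZ.
- move=> a b; have mb := umul_bilin.
  rewrite /ucop /= autVK DeltaM -/ucop sw_ucop; last by lin.
  apply: eq_sw => a1 a2; rewrite sw_ucop; last by lin.
  by apply: eq_sw => b1 b2; rewrite /umul !alphaVM !autK.
- by rewrite /ucop /= alpha1 Delta1.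
- by move=> a b; rewrite /umul -eps_alpha autVK epsM.
- move=> h; have mb := umul_bilin; rewrite sw_ucop; last by lin.
  rewrite -antipode_l; apply: eq_sw => a b.
  by rewrite /umul alphaVM antipode_alpha !autK.
- move=> h; have mb := umul_bilin; rewrite sw_ucop; last by lin.
  rewrite -antipode_r; apply: eq_sw => a b.
  by rewrite /umul alphaVM antipode_alpha !autK.
Defined.

End UntwistHopf.

Arguments untwist_hopf {k} H.

Section UntwistBimod.
Variables (k : comPzRingType) (H : homHopf k) (M : bicov H).
Local Notation α := (alpha H).
Local Notation α' := (autV (alpha H)).
Local Notation μ := (mu M).
Local Notation μ' := (autV (mu M)).
Let bm := @hmul_bilin k H.
Let bum := @umul_bilin k H.
Implicit Types (m : M) (g h : H).

Lemma lact_bilin : bilin (@lact k H M).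
Proof. by have [[]] := s_bimodule (bstr M). Qed.

Lemma ract_bilin : bilin (@ract k H M).
Proof. by have [[]] := s_bimodule (bstr M). Qed.

Let lb := lact_bilin.
Let rb := ract_bilin.

Lemma mu_lact h m : μ (h ▷ m) = α h ▷ μ m.
Proof. by have [[_ _ e _] _ _ _] := s_bimodule (bstr M); exact: e. Qed.

Lemma mu_ract m h : μ (m ◁ h) = μ m ◁ α h.
Proof. by have [[_ _ _ e] _ _ _] := s_bimodule (bstr M); exact: e. Qed.

Lemma muV_lact h m : μ' (h ▷ m) = α' h ▷ μ' m.
Proof. by apply: (can_inj (autK μ)); rewrite mu_lact !autVK. Qed.

Lemma muV_ract m h : μ' (m ◁ h) = μ' m ◁ α' h.
Proof. by apply: (can_inj (autK μ)); rewrite mu_ract !autVK. Qed.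

Lemma lact_lact g h m : α g ▷ (h ▷ m) = (g ∙ h) ▷ μ m.
Proof. by have [_ [e _] _ _] := s_bimodule (bstr M); exact: e. Qed.

Lemma lact1 m : hone H ▷ m = μ m.
Proof. by have [_ [_ e] _ _] := s_bimodule (bstr M); exact: e. Qed.

Lemma ract_ract m g h : (m ◁ g) ◁ α h = μ m ◁ (g ∙ h).
Proof. by have [_ _ [e _] _] := s_bimodule (bstr M); exact: e. Qed.

Lemma ract1 m : m ◁ hone H = μ m.
Proof. by have [_ _ [_ e] _] := s_bimodule (bstr M); exact: e. Qed.

Lemma lact_ract g m h : (g ▷ m) ◁ α h = α g ▷ (m ◁ h).
Proof. by have [_ _ _ e] := s_bimodule (bstr M); exact: e. Qed.

Definition ul h m : M := μ' (h ▷ m).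
Definition ur m h : M := μ' (m ◁ h).
Definition urho : {linear M -> tens H M} := rho M \o μ.
Definition usigma : {linear M -> tens M H} := sigma M \o μ.

Lemma ul_bilin : bilin ul.
Proof. by split=> ?; rewrite /ul; lin. Qed.

Lemma ur_bilin : bilin ur.
Proof. by split=> ?; rewrite /ur; lin. Qed.

Lemma ulE h m : ul h m = α' h ▷ μ' m.
Proof. exact: muV_lact. Qed.

Lemma urE m h : ur m h = μ' m ◁ α' h.
Proof. exact: muV_ract. Qed.

Lemma mu_ul h m : μ (ul h m) = ul (α h) (μ m).
Proof. by rewrite /ul -mu_lact autK autVK. Qed.

Lemma mu_ur h m : μ (ur m h) = ur (μ m) (α h).
Proof. by rewrite /ur -mu_ract autK autVK. Qed.

Lemma lactE h m : h ▷ m = μ (ul h m).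
Proof. by rewrite /ul autVK. Qed.

Lemma ractE h m : m ◁ h = μ (ur m h).
Proof. by rewrite /ur autVK. Qed.

Lemma hmulE a b : a ∙ b = α (umul a b).
Proof. by rewrite /umul autVK. Qed.

Lemma sw_rho_mu (P : lmodType k) (f : H -> M -> P) m : bilin f ->
  \sw_(a, x <- rho M (μ m)) f a x = \sw_(a, x <- rho M m) f (α a) (μ x).
Proof.
have [e _ _] := s_left_comodule (bstr M).
move=> bf; rewrite [rho M _]e sw_sw //; apply: eq_sw => a x.
by rewrite sw_tpure.
Qed.

Lemma sw_sigma_mu (P : lmodType k) (f : M -> H -> P) m : bilin f ->
  \sw_(x, a <- sigma M (μ m)) f x a = \sw_(x, a <- sigma M m) f (μ x) (α a).
Proof.
have [e _ _] := s_right_comodule (bstr M).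
move=> bf; rewrite [sigma M _]e sw_sw //; apply: eq_sw => a x.
by rewrite sw_tpure.
Qed.

Lemma sw_urho (P : lmodType k) (f : H -> M -> P) m : bilin f ->
  \sw_(a, x <- urho m) f a x = \sw_(a, x <- rho M m) f (α a) (μ x).
Proof. exact: sw_rho_mu. Qed.

Lemma sw_usigma (P : lmodType k) (f : M -> H -> P) m : bilin f ->
  \sw_(x, a <- usigma m) f x a = \sw_(x, a <- sigma M m) f (μ x) (α a).
Proof. exact: sw_sigma_mu. Qed.

Lemma sw_urho_mu (P : lmodType k) (f : H -> M -> P) m : bilin f ->
  \sw_(a, x <- urho (μ m)) f a x = \sw_(a, x <- urho m) f (α a) (μ x).
Proof. by move=> bf; rewrite sw_urho // [RHS]sw_rho_mu //; lin. Qed.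

Lemma sw_usigma_mu (P : lmodType k) (f : M -> H -> P) m : bilin f ->
  \sw_(x, a <- usigma (μ m)) f x a = \sw_(x, a <- usigma m) f (μ x) (α a).
Proof. by move=> bf; rewrite sw_usigma // [RHS]sw_sigma_mu //; lin. Qed.

Lemma urhoA (P : lmodType k) (f : H -> H -> M -> P) m : trilin f ->
  \sw_(h, x <- urho m) \sw_(a, b <- ucop H h) f a b x
  = \sw_(h, x <- urho m) \sw_(g, y <- urho x) f h g y.
Proof.
move=> tf; have [_ e _] := s_left_comodule (bstr M).
pose F a b x := f (α (α a)) (α (α b)) (μ (μ x)).
have tF : trilin F by rewrite /F; lin.
pose G y x := \sw_(a, b <- y) F a b x.
have bG : bilin G by rewrite /G; lin.
rewrite !sw_urho; try by lin.
transitivity (sw (\sw_(h, x <- rho M m) (Delta h ⊗ μ' x)) G).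
  rewrite sw_sw //; apply: eq_sw => h x.
  rewrite sw_tpure // /G sw_ucop ?sw_Delta_alpha; try by lin.
  by apply: eq_sw => a b; rewrite /F autVK.
rewrite [sw _ _](congr1 (fun t => sw t G) (e m)) sw_sw //.
apply: eq_sw => h x; rewrite sw_sw // sw_urho ?sw_rho_mu; try by lin.
by apply: eq_sw => g y; rewrite sw_tpure // /G sw_tpure /F ?autVK //; lin.
Qed.

Lemma urho_cou m : \sw_(h, x <- urho m) (eps h *: x) = m.
Proof.
have [_ _ e] := s_left_comodule (bstr M).
rewrite sw_urho; last by lin.
rewrite -[RHS](autVK μ) -e (linear_sw _ _ (linearP _)).
by apply: eq_sw => h x; rewrite eps_alpha linearZ.
Qed.

Lemma usigmaA (P : lmodType k) (f : M -> H -> H -> P) m : trilin f ->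
  \sw_(x, h <- usigma m) \sw_(a, b <- ucop H h) f x a b
  = \sw_(x, h <- usigma m) \sw_(y, g <- usigma x) f y g h.
Proof.
move=> tf; have [_ e _] := s_right_comodule (bstr M).
pose F x a b := f (μ (μ x)) (α (α a)) (α (α b)).
have tF : trilin F by rewrite /F; lin.
pose G x y := \sw_(a, b <- y) F x a b.
have bG : bilin G by rewrite /G; lin.
rewrite !sw_usigma; try by lin.
transitivity (sw (\sw_(x, h <- sigma M m) (μ' x ⊗ Delta h)) G).
  rewrite sw_sw //; apply: eq_sw => x h.
  rewrite sw_tpure // /G sw_ucop ?sw_Delta_alpha; try by lin.
  by apply: eq_sw => a b; rewrite /F autVK.
rewrite [sw _ _](congr1 (fun t => sw t G) (e m)) sw_sw //.
apply: eq_sw => x h; rewrite sw_sw // sw_usigma ?sw_sigma_mu; try by lin.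
by apply: eq_sw => y g; rewrite sw_tpure // /G sw_tpure /F ?autVK //; lin.
Qed.

Lemma usigma_cou m : \sw_(x, h <- usigma m) (eps h *: x) = m.
Proof.
have [_ _ e] := s_right_comodule (bstr M).
rewrite sw_usigma; last by lin.
rewrite -[RHS](autVK μ) -e (linear_sw _ _ (linearP _)).
by apply: eq_sw => x h; rewrite eps_alpha linearZ.
Qed.

Lemma ucop_one : ucop H (hone H) = hone H ⊗ hone H.
Proof. by rewrite /ucop /= alpha1 Delta1. Qed.

Let lub := ul_bilin.
Let rub := ur_bilin.

Lemma umul_alpha (a b : H) : umul (α a) (α b) = a ∙ b.
Proof. by rewrite /umul -alphaM autK. Qed.

Lemma ul_alpha h m : ul (α h) (μ m) = h ▷ m.
Proof. by rewrite /ul -mu_lact autK. Qed.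

Lemma ur_alpha m h : ur (μ m) (α h) = m ◁ h.
Proof. by rewrite /ur -mu_ract autK. Qed.

Lemma umul1l (a : H) : umul (hone H) a = a.
Proof. exact: (@hopf1l _ (untwist_hopf H)). Qed.

Lemma umul1r (a : H) : umul a (hone H) = a.
Proof. exact: (@hopf1r _ (untwist_hopf H)). Qed.

Lemma ul1 m : ul (hone H) m = m.
Proof. by rewrite /ul lact1 autK. Qed.

Lemma ur1 m : ur m (hone H) = m.
Proof. by rewrite /ur ract1 autK. Qed.

Lemma urho_lr h m g : urho (ur (ul h m) g) =
  \sw_(h1, h2 <- ucop H h) \sw_(b, x <- urho m) \sw_(g1, g2 <- ucop H g)
    (umul h1 (umul b g1) ⊗ ul h2 (ur x g2)).
Proof.
have [e _ _] := s_bicovariant (bstr M).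
(* Evaluation at inverse images absorbs both the [α] in the bicovariance axiom and the inverse
   automorphisms in the untwisted actions. *)
have {}e := e (α' h) (μ' m) (α' g); rewrite !autVK in e.
transitivity (rho M ((α' h ▷ μ' m) ◁ g)); first by rewrite /urho /= /ur autVK ulE.
rewrite [LHS]e -[in RHS](autVK μ m) -[in RHS](autVK α g).
rewrite sw_ucop; last by lin.
apply: eq_sw => h1 h2; rewrite sw_urho_mu ?sw_urho; try by lin.
apply: eq_sw => b x; rewrite sw_ucop ?sw_Delta_alpha; try by lin.
by apply: eq_sw => g1 g2; rewrite !(umul_alpha, ur_alpha, ul_alpha) -alphaM
  -mu_ract !(umul_alpha, ur_alpha, ul_alpha).
Qed.

Lemma usigma_lr h m g : usigma (ur (ul h m) g) =
  \sw_(h1, h2 <- ucop H h) \sw_(x, b <- usigma m) \sw_(g1, g2 <- ucop H g)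
    (ul h1 (ur x g1) ⊗ umul h2 (umul b g2)).
Proof.
have [_ e _] := s_bicovariant (bstr M).
have {}e := e (α' h) (μ' m) (α' g); rewrite !autVK in e.
transitivity (sigma M ((α' h ▷ μ' m) ◁ g)); first by rewrite /usigma /= /ur autVK ulE.
rewrite [LHS]e -[in RHS](autVK μ m) -[in RHS](autVK α g).
rewrite sw_ucop; last by lin.
apply: eq_sw => h1 h2; rewrite sw_usigma_mu ?sw_usigma; try by lin.
apply: eq_sw => b x; rewrite sw_ucop ?sw_Delta_alpha; try by lin.
by apply: eq_sw => g1 g2; rewrite !(umul_alpha, ur_alpha, ul_alpha) -alphaM
  -mu_ract !(umul_alpha, ur_alpha, ul_alpha).
Qed.

Lemma urho_sigma (P : lmodType k) (f : H -> M -> H -> P) m : trilin f ->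
  \sw_(h, x <- urho m) \sw_(y, g <- usigma x) f h y g
  = \sw_(x, g <- usigma m) \sw_(h, y <- urho x) f h y g.
Proof.
move=> tf; have [_ _ e] := s_bicovariant (bstr M).
(* These powers are those of the left-hand side. On the right the two outer ones are exchanged, and
   the [α] and [α'] of the axiom account for the difference. *)
pose F a x b := f (α a) (μ (μ x)) (α (α b)).
have tF : trilin F by rewrite /F; lin.
pose G a y := \sw_(x, b <- y) F a x b.
have bG : bilin G by rewrite /G; lin.
have E := congr1 (fun t => sw t G) (e m).
rewrite sw_urho ?sw_usigma; try by lin.
transitivity (sw (\sw_(b, x <- rho M m) \sw_(y, c <- sigma M x) (b ⊗ (y ⊗ c))) G).
  rewrite sw_sw //; apply: eq_sw => h x; rewrite sw_usigma ?sw_sigma_mu ?sw_sw; try by lin.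
  by apply: eq_sw => y g; rewrite sw_tpure // /G sw_tpure //; lin.
rewrite [LHS]E sw_sw //; apply: eq_sw => x g.
rewrite sw_urho ?sw_rho_mu ?sw_sw; try by lin.
by apply: eq_sw => h y; rewrite sw_tpure // /G sw_tpure /F ?autVK //; lin.
Qed.

(** The compatibility axiom treats both actions at once; acting by [hone H] on the other side
    isolates one of them. *)
Lemma urho_l h m : urho (ul h m) =
  \sw_(h1, h2 <- ucop H h) \sw_(a, x <- urho m) (umul h1 a ⊗ ul h2 x).
Proof.
rewrite -[ul h m]ur1 urho_lr; apply: eq_sw => h1 h2; apply: eq_sw => b x.
by rewrite ucop_one sw_tpure ?umul1r ?ur1 //; lin.
Qed.

Lemma urho_r m h : urho (ur m h) =
  \sw_(a, x <- urho m) \sw_(h1, h2 <- ucop H h) (umul a h1 ⊗ ur x h2).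
Proof.
rewrite -[m in ur m h]ul1 urho_lr ucop_one sw_tpure; last by lin.
by do 2 (apply: eq_sw => ? ?); rewrite umul1l ul1.
Qed.

Lemma usigma_l h m : usigma (ul h m) =
  \sw_(h1, h2 <- ucop H h) \sw_(x, a <- usigma m) (ul h1 x ⊗ umul h2 a).
Proof.
rewrite -[ul h m]ur1 usigma_lr; apply: eq_sw => h1 h2; apply: eq_sw => b x.
by rewrite ucop_one sw_tpure ?umul1r ?ur1 //; lin.
Qed.

Lemma usigma_r m h : usigma (ur m h) =
  \sw_(x, a <- usigma m) \sw_(h1, h2 <- ucop H h) (ur x h1 ⊗ umul a h2).
Proof.
rewrite -[m in ur m h]ul1 usigma_lr ucop_one sw_tpure; last by lin.
by do 2 (apply: eq_sw => ? ?); rewrite umul1l ul1.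
Qed.

Definition untwist_bimod : bimod (untwist_hopf H).
Proof.
refine (@Bimod k (untwist_hopf H) M ul ur urho usigma ul_bilin ur_bilin
  _ ul1 _ ur1 _ urhoA urho_cou usigmaA usigma_cou urho_l urho_r usigma_l usigma_r
  urho_sigma).
- move=> g h m; rewrite -[_ ⋅ _]/(umul g h) !ulE muV_lact /umul !alphaVM.
  by rewrite -[α' g in LHS](autVK α) lact_lact autVK.
- move=> m g h; rewrite -[_ ⋅ _]/(umul g h) !urE muV_ract /umul !alphaVM.
  by rewrite -[α' h in LHS](autVK α) ract_ract autVK.
- move=> g m h; rewrite urE ulE urE ulE muV_lact muV_ract.
  by rewrite -[α' h in LHS](autVK α) lact_ract autVK.
Defined.

End UntwistBimod.

Arguments untwist_bimod {k H} M.

(** * Restoring the automorphisms *)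

Section Twist.
Variables (k : comPzRingType) (H : homHopf k) (B : bimod (untwist_hopf H)).
Variable ξ : lin_aut B.
Local Notation α := (alpha H).
Local Notation α' := (autV (alpha H)).
Local Notation ξ' := (autV ξ).
Let l : H -> B -> B := @bl k (untwist_hopf H) B.
Let r : B -> H -> B := @br k (untwist_hopf H) B.
Let rho : {linear B -> tens H B} := brho B.
Let sigma : {linear B -> tens B H} := bsigma B.
Hypotheses (ξl : forall h x, ξ (l h x) = l (α h) (ξ x))
  (ξr : forall x h, ξ (r x h) = r (ξ x) (α h))
  (ξrho : forall x, rho (ξ x) = \sw_(h, y <- rho x) (α h ⊗ ξ y))
  (ξsigma : forall x, sigma (ξ x) = \sw_(y, h <- sigma x) (ξ y ⊗ α h)).

Let bm := @hmul_bilin k H.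
Let bum := @umul_bilin k H.
Let lb : bilin l := @bl_bilin k (untwist_hopf H) B.
Let rb : bilin r := @br_bilin k (untwist_hopf H) B.

Definition twl h x : B := ξ (l h x).
Definition twr x h : B := ξ (r x h).
Definition twrho : {linear B -> tens H B} := rho \o ξ'.
Definition twsigma : {linear B -> tens B H} := sigma \o ξ'.

Let sw_rho (P : lmodType k) (f : H -> B -> P) x : bilin f ->
  \sw_(h, y <- rho (ξ x)) f h y = \sw_(h, y <- rho x) f (α h) (ξ y).
Proof.
by move=> bf; rewrite ξrho sw_sw //; apply: eq_sw => ? ?; rewrite sw_tpure.
Qed.

Let sw_sigma (P : lmodType k) (f : B -> H -> P) x : bilin f ->
  \sw_(y, h <- sigma (ξ x)) f y h = \sw_(y, h <- sigma x) f (ξ y) (α h).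
Proof.
by move=> bf; rewrite ξsigma sw_sw //; apply: eq_sw => ? ?; rewrite sw_tpure.
Qed.

Let sw_rhoV (P : lmodType k) (f : H -> B -> P) x : bilin f ->
  \sw_(h, y <- rho (ξ' x)) f h y = \sw_(h, y <- rho x) f (α' h) (ξ' y).
Proof.
move=> bf; rewrite -[in RHS](autVK ξ x) sw_rho; last by lin.
by apply: eq_sw => h y; rewrite !autK.
Qed.

Let sw_sigmaV (P : lmodType k) (f : B -> H -> P) x : bilin f ->
  \sw_(y, h <- sigma (ξ' x)) f y h = \sw_(y, h <- sigma x) f (ξ' y) (α' h).
Proof.
move=> bf; rewrite -[in RHS](autVK ξ x) sw_sigma; last by lin.
by apply: eq_sw => h y; rewrite !autK.
Qed.

Let sw_DeltaV (P : lmodType k) (f : H -> H -> P) h : bilin f ->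
  \sw_(a, b <- Delta (α' h)) f a b = \sw_(a, b <- Delta h) f (α' a) (α' b).
Proof.
move=> bf; rewrite -[in RHS](autVK α h) sw_Delta_alpha; last by lin.
by apply: eq_sw => a b; rewrite !autK.
Qed.

Let twl_bilin : bilin twl.
Proof. by split=> ?; rewrite /twl; lin. Qed.

Let twr_bilin : bilin twr.
Proof. by split=> ?; rewrite /twr; lin. Qed.

Lemma twist_bimodule : hom_bimodule ξ twl twr.
Proof.
split; [split | split | split |].
- exact: twl_bilin.
- exact: twr_bilin.
- by move=> h m; rewrite /twl ξl.
- by move=> h m; rewrite /twr ξr.
- move=> g h m; rewrite /twl hmulE -ξl -ξl; congr (ξ (ξ _)).
  exact: (@blA _ _ B).
- by move=> m; congr (ξ _); exact: (@bl1 _ _ B).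
- move=> m g h; rewrite /twr hmulE -ξr -ξr; congr (ξ (ξ _)).
  exact: (@brA _ _ B).
- by move=> m; congr (ξ _); exact: (@br1 _ _ B).
- move=> g m h; rewrite /twr /twl -ξr -ξl; congr (ξ (ξ _)).
  exact: (@blrA _ _ B).
Qed.

Let rhoA (P : lmodType k) (f : H -> H -> B -> P) x : trilin f ->
  \sw_(h, y <- rho x) \sw_(a, b <- ucop H h) f a b y
  = \sw_(h, y <- rho x) \sw_(g, z <- rho y) f h g z.
Proof. exact: (@brhoA _ _ B P f x). Qed.

Let sigmaA (P : lmodType k) (f : B -> H -> H -> P) x : trilin f ->
  \sw_(y, h <- sigma x) \sw_(a, b <- ucop H h) f y a b
  = \sw_(y, h <- sigma x) \sw_(z, g <- sigma y) f z g h.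
Proof. exact: (@bsigmaA _ _ B P f x). Qed.

Let sw_rho_l (P : lmodType k) (f : H -> B -> P) h x : bilin f ->
  \sw_(a, y <- rho (l h x)) f a y =
  \sw_(h1, h2 <- ucop H h) \sw_(a, y <- rho x) f (umul h1 a) (l h2 y).
Proof. exact: (@sw_brho_l _ _ B P f h x). Qed.

Let sw_rho_r (P : lmodType k) (f : H -> B -> P) h x : bilin f ->
  \sw_(a, y <- rho (r x h)) f a y =
  \sw_(a, y <- rho x) \sw_(h1, h2 <- ucop H h) f (umul a h1) (r y h2).
Proof. exact: (@sw_brho_r _ _ B P f h x). Qed.

Let sw_sigma_l (P : lmodType k) (f : B -> H -> P) h x : bilin f ->
  \sw_(y, a <- sigma (l h x)) f y a =
  \sw_(h1, h2 <- ucop H h) \sw_(y, a <- sigma x) f (l h1 y) (umul h2 a).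
Proof. exact: (@sw_bsigma_l _ _ B P f h x). Qed.

Let sw_sigma_r (P : lmodType k) (f : B -> H -> P) h x : bilin f ->
  \sw_(y, a <- sigma (r x h)) f y a =
  \sw_(y, a <- sigma x) \sw_(h1, h2 <- ucop H h) f (r y h1) (umul a h2).
Proof. exact: (@sw_bsigma_r _ _ B P f h x). Qed.

Let rho_sigma (P : lmodType k) (f : H -> B -> H -> P) x : trilin f ->
  \sw_(h, y <- rho x) \sw_(z, g <- sigma y) f h z g
  = \sw_(y, g <- sigma x) \sw_(h, z <- rho y) f h z g.
Proof. exact: (@brho_sigma _ _ B P f x). Qed.

Lemma twist_left_comodule : left_hom_comodule ξ twrho.
Proof.
split=> m; rewrite /twrho /=.
- rewrite autK -[LHS]tens_id sw_rhoV; last by lin.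
  by apply: eq_sw => h x; rewrite !autVK.
- rewrite !sw_rhoV; try by lin.
  transitivity (\sw_(h, x <- rho m) \sw_(a, b <- ucop H h)
    ((α' (α' a) ⊗ α' (α' b)) ⊗ ξ' (ξ' x))).
    apply: eq_sw => h x; rewrite -[Delta _]tens_id sw_DeltaV; last by lin.
    rewrite (bilin_swl _ _ _ (@tpure_bilin _ _ _)) sw_ucop; last by lin.
    by apply: eq_sw => a b; rewrite !autK.
  rewrite (rhoA (f := fun a b x => (α' (α' a) ⊗ α' (α' b)) ⊗ ξ' (ξ' x))); last by lin.
  by symmetry; apply: eq_sw => h x; rewrite !sw_rhoV //; lin.
- exact: (@brho_cou _ _ B).
Qed.

Lemma twist_right_comodule : right_hom_comodule ξ twsigma.
Proof.
split=> m; rewrite /twsigma /=.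
- rewrite autK -[LHS]tens_id sw_sigmaV; last by lin.
  by apply: eq_sw => h x; rewrite !autVK.
- rewrite !sw_sigmaV; try by lin.
  transitivity (\sw_(x, h <- sigma m) \sw_(a, b <- ucop H h)
    (ξ' (ξ' x) ⊗ (α' (α' a) ⊗ α' (α' b)))).
    apply: eq_sw => x h; rewrite -[Delta _]tens_id sw_DeltaV; last by lin.
    rewrite (bilin_swr _ _ _ (@tpure_bilin _ _ _)) sw_ucop; last by lin.
    by apply: eq_sw => a b; rewrite !autK.
  rewrite (sigmaA (f := fun x a b => ξ' (ξ' x) ⊗ (α' (α' a) ⊗ α' (α' b)))); last by lin.
  by symmetry; apply: eq_sw => x h; rewrite !sw_sigmaV //; lin.
- exact: (@bsigma_cou _ _ B).
Qed.

Lemma twist_bicovariant : bicovariant twl twr twrho twsigma.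
Proof.
have lrE h m g : ξ' (twr (twl h m) (α g)) = ξ (r (l h m) g).
  by rewrite /twr /twl -ξr !autK.
have mulE (a b c : H) : a ∙ (α' b ∙ c) = α (umul (umul a b) (α c)).
  have -> : umul (umul a b) (α c) = umul a (umul b (α c)).
    exact/esym/(@hopfA _ (untwist_hopf H)).
  by rewrite /umul autVK alphaVM autK.
have actE (a c : H) x : twl a (twr (ξ' x) c) = ξ (r (l a x) (α c)).
  by rewrite /twl /twr ξr autVK; congr (ξ _); exact/esym/(@blrA _ _ B).
split=> [h m g | h m g | m]; rewrite /twrho /twsigma /=.
- rewrite lrE -[LHS]tens_id sw_rho ?sw_rho_r ?sw_rho_l; try by lin.
  rewrite -[Delta (α h)]/(ucop H h); apply: eq_sw => h1 h2.
  rewrite sw_rhoV; last by lin.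
  apply: eq_sw => b x; rewrite sw_ucop; last by lin.
  by apply: eq_sw => g1 g2; rewrite mulE actE.
- rewrite lrE -[LHS]tens_id sw_sigma ?sw_sigma_r ?sw_sigma_l; try by lin.
  rewrite -[Delta (α h)]/(ucop H h); apply: eq_sw => h1 h2.
  rewrite sw_sigmaV; last by lin.
  apply: eq_sw => b x; rewrite sw_ucop; last by lin.
  by apply: eq_sw => g1 g2; rewrite mulE actE.
- rewrite sw_rhoV ?sw_sigmaV; try by lin.
  transitivity (\sw_(b, x <- rho m) \sw_(y, c <- sigma x)
     (α' b ⊗ (ξ' (ξ' y) ⊗ α' (α' c)))).
    by apply: eq_sw => b x; rewrite !sw_sigmaV //; lin.
  rewrite (rho_sigma (f := fun b y c => α' b ⊗ (ξ' (ξ' y) ⊗ α' (α' c)))); last by lin.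
  symmetry; apply: eq_sw => x c; rewrite !sw_rhoV; try by lin.
  by apply: eq_sw => b y; rewrite autVK.
Qed.

(** The converse of [untwist_bimod]. It gives [tensH M N] its Hom-structure, from the ordinary one
    that [tens_bimod] provides. *)
Definition twist_struct : bicov_struct H B :=
  BicovStruct twist_bimodule twist_left_comodule twist_right_comodule
    twist_bicovariant.

End Twist.

Section Quotient.
Variables (k : comPzRingType) (V : lmodType k) (A : V -> Prop) (P : lmodType k).

Lemma quot_lift (f : V -> P) : linear f -> (forall u, A u -> f u = 0) ->
  exists g : {linear quot A -> P}, forall v, g (qproj A v) = f v.
Proof.
move=> lf fA.
have f0 : f 0 = 0 by have := linear0 (mklin lf).
have fS u : spanned A u -> f u = 0.
  by elim=> [|a v w Av _ IH] //; rewrite lf fA // IH scaler0 addr0.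
pose g (x : quot A) := f (repr x).
have gE v : g (qproj A v) = f v.
  apply/eqP; rewrite -subr_eq0; apply/eqP.
  have := fS _ (qrepr A v); rewrite /g => <-.
  by have := linearB (mklin lf) (repr (qproj A v)) v.
have lg : linear g.
  move=> a x y; have [u ->] := Defs.quotP x; have [v ->] := Defs.quotP y.
  by rewrite -qproj_linear !gE lf.
by exists (mklin lg).
Qed.

End Quotient.

(** * The Hom-tensor product *)

Section TensH.
Variables (k : comPzRingType) (H : homHopf k) (M N : bicov H).
Local Notation α := (alpha H).
Local Notation α' := (autV (alpha H)).
Local Notation μ := (mu M).
Local Notation ν := (mu N).
Local Notation μ' := (autV (mu M)).
Local Notation ν' := (autV (mu N)).

(* The shift by the automorphisms turns the structure maps of the Hom-tensor product into those of the ordinary one. *)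
Definition utp (m : M) (n : N) : tensH M N := μ' m ⊗_[M, N] ν' n.

Lemma tpureH_bilin : bilin (tpureH M N).
Proof.
have lq := @qproj_linear _ _ (@tensH_rel k H M N).
by split=> x; rewrite /tpureH; lin.
Qed.

Lemma tpureHE m n : m ⊗_[M, N] n = utp (μ m) (ν n).
Proof. by rewrite /utp !autK. Qed.

Lemma tpureH_bal (m : M) (h : H) (n : N) :
  (m ◁ h) ⊗_[M, N] n = μ m ⊗_[M, N] (h ▷ ν' n).
Proof.
apply/qproj_eqP.
rewrite -[_ - _]scale1r -[X in spanned _ X]addr0; apply: spanned_lin; last exact: spanned0.
by exists m, h, n.
Qed.

Lemma utp_balanced :
  balanced_tensor (M := untwist_bimod M) (N := untwist_bimod N) utp.
Proof.
have bt := tpureH_bilin.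
split=> [|m h n | P f bf balf | P f g lf lg fg].
- by split=> ?; rewrite /utp; lin.
- rewrite -[m ⊲ h]/(ur m h) -[h ⊳ n]/(ul h n) /utp urE ulE muV_lact muV_ract.
  by rewrite tpureH_bal autVK.
(* [F] undoes the shift in [utp], so that the balancing of [f] becomes the vanishing of [F] on
   [tensH_rel]. *)
- pose F m n := f (μ m) (ν n).
  have bf' : @bilin k M N P f := bf.
  have bF : bilin F by split=> ?; rewrite /F; lin.
  have [||g gE] := @quot_lift _ _ (@tensH_rel k H M N) P (fun t => sw t F).
  + exact: sw_linear.
  + move=> u [m [h [n ->]]].
    have := linearB (mklin (sw_linear bF)) ((m ◁ h) ⊗ n) (μ m ⊗ h ▷ ν' n).
    move=> /= ->; rewrite !sw_tpure // /F; apply/eqP; rewrite subr_eq0; apply/eqP.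
    rewrite -ur_alpha mu_ur -ul_alpha mu_ul autVK.
    exact: balf.
  by exists g => m n; rewrite gE sw_tpure // /F !autVK.
- have lq := @qproj_linear _ _ (@tensH_rel k H M N).
  move=> x; have [t ->] := Defs.quotP x; rewrite -[t]tens_id.
  rewrite !(linear_sw _ _ lq) (linear_sw _ _ lf) (linear_sw _ _ lg).
  by apply: eq_sw => m n; rewrite -/(tpureH M N m n) tpureHE.
Qed.

Let HT := utp_balanced.
Let tb : bilin utp := bt_bilin HT.

Lemma utp_bal m h n : utp (ur m h) n = utp m (ul h n).
Proof. exact: bt_bal HT m h n. Qed.

Lemma utp_ext (P : lmodType k) (f g : tensH M N -> P) : linear f -> linear g ->
  (forall m n, f (utp m n) = g (utp m n)) -> f =1 g.
Proof. by move=> lf lg fg; exact: (bt_ext HT lf lg fg). Qed.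

Lemma utp_lift (P : lmodType k) (f : M -> N -> P) : bilin f ->
  (forall m h n, f (ur m h) n = f m (ul h n)) ->
  exists g : {linear tensH M N -> P}, forall m n, g (utp m n) = f m n.
Proof. by move=> bf balf; exact: (bt_lift HT bf balf). Qed.

Lemma tensH_mu_ex : exists ξ : {linear tensH M N -> tensH M N},
  forall m n, ξ (utp m n) = utp (μ m) (ν n).
Proof.
apply: (utp_lift (f := fun m n => utp (μ m) (ν n))); first by split=> ?; lin.
by move=> m h n; rewrite mu_ur mu_ul utp_bal.
Qed.

Lemma tensH_muV_ex : exists ξ : {linear tensH M N -> tensH M N},
  forall m n, ξ (utp m n) = utp (μ' m) (ν' n).
Proof.
apply: (utp_lift (f := fun m n => utp (μ' m) (ν' n))); first by split=> ?; lin.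
move=> m h n; rewrite -[m in LHS](autVK μ) -[n in RHS](autVK ν) -(autVK α h).
by rewrite -mu_ur -mu_ul !autK utp_bal.
Qed.

Definition tensH_mu := projT1 (cid tensH_mu_ex).
Definition tensH_muV := projT1 (cid tensH_muV_ex).

Lemma tensH_muE m n : tensH_mu (utp m n) = utp (μ m) (ν n).
Proof. exact: (projT2 (cid tensH_mu_ex)). Qed.

Lemma tensH_muVE m n : tensH_muV (utp m n) = utp (μ' m) (ν' n).
Proof. exact: (projT2 (cid tensH_muV_ex)). Qed.

Lemma tensH_muK : cancel tensH_mu tensH_muV.
Proof.
apply: (utp_ext (f := fun x => tensH_muV (tensH_mu x)) (g := id)) => [||m n]; try by lin.
by rewrite tensH_muE tensH_muVE !autK.
Qed.

Lemma tensH_muVK : cancel tensH_muV tensH_mu.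
Proof.
apply: (utp_ext (f := fun x => tensH_mu (tensH_muV x)) (g := id)) => [||m n]; try by lin.
by rewrite tensH_muVE tensH_muE !autVK.
Qed.

Definition tensH_aut : lin_aut (tensH M N) := LinAut tensH_muK tensH_muVK.

Let B := tens_bimod HT.
Let Bl : H -> tensH M N -> tensH M N := tens_l HT.
Let Br : tensH M N -> H -> tensH M N := tens_r HT.
Let Brho : {linear tensH M N -> tens H (tensH M N)} := tens_rho HT.
Let Bsigma : {linear tensH M N -> tens (tensH M N) H} := tens_sigma HT.
Let lb : bilin Bl := tens_l_bilin HT.
Let rb : bilin Br := tens_r_bilin HT.
Let bum := @umul_bilin k H.

Let BlE h m n : Bl h (utp m n) = utp (ul h m) n.
Proof. exact: tens_lE. Qed.

Let BrE m n h : Br (utp m n) h = utp m (ur n h).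
Proof. exact: tens_rE. Qed.

Let BrhoE m n : Brho (utp m n) =
  \sw_(a, x <- urho M m) \sw_(b, y <- urho N n) (umul a b ⊗ utp x y).
Proof. exact: (tens_rhoE HT m n). Qed.

Let BsigmaE m n : Bsigma (utp m n) =
  \sw_(x, a <- usigma M m) \sw_(y, b <- usigma N n) (utp x y ⊗ umul a b).
Proof. exact: (tens_sigmaE HT m n). Qed.

Let ξl h x : tensH_mu (Bl h x) = Bl (α h) (tensH_mu x).
Proof.
apply: (utp_ext (f := fun x => tensH_mu (Bl h x))
  (g := fun x => Bl (α h) (tensH_mu x))) => [||m n]; try by lin.
by rewrite tensH_muE !BlE tensH_muE mu_ul.
Qed.

Let ξr x h : tensH_mu (Br x h) = Br (tensH_mu x) (α h).
Proof.
apply: (utp_ext (f := fun x => tensH_mu (Br x h))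
  (g := fun x => Br (tensH_mu x) (α h))) => [||m n]; try by lin.
by rewrite tensH_muE !BrE tensH_muE mu_ur.
Qed.

Let ξrho x : Brho (tensH_mu x) = \sw_(h, y <- Brho x) (α h ⊗ tensH_mu y).
Proof.
apply: (utp_ext (f := fun x => Brho (tensH_mu x))
  (g := fun x => \sw_(h, y <- Brho x) (α h ⊗ tensH_mu y))) => [||m n]; try by lin.
rewrite tensH_muE !BrhoE sw_urho_mu ?sw_sw; try by lin.
apply: eq_sw => a x'; rewrite sw_urho_mu ?sw_sw; try by lin.
apply: eq_sw => b y; rewrite sw_tpure; last by lin.
by rewrite tensH_muE umul_alpha hmulE.
Qed.

Let ξsigma x : Bsigma (tensH_mu x) = \sw_(y, h <- Bsigma x) (tensH_mu y ⊗ α h).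
Proof.
apply: (utp_ext (f := fun x => Bsigma (tensH_mu x))
  (g := fun x => \sw_(y, h <- Bsigma x) (tensH_mu y ⊗ α h))) => [||m n]; try by lin.
rewrite tensH_muE !BsigmaE sw_usigma_mu ?sw_sw; try by lin.
apply: eq_sw => a x'; rewrite sw_usigma_mu ?sw_sw; try by lin.
apply: eq_sw => b y; rewrite sw_tpure; last by lin.
by rewrite tensH_muE umul_alpha hmulE.
Qed.

Definition tensH_struct : bicov_struct H (tensH M N) :=
  @twist_struct k H B tensH_aut ξl ξr ξrho ξsigma.

Lemma tensH_structP : is_tensH_struct tensH_struct.
Proof.
split=> [m n | h m n | m n h | m n | m n].
- by rewrite !tpureHE; exact: tensH_muE.
- rewrite !tpureHE -ul_alpha autVK.
  by rewrite -[LHS]/(tensH_mu (Bl h (utp (μ m) (ν n)))) BlE tensH_muE mu_ul.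
- rewrite !tpureHE -ur_alpha autVK.
  by rewrite -[LHS]/(tensH_mu (Br (utp (μ m) (ν n)) h)) BrE tensH_muE mu_ur.
- rewrite tpureHE -[LHS]/(Brho (tensH_muV (utp (μ m) (ν n)))) tensH_muVE !autK.
  rewrite BrhoE sw_urho; last by lin.
  apply: eq_sw => a x; rewrite sw_urho; last by lin.
  by apply: eq_sw => b y; rewrite umul_alpha tpureHE.
- rewrite tpureHE -[LHS]/(Bsigma (tensH_muV (utp (μ m) (ν n)))) tensH_muVE !autK.
  rewrite BsigmaE sw_usigma; last by lin.
  apply: eq_sw => a x; rewrite sw_usigma; last by lin.
  by apply: eq_sw => b y; rewrite umul_alpha tpureHE.
Qed.

Definition bicov_tens : bicov H := Bicov tensH_struct.

(** Twisting followed by untwisting inserts [tensH_mu] and then [tensH_muV] into each structure map,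
    and these cancel. Hence untwisting turns the Hom-tensor product into the ordinary one. *)
Lemma utpP : @bimod_tensor k _ (untwist_bimod M) (untwist_bimod N)
  (untwist_bimod bicov_tens) utp.
Proof.
split; [split=> // | |].
- by move=> h m n; apply: etrans (BlE h m n); exact: tensH_muK.
- by move=> m n h; apply: etrans (BrE m n h); exact: tensH_muK.
- by move=> m n; apply: etrans (BrhoE m n); congr (Brho _); exact: tensH_muK.
- by move=> m n; apply: etrans (BsigmaE m n); congr (Bsigma _); exact: tensH_muK.
Qed.

Lemma mu_utp m n : mu bicov_tens (utp m n) = utp (μ m) (ν n).
Proof. exact: tensH_muE. Qed.

End TensH.

(** * The monoidal category *)

Section Morphisms.
Variables (k : comPzRingType) (H : homHopf k).
Implicit Types M N P Q : bicov H.

Section FromUntwisted.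
Variables (M N : bicov H) (f : {linear M -> N}).
Hypotheses (fmu : forall m, mu N (f m) = f (mu M m))
  (fl : forall h m, f (ul h m) = ul h (f m))
  (fr : forall m h, f (ur m h) = ur (f m) h)
  (frho : forall m, urho N (f m) = \sw_(h, x <- urho M m) (h ⊗ f x))
  (fsigma : forall m, usigma N (f m) = \sw_(x, h <- usigma M m) (f x ⊗ h)).

(** For a map that commutes with the automorphisms, compatibility with the Hom-structures and with
    the untwisted ones amount to the same. *)
Lemma uhom_ex : exists F : bicov_hom M N, F =1 f.
Proof.
have f_lact h m : f (h ▷ m) = h ▷ f m by rewrite !lactE -fmu fl.
have f_ract m h : f (m ◁ h) = f m ◁ h by rewrite !ractE -fmu fr.
have f_rho m : rho N (f m) = \sw_(h, x <- rho M m) (h ⊗ f x).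
  by have := frho (autV (mu M) m); rewrite /urho /= fmu autVK.
have f_sigma m : sigma N (f m) = \sw_(x, h <- sigma M m) (f x ⊗ h).
  by have := fsigma (autV (mu M) m); rewrite /usigma /= fmu autVK.
by exists (BicovHom fmu f_lact f_ract f_rho f_sigma).
Qed.

End FromUntwisted.

Section ToUntwisted.
Variables (M N : bicov H) (f : bicov_hom M N).

Lemma bhom_muV m : autV (mu N) (f m) = f (autV (mu M) m).
Proof. by apply: (can_inj (autK (mu N))); rewrite bhom_mu !autVK. Qed.

Lemma bhom_ul h m : f (ul h m) = ul h (f m).
Proof. by rewrite /ul -bhom_muV bhom_lact. Qed.

Lemma bhom_ur m h : f (ur m h) = ur (f m) h.
Proof. by rewrite /ur -bhom_muV bhom_ract. Qed.

Lemma bhom_urho m : urho N (f m) = \sw_(h, x <- urho M m) (h ⊗ f x).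
Proof. by rewrite /urho /= bhom_mu bhom_rho. Qed.

Lemma bhom_usigma m : usigma N (f m) = \sw_(x, h <- usigma M m) (f x ⊗ h).
Proof. by rewrite /usigma /= bhom_mu bhom_sigma. Qed.

End ToUntwisted.

(** Each compatibility of [g] follows from that of [f] by cancellation. The inverses of the
    constraints and of the braiding therefore need only be given as linear maps. *)
Lemma bhom_inv M N (f : bicov_hom M N) (g : {linear N -> M}) :
  cancel f g -> cancel g f -> exists2 G : bicov_hom N M,
    bicov_comp G f = bicov_id M & bicov_comp f G = bicov_id N.
Proof.
move=> fK gK.
have [|||||G GE] := @uhom_ex N M g.
- by move=> m; apply: (can_inj fK); rewrite -bhom_mu !gK.
- by move=> h m; apply: (can_inj fK); rewrite bhom_ul !gK.
- by move=> m h; apply: (can_inj fK); rewrite bhom_ur !gK.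
- move=> m; rewrite -[m in RHS]gK bhom_urho sw_sw; last by lin.
  rewrite -[LHS]tens_id; apply: eq_sw => h x.
  by rewrite sw_tpure ?fK //; lin.
- move=> m; rewrite -[m in RHS]gK bhom_usigma sw_sw; last by lin.
  rewrite -[LHS]tens_id; apply: eq_sw => h x.
  by rewrite sw_tpure ?fK //; lin.
exists G; apply: bicov_hom_ext => x /=; rewrite GE; [exact: fK | exact: gK].
Qed.

Lemma sw_urho_utp M N (P : lmodType k) (f : H -> tensH M N -> P) m n : bilin f ->
  \sw_(h, x <- urho (bicov_tens M N) (utp m n)) f h x =
  \sw_(a, x <- urho M m) \sw_(b, y <- urho N n) f (umul a b) (utp x y).
Proof. by move=> bf; exact: (sw_bmt_rho (utpP M N) m n bf). Qed.

Lemma sw_usigma_utp M N (P : lmodType k) (f : tensH M N -> H -> P) m n : bilin f ->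
  \sw_(x, h <- usigma (bicov_tens M N) (utp m n)) f x h =
  \sw_(x, a <- usigma M m) \sw_(y, b <- usigma N n) f (utp x y) (umul a b).
Proof. by move=> bf; exact: (sw_bmt_sigma (utpP M N) m n bf). Qed.

Lemma ul_utp M N h (m : M) (n : N) :
  ul h (utp m n : bicov_tens M N) = utp (ul h m) n.
Proof. exact: (at_l (utpP M N)). Qed.

Lemma ur_utp M N (m : M) (n : N) h :
  ur (utp m n : bicov_tens M N) h = utp m (ur n h).
Proof. exact: (at_r (utpP M N)). Qed.

Lemma tens_ext M N (P : lmodType k) (f g : bicov_tens M N -> P) :
  linear f -> linear g -> (forall m n, f (utp m n) = g (utp m n)) -> f =1 g.
Proof. exact: utp_ext. Qed.

Lemma utp_bilin M N : bilin (@utp k H M N).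
Proof. exact: bt_bilin (utp_balanced M N). Qed.

End Morphisms.

#[export] Hint Extern 1 (bilin (@utp ?k ?H ?M ?N)) => exact (@utp_bilin k H M N) : multilin.
#[export] Hint Extern 1 (bilin (@ul ?k ?H ?M)) => exact (@ul_bilin k H M) : multilin.
#[export] Hint Extern 1 (bilin (@ur ?k ?H ?M)) => exact (@ur_bilin k H M) : multilin.
#[export] Hint Extern 1 (bilin (@umul ?k ?H)) => exact (@umul_bilin k H) : multilin.

Section TensorMorphism.
Variables (k : comPzRingType) (H : homHopf k) (M M' N N' : bicov H).
Variables (f : bicov_hom M M') (g : bicov_hom N N').

Lemma tens_hom_ex : exists F : bicov_hom (bicov_tens M N) (bicov_tens M' N'),
  forall m n, F (utp m n) = utp (f m) (g n).
Proof.
have [||F FE] := utp_lift (f := fun m n => utp (f m) (g n)).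
- by lin.
- by move=> m h n; rewrite bhom_ur bhom_ul utp_bal.
have [|||||G GE] := @uhom_ex k H (bicov_tens M N) (bicov_tens M' N') F;
    last by exists G => m n; rewrite GE.
- apply: tens_ext => [||m n]; try by lin.
  by rewrite FE !mu_utp FE !bhom_mu.
- move=> h; apply: tens_ext => [||m n]; try by lin.
  by rewrite FE !ul_utp FE bhom_ul.
- move=> x h; move: x; apply: tens_ext => [||m n]; try by lin.
  by rewrite FE !ur_utp FE bhom_ur.
- apply: tens_ext => [||m n]; try by lin.
  rewrite FE -[LHS]tens_id !sw_urho_utp ?bhom_urho ?sw_sw; try by lin.
  apply: eq_sw => a x; rewrite sw_tpure ?bhom_urho ?sw_sw; try by lin.
  by apply: eq_sw => b y; rewrite sw_tpure ?FE //; lin.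
- apply: tens_ext => [||m n]; try by lin.
  rewrite FE -[LHS]tens_id !sw_usigma_utp ?bhom_usigma ?sw_sw; try by lin.
  apply: eq_sw => a x; rewrite sw_tpure ?bhom_usigma ?sw_sw; try by lin.
  by apply: eq_sw => b y; rewrite sw_tpure ?FE //; lin.
Qed.

Definition tens_hom := projT1 (cid tens_hom_ex).

Lemma tens_homE m n : tens_hom (utp m n) = utp (f m) (g n).
Proof. exact: (projT2 (cid tens_hom_ex)). Qed.

End TensorMorphism.

Section ParametrizedLift.
Variables (k : comPzRingType) (H : homHopf k) (M N : bicov H).
Variables (P Q : lmodType k) (f : Q -> M -> N -> P).
Hypotheses (tf : trilin f)
  (balf : forall q m h n, f q (ur m h) n = f q m (ul h n)).

(** Maps out of a nested tensor product are lifted one level at a time; the outer lift needs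
    bilinearity of the inner one together with its parameter, again recovered from uniqueness. *)
Lemma utp_lift_param : exists F : Q -> tensH M N -> P,
  bilin F /\ forall q m n, F q (utp m n) = f q m n.
Proof.
have ex q : exists g : {linear tensH M N -> P}, forall m n, g (utp m n) = f q m n.
  by apply: (utp_lift (f := f q)); [lin | exact: balf].
pose F q x := projT1 (cid (ex q)) x.
have FE q m n : F q (utp m n) = f q m n := projT2 (cid (ex q)) m n.
have Fl q : linear (F q) by rewrite /F; exact: linearP.
exists F; split=> //; split=> // x a q q' /=.
apply: (utp_ext (f := F (a *: q + q')) (g := fun x => a *: F q x + F q' x)) => //.
  move=> b y z; rewrite !Fl !scalerDr !scalerA [b * a]mulrC.
  by rewrite addrACA.
by case: tf => f1 _ _ m n; rewrite !FE f1.
Qed.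

End ParametrizedLift.

(** * The associativity constraint *)

Section TripleTensor.
Variables (k : comPzRingType) (H : homHopf k) (M N P : bicov H).
Local Notation "A ⊠ B" := (bicov_tens A B) (at level 40, left associativity).

Lemma tens_ext_l (Q : lmodType k) (f g : (M ⊠ N) ⊠ P -> Q) : linear f -> linear g ->
  (forall m n p, f (utp (utp m n : M ⊠ N) p) = g (utp (utp m n : M ⊠ N) p)) -> f =1 g.
Proof.
move=> lf lg fg; apply: tens_ext => // x p; move: x.
apply: (tens_ext (f := fun x : M ⊠ N => f (utp x p))
  (g := fun x : M ⊠ N => g (utp x p))) => [||m n]; try by lin.
exact: fg.
Qed.

Lemma tens_ext_r (Q : lmodType k) (f g : M ⊠ (N ⊠ P) -> Q) : linear f -> linear g ->
  (forall m n p, f (utp m (utp n p : N ⊠ P)) = g (utp m (utp n p : N ⊠ P))) -> f =1 g.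
Proof.
move=> lf lg fg; apply: tens_ext => // m.
apply: (tens_ext (f := fun x : N ⊠ P => f (utp m x))
  (g := fun x : N ⊠ P => g (utp m x))) => [||n p]; try by lin.
exact: fg.
Qed.

Lemma assoc_linear : exists F : {linear (M ⊠ N) ⊠ P -> M ⊠ (N ⊠ P)},
  forall m n p, F (utp (utp m n : M ⊠ N) p) = utp m (utp n p : N ⊠ P).
Proof.
have [|q m h n|G [bG GE]] := utp_lift_param
  (f := fun (p : P) (m : M) (n : N) => utp m (utp n p : N ⊠ P)).
- by lin.
- by rewrite utp_bal ul_utp.
have [|x h p|F FE] := utp_lift (f := fun (x : M ⊠ N) (p : P) => G p x).
- by case: bG.
- move: x; apply: tens_ext => [||m n]; try by lin.
  by rewrite ur_utp !GE utp_bal.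
by exists F => m n p; rewrite FE GE.
Qed.

Lemma assoc_linear_inv : exists F : {linear M ⊠ (N ⊠ P) -> (M ⊠ N) ⊠ P},
  forall m n p, F (utp m (utp n p : N ⊠ P)) = utp (utp m n : M ⊠ N) p.
Proof.
have [|q m h n|G [bG GE]] := utp_lift_param
  (f := fun (m : M) (n : N) (p : P) => utp (utp m n : M ⊠ N) p).
- by lin.
- by rewrite -utp_bal ur_utp.
have [|m h x|F FE] := utp_lift (f := fun (m : M) (x : N ⊠ P) => G m x).
- by [].
- move: x; apply: tens_ext => [||n p]; try by lin.
  by rewrite ul_utp !GE utp_bal.
by exists F => m n p; rewrite FE GE.
Qed.

Lemma assoc_ex : exists (F : bicov_hom ((M ⊠ N) ⊠ P) (M ⊠ (N ⊠ P)))
    (G : bicov_hom (M ⊠ (N ⊠ P)) ((M ⊠ N) ⊠ P)),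
  [/\ forall m n p, F (utp (utp m n : M ⊠ N) p) = utp m (utp n p : N ⊠ P),
      forall m n p, G (utp m (utp n p : N ⊠ P)) = utp (utp m n : M ⊠ N) p,
      bicov_comp G F = bicov_id _ & bicov_comp F G = bicov_id _].
Proof.
have [A AE] := assoc_linear; have [A' A'E] := assoc_linear_inv.
have [|||||F FE] := @uhom_ex k H ((M ⊠ N) ⊠ P) (M ⊠ (N ⊠ P)) A.
- apply: tens_ext_l => [||m n p]; try by lin.
  by rewrite AE !mu_utp AE.
- move=> h; apply: tens_ext_l => [||m n p]; try by lin.
  by rewrite AE !ul_utp AE.
- move=> x h; move: x; apply: tens_ext_l => [||m n p]; try by lin.
  by rewrite AE !ur_utp AE.
- apply: tens_ext_l => [||m n p]; try by lin.
  rewrite AE -[LHS]tens_id !sw_urho_utp; try by lin.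
  apply: eq_sw => a x; rewrite sw_urho_utp; last by lin.
  apply: eq_sw => b y; apply: eq_sw => c z.
  by rewrite AE; congr (_ ⊗ _); exact: (@hopfA _ (untwist_hopf H)).
- apply: tens_ext_l => [||m n p]; try by lin.
  rewrite AE -[LHS]tens_id !sw_usigma_utp; try by lin.
  apply: eq_sw => a x; rewrite sw_usigma_utp; last by lin.
  apply: eq_sw => b y; apply: eq_sw => c z.
  by rewrite AE; congr (_ ⊗ _); exact: (@hopfA _ (untwist_hopf H)).
have FK : cancel F A'.
  move=> x; rewrite FE; move: x.
  apply: (tens_ext_l (f := fun x => A' (A x)) (g := id)) => [||m n p]; try by lin.
  by rewrite AE A'E.
have KF : cancel A' F.
  move=> x; rewrite FE; move: x.
  apply: (tens_ext_r (f := fun x => A (A' x)) (g := id)) => [||m n p]; try by lin.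
  by rewrite A'E AE.
have [G GF FG] := bhom_inv FK KF.
exists F, G; split=> // m n p; first by rewrite FE AE.
have -> : utp m (utp n p : N ⊠ P) = F (utp (utp m n : M ⊠ N) p) by rewrite FE AE.
by rewrite -[LHS]/(bicov_comp G F _) GF.
Qed.

Definition assoc_fwd := projT1 (cid assoc_ex).
Let assoc_ex2 := projT2 (cid assoc_ex).
Definition assoc_bwd := projT1 (cid assoc_ex2).
Let assocP := projT2 (cid assoc_ex2).

Lemma assoc_fwdE m n p :
  assoc_fwd (utp (utp m n : M ⊠ N) p) = utp m (utp n p : N ⊠ P).
Proof. by case: assocP => e *; exact: e. Qed.

Lemma assoc_bwdE m n p :
  assoc_bwd (utp m (utp n p : N ⊠ P)) = utp (utp m n : M ⊠ N) p.
Proof. by case: assocP => _ e *; exact: e. Qed.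

Lemma assoc_fwdK : bicov_comp assoc_bwd assoc_fwd = bicov_id _.
Proof. by case: assocP. Qed.

Lemma assoc_bwdK : bicov_comp assoc_fwd assoc_bwd = bicov_id _.
Proof. by case: assocP. Qed.

End TripleTensor.

(** * The unit constraints *)

Section Units.
Variables (k : comPzRingType) (H : homHopf k) (M : bicov H).
Local Notation "A ⊠ B" := (bicov_tens A B) (at level 40, left associativity).
Local Notation I := (unit_bicov H).

Lemma lunit_ex : exists (F : bicov_hom (I ⊠ M) M) (G : bicov_hom M (I ⊠ M)),
  [/\ forall h m, F (utp (h : I) m) = ul h m,
      bicov_comp G F = bicov_id _ & bicov_comp F G = bicov_id _].
Proof.
have [||A AE] := utp_lift (f := fun (h : I) (m : M) => ul h m).
- exact: ul_bilin.
- by move=> m h n; exact/esym/(@blA _ _ (untwist_bimod M)).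
have [|||||F FE] := @uhom_ex k H (I ⊠ M) M A.
- apply: tens_ext => [||m n]; try by lin.
  by rewrite AE !mu_utp AE mu_ul.
- move=> h; apply: tens_ext => [||m n]; try by lin.
  by rewrite AE !ul_utp AE; exact/esym/(@blA _ _ (untwist_bimod M)).
- move=> x h; move: x; apply: tens_ext => [||m n]; try by lin.
  by rewrite AE !ur_utp AE; exact/esym/(@blrA _ _ (untwist_bimod M)).
- apply: tens_ext => [||m n]; try by lin.
  rewrite AE urho_l sw_urho_utp; last by lin.
  by apply: eq_sw => a x; apply: eq_sw => b y; rewrite AE.
- apply: tens_ext => [||m n]; try by lin.
  rewrite AE usigma_l sw_usigma_utp; last by lin.
  by apply: eq_sw => a x; apply: eq_sw => b y; rewrite AE.
have lG : linear (fun m : M => utp (hone H : I) m) by lin.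
have FK : cancel F (mklin lG).
  move=> x; rewrite FE; move: x.
  apply: (tens_ext (f := fun x => mklin lG (A x)) (g := id)) => [||h m]; try by lin.
  rewrite AE /= -utp_bal (_ : ur _ _ = h) //; exact: umul1l.
have KF : cancel (mklin lG) F by move=> m; rewrite FE AE; exact: ul1.
have [G GF FG] := bhom_inv FK KF.
by exists F, G; split=> // m n; rewrite FE AE.
Qed.

Lemma runit_ex : exists (F : bicov_hom (M ⊠ I) M) (G : bicov_hom M (M ⊠ I)),
  [/\ forall m h, F (utp m (h : I)) = ur m h,
      bicov_comp G F = bicov_id _ & bicov_comp F G = bicov_id _].
Proof.
have [||A AE] := utp_lift (f := fun (m : M) (h : I) => ur m h).
- exact: ur_bilin.
- by move=> m h n; exact: (@brA _ _ (untwist_bimod M)).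
have [|||||F FE] := @uhom_ex k H (M ⊠ I) M A.
- apply: tens_ext => [||m n]; try by lin.
  by rewrite AE !mu_utp AE mu_ur.
- move=> h; apply: tens_ext => [||m n]; try by lin.
  by rewrite AE !ul_utp AE; exact: (@blrA _ _ (untwist_bimod M)).
- move=> x h; move: x; apply: tens_ext => [||m n]; try by lin.
  by rewrite AE !ur_utp AE; exact/esym/(@brA _ _ (untwist_bimod M)).
- apply: tens_ext => [||m n]; try by lin.
  rewrite AE urho_r sw_urho_utp; last by lin.
  by apply: eq_sw => a x; apply: eq_sw => b y; rewrite AE.
- apply: tens_ext => [||m n]; try by lin.
  rewrite AE usigma_r sw_usigma_utp; last by lin.
  by apply: eq_sw => a x; apply: eq_sw => b y; rewrite AE.
have lG : linear (fun m : M => utp m (hone H : I)) by lin.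
have FK : cancel F (mklin lG).
  move=> x; rewrite FE; move: x.
  apply: (tens_ext (f := fun x => mklin lG (A x)) (g := id)) => [||m h]; try by lin.
  rewrite AE /= utp_bal (_ : ul _ _ = h) //; exact: umul1r.
have KF : cancel (mklin lG) F by move=> m; rewrite FE AE; exact: ur1.
have [G GF FG] := bhom_inv FK KF.
by exists F, G; split=> // m n; rewrite FE AE.
Qed.

Definition lunit_fwd := projT1 (cid lunit_ex).
Let lunit_ex2 := projT2 (cid lunit_ex).
Definition lunit_bwd := projT1 (cid lunit_ex2).
Let lunitP := projT2 (cid lunit_ex2).

Lemma lunit_fwdE h m : lunit_fwd (utp (h : I) m) = ul h m.
Proof. by case: lunitP => e *; exact: e. Qed.

Lemma lunit_fwdK : bicov_comp lunit_bwd lunit_fwd = bicov_id _.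
Proof. by case: lunitP. Qed.

Lemma lunit_bwdK : bicov_comp lunit_fwd lunit_bwd = bicov_id _.
Proof. by case: lunitP. Qed.

Definition runit_fwd := projT1 (cid runit_ex).
Let runit_ex2 := projT2 (cid runit_ex).
Definition runit_bwd := projT1 (cid runit_ex2).
Let runitP := projT2 (cid runit_ex2).

Lemma runit_fwdE m h : runit_fwd (utp m (h : I)) = ur m h.
Proof. by case: runitP => e *; exact: e. Qed.

Lemma runit_fwdK : bicov_comp runit_bwd runit_fwd = bicov_id _.
Proof. by case: runitP. Qed.

Lemma runit_bwdK : bicov_comp runit_fwd runit_bwd = bicov_id _.
Proof. by case: runitP. Qed.

End Units.

Section Monoidal.
Variables (k : comPzRingType) (H : homHopf k).
Implicit Types M N P Q : bicov H.
Local Notation "A ⊠ B" := (bicov_tens A B) (at level 40, left associativity).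
Local Notation I := (unit_bicov H).

Lemma tens_hom_id M N : tens_hom (bicov_id M) (bicov_id N) = bicov_id (M ⊠ N).
Proof.
apply: bicov_hom_ext; apply: tens_ext => [||m n]; try by lin.
by rewrite tens_homE.
Qed.

Lemma tens_hom_comp M M' M'' N N' N'' (f' : bicov_hom M' M'') (f : bicov_hom M M')
    (g' : bicov_hom N' N'') (g : bicov_hom N N') :
  tens_hom (bicov_comp f' f) (bicov_comp g' g) =
  bicov_comp (tens_hom f' g') (tens_hom f g).
Proof.
apply: bicov_hom_ext; apply: tens_ext => [||m n]; try by lin.
by rewrite /= !tens_homE.
Qed.

Lemma assoc_natural M M' N N' P P' (f : bicov_hom M M') (g : bicov_hom N N')
    (h : bicov_hom P P') :
  bicov_comp (assoc_fwd M' N' P') (tens_hom (tens_hom f g) h) =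
  bicov_comp (tens_hom f (tens_hom g h)) (assoc_fwd M N P).
Proof.
apply: bicov_hom_ext; apply: tens_ext_l => [||m n p]; try by lin.
by rewrite /= assoc_fwdE !tens_homE assoc_fwdE.
Qed.

Lemma lunit_natural M N (f : bicov_hom M N) :
  bicov_comp (lunit_fwd N) (tens_hom (bicov_id I) f) = bicov_comp f (lunit_fwd M).
Proof.
apply: bicov_hom_ext; apply: tens_ext => [||h m]; try by lin.
by rewrite /= tens_homE !lunit_fwdE bhom_ul.
Qed.

Lemma runit_natural M N (f : bicov_hom M N) :
  bicov_comp (runit_fwd N) (tens_hom f (bicov_id I)) = bicov_comp f (runit_fwd M).
Proof.
apply: bicov_hom_ext; apply: tens_ext => [||m h]; try by lin.
by rewrite /= tens_homE !runit_fwdE bhom_ur.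
Qed.

Lemma tens_ext4 M N P Q (R : lmodType k) (f g : ((M ⊠ N) ⊠ P) ⊠ Q -> R) :
  linear f -> linear g ->
  (forall m n p q, f (utp (utp (utp m n : M ⊠ N) p : (M ⊠ N) ⊠ P) q) =
                   g (utp (utp (utp m n : M ⊠ N) p : (M ⊠ N) ⊠ P) q)) -> f =1 g.
Proof.
move=> lf lg fg; apply: tens_ext => // x q; move: x.
apply: (tens_ext_l (f := fun x : (M ⊠ N) ⊠ P => f (utp x q))
  (g := fun x : (M ⊠ N) ⊠ P => g (utp x q))) => [||m n p]; try by lin.
exact: fg.
Qed.

Lemma assoc_pentagon M N P Q :
  bicov_comp (bicov_comp (tens_hom (bicov_id M) (assoc_fwd N P Q))
      (assoc_fwd M (N ⊠ P) Q)) (tens_hom (assoc_fwd M N P) (bicov_id Q))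
  = bicov_comp (assoc_fwd M N (P ⊠ Q)) (assoc_fwd (M ⊠ N) P Q).
Proof.
apply: bicov_hom_ext; apply: tens_ext4 => [||m n p q]; try by lin.
by rewrite /= tens_homE !assoc_fwdE tens_homE !assoc_fwdE.
Qed.

(** In untwisted form this is the balancing relation. *)
Lemma unit_triangle M N :
  bicov_comp (tens_hom (bicov_id M) (lunit_fwd N)) (assoc_fwd M I N) =
  tens_hom (runit_fwd M) (bicov_id N).
Proof.
apply: bicov_hom_ext; apply: tens_ext_l => [||m h n]; try by lin.
by rewrite /= assoc_fwdE !tens_homE lunit_fwdE runit_fwdE utp_bal.
Qed.

Definition bicov_ten (M N : BicovCat H) : BicovCat H := Bicov (tensH_struct M N).

Definition bicov_monoidal : monoidal_on bicov_ten (I : BicovCat H).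
Proof.
exact: (@MonoidalOn (BicovCat H) bicov_ten I
  (fun M M' N N' f g => tens_hom f g)
  (fun M N P => @Iso (BicovCat H) _ _ _ _ (assoc_fwdK M N P) (assoc_bwdK M N P))
  (fun M => @Iso (BicovCat H) _ _ _ _ (lunit_fwdK M) (lunit_bwdK M))
  (fun M => @Iso (BicovCat H) _ _ _ _ (runit_fwdK M) (runit_bwdK M))
  tens_hom_id tens_hom_comp assoc_natural lunit_natural runit_natural
  assoc_pentagon unit_triangle).
Defined.

End Monoidal.

(** * Invariant vectors and generators of iterated tensor products *)

Section Invariants.
Variables (k : comPzRingType) (H : homHopf k).
Implicit Types M N P Q : bicov H.
Local Notation "A ⊠ B" := (bicov_tens A B) (at level 40, left associativity).

Definition ulinv M (m : M) := urho M m = hone H ⊗ m.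
Definition urinv M (m : M) := usigma M m = m ⊗ hone H.

Lemma ulinv_hom M N (f : bicov_hom M N) m : ulinv m -> ulinv (f m).
Proof. by move=> e; rewrite /ulinv bhom_urho e sw_tpure //; lin. Qed.

Lemma urinv_hom M N (f : bicov_hom M N) m : urinv m -> urinv (f m).
Proof. by move=> e; rewrite /urinv bhom_usigma e sw_tpure //; lin. Qed.

Lemma ulinv_mu M (m : M) : ulinv m -> ulinv (mu M m).
Proof.
move=> e; rewrite /ulinv -[LHS]tens_id sw_urho_mu; last by lin.
by rewrite e sw_tpure ?alpha1 //; lin.
Qed.

Lemma urinv_mu M (m : M) : urinv m -> urinv (mu M m).
Proof.
move=> e; rewrite /urinv -[LHS]tens_id sw_usigma_mu; last by lin.
by rewrite e sw_tpure ?alpha1 //; lin.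
Qed.

Lemma ulinv_utp M N (m : M) (n : N) :
  ulinv m -> ulinv n -> ulinv (utp m n : M ⊠ N).
Proof.
move=> em en; rewrite /ulinv -[LHS]tens_id sw_urho_utp; last by lin.
rewrite em sw_tpure; last by lin.
rewrite en sw_tpure; last by lin.
by congr (_ ⊗ _); exact: umul1l.
Qed.

Lemma urinv_utp M N (m : M) (n : N) :
  urinv m -> urinv n -> urinv (utp m n : M ⊠ N).
Proof.
move=> em en; rewrite /urinv -[LHS]tens_id sw_usigma_utp; last by lin.
rewrite em sw_tpure; last by lin.
rewrite en sw_tpure; last by lin.
by congr (_ ⊗ _); exact: umul1l.
Qed.

Lemma tens_gen M N (P : lmodType k) (L : H -> P -> P) (R : P -> H -> P)
    (f g : M ⊠ N -> P) : linear f -> linear g ->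
  (forall h x, f (ul h x) = L h (f x)) -> (forall h x, g (ul h x) = L h (g x)) ->
  (forall x h, f (ur x h) = R (f x) h) -> (forall x h, g (ur x h) = R (g x) h) ->
  (forall m n, ulinv m -> urinv n -> f (utp m n) = g (utp m n)) -> f =1 g.
Proof.
by move=> lf lg fL gL fR gR fg; exact: (gen_ext (utpP M N) lf lg fL gL fR gR fg).
Qed.

Lemma hom_gen M N Q (f g : bicov_hom (M ⊠ N) Q) :
  (forall m n, ulinv m -> urinv n -> f (utp m n) = g (utp m n)) -> f = g.
Proof.
move=> fg; apply: bicov_hom_ext.
apply: (tens_gen (L := @ul k H Q) (R := @ur k H Q)) => //; try by lin.
all: by move=> *; rewrite ?bhom_ul ?bhom_ur.
Qed.

Lemma utp_dec M N (m : M) (n : N) : utp m n =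
  \sw_(a, x <- urho M m) \sw_(y, b <- usigma N n)
    ur (ul a (utp (PL (untwist_bimod M) x) (PR (untwist_bimod N) y) : M ⊠ N)) b
  :> (M ⊠ N).
Proof. exact: (tens_dec (utpP M N)). Qed.

Lemma ul_dec M m :
  \sw_(a, x <- urho M m) ul a (PL (untwist_bimod M) x : M) = m.
Proof. exact: (@PL_dec _ _ (untwist_bimod M)). Qed.

Lemma ur_dec M m :
  \sw_(x, a <- usigma M m) ur (PR (untwist_bimod M) x : M) a = m.
Proof. exact: (@PR_dec _ _ (untwist_bimod M)). Qed.

Lemma ulinv_PL M m : ulinv (PL (untwist_bimod M) m : M).
Proof. exact: (@linv_PL _ _ (untwist_bimod M) m). Qed.

Lemma urinv_PR M m : urinv (PR (untwist_bimod M) m : M).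
Proof. exact: (@rinv_PR _ _ (untwist_bimod M) m). Qed.

(** In the decomposition of [utp m n] the left coefficient leaves by left linearity, and the right
    one crosses the tensor sign to [p]. What remains of [p] is then reduced to a right invariant by
    [ur_dec]. Two right invariants are wanted because the first hexagon braids [m] past [N ⊠ P]. *)
Lemma hom_gen_l M N P Q (f g : bicov_hom ((M ⊠ N) ⊠ P) Q) :
  (forall m n p, ulinv m -> urinv n -> urinv p ->
    f (utp (utp m n : M ⊠ N) p) = g (utp (utp m n : M ⊠ N) p)) -> f = g.
Proof.
move=> fg; apply: bicov_hom_ext.
have step m n p : ulinv m -> urinv n ->
    f (utp (utp m n : M ⊠ N) p) = g (utp (utp m n : M ⊠ N) p).
  move=> lm rn; rewrite -[p]ur_dec.
  rewrite !(bilin_swr _ _ _ (@utp_bilin k H (M ⊠ N) P)).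
  rewrite !(linear_sw _ _ (linearP _)); apply: eq_sw => y b.
  by rewrite -ur_utp !bhom_ur fg //; exact: urinv_PR.
apply: tens_ext_l => [||m n p]; try by lin.
rewrite (utp_dec m n) !(bilin_swl _ _ _ (@utp_bilin k H (M ⊠ N) P)).
rewrite !(linear_sw _ _ (linearP _)); apply: eq_sw => a x.
rewrite !(bilin_swl _ _ _ (@utp_bilin k H (M ⊠ N) P)).
rewrite !(linear_sw _ _ (linearP _)); apply: eq_sw => y b.
rewrite utp_bal -ul_utp !bhom_ul step //; [exact: ulinv_PL | exact: urinv_PR].
Qed.

(** The mirror image, with two left invariants, for the hexagon that braids [M ⊠ N] past [p]. *)
Lemma hom_gen_r M N P Q (f g : bicov_hom (M ⊠ (N ⊠ P)) Q) :
  (forall m n p, ulinv m -> ulinv n -> urinv p ->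
    f (utp m (utp n p : N ⊠ P)) = g (utp m (utp n p : N ⊠ P))) -> f = g.
Proof.
move=> fg; apply: bicov_hom_ext.
have step m n p : ulinv n -> urinv p ->
    f (utp m (utp n p : N ⊠ P)) = g (utp m (utp n p : N ⊠ P)).
  move=> lm rn; rewrite -[m]ul_dec.
  rewrite !(bilin_swl _ _ _ (@utp_bilin k H M (N ⊠ P))).
  rewrite !(linear_sw _ _ (linearP _)); apply: eq_sw => y b.
  by rewrite -ul_utp !bhom_ul fg //; exact: ulinv_PL.
apply: tens_ext_r => [||m n p]; try by lin.
rewrite (utp_dec n p) !(bilin_swr _ _ _ (@utp_bilin k H M (N ⊠ P))).
rewrite !(linear_sw _ _ (linearP _)); apply: eq_sw => a x.
rewrite !(bilin_swr _ _ _ (@utp_bilin k H M (N ⊠ P))).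
rewrite !(linear_sw _ _ (linearP _)); apply: eq_sw => y b.
rewrite -ur_utp !bhom_ur -utp_bal step //; [exact: ulinv_PL | exact: urinv_PR].
Qed.

End Invariants.

(** * The prebraiding and its axioms *)

Section Braiding.
Variables (k : comPzRingType) (H : homHopf k).
Implicit Types M N P Q : bicov H.
Local Notation "A ⊠ B" := (bicov_tens A B) (at level 40, left associativity).

(** The automorphisms in the untwisted coaction cancel the inverse one in the untwisted action,
    since the antipode commutes with [α]. *)
Lemma P_L_PL M m : P_L m = PL (untwist_bimod M) m.
Proof.
rewrite /P_L; symmetry.
transitivity (\sw_(h, x <- urho M m) ul (antipode H h) x); first by [].
rewrite sw_urho; last by lin.
by apply: eq_sw => h x; rewrite antipode_alpha ul_alpha.
Qed.

Lemma P_R_PR M m : P_R m = PR (untwist_bimod M) m.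
Proof.
rewrite /P_R; symmetry.
transitivity (\sw_(x, h <- usigma M m) ur x (antipode H h)); first by [].
rewrite sw_usigma; last by lin.
by apply: eq_sw => x h; rewrite antipode_alpha ur_alpha.
Qed.

Lemma P_L_linear M : linear (@P_L k H M).
Proof. by move=> a x y; rewrite !P_L_PL; exact: (@PL_linear _ _ (untwist_bimod M)). Qed.

Lemma P_R_linear M : linear (@P_R k H M).
Proof. by move=> a x y; rewrite !P_R_PR; exact: (@PR_linear _ _ (untwist_bimod M)). Qed.

Lemma P_L_mu M m : P_L (mu M m) = mu M (P_L m).
Proof.
rewrite /P_L sw_rho_mu; last by have lb := @lact_bilin k H M; lin.
rewrite (linear_sw _ _ (linearP _)); apply: eq_sw => h x.
by rewrite antipode_alpha mu_lact.
Qed.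

Lemma P_R_mu M m : P_R (mu M m) = mu M (P_R m).
Proof.
rewrite /P_R sw_sigma_mu; last by have rb := @ract_bilin k H M; lin.
rewrite (linear_sw _ _ (linearP _)); apply: eq_sw => x h.
by rewrite antipode_alpha mu_ract.
Qed.

Section BraidHom.
Variables M N : bicov H.

(** The first description is the untwisted form of the required formula; naturality, the hexagons
    and invertibility rest on the second. *)
Lemma braid_hom_ex : exists c : bicov_hom (M ⊠ N) (N ⊠ M),
  (forall m n, c (utp m n) =
    \sw_(a, x <- urho M m) \sw_(y, b <- usigma N n) utp (ul a (P_R y)) (ur (P_L x) b))
  /\ (forall m n, ulinv m -> urinv n -> c (utp m n) = utp n m).
Proof.
have HT := utpP M N; have HT' := utpP N M.
have [c cE] := braid_exists HT HT'.
have cl := braid_l HT HT' cE; have cr := braid_r HT HT' cE.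
have cI := braid_inv HT' cE.
have [|||||F FE] := @uhom_ex k H (M ⊠ N) (N ⊠ M) c.
- move=> x; symmetry; move: x.
  (* The automorphisms are linear only up to [α], so the target carries the actions through
     [alpha H]. *)
  apply: (tens_gen (f := fun x => c (mu (M ⊠ N) x))
    (g := fun x => mu (N ⊠ M) (c x)) (L := fun h x => ul (alpha H h) x)
    (R := fun x h => ur x (alpha H h))) => [||h x|h x|x h|x h|m n lm rn]; try by lin.
  + by rewrite mu_ul; exact: cl.
  + by rewrite -mu_ul; congr (mu _ _); exact: cl.
  + by rewrite mu_ur; exact: cr.
  + by rewrite -mu_ur; congr (mu _ _); exact: cr.
  by rewrite mu_utp (cI _ _ (ulinv_mu lm) (urinv_mu rn)) (cI _ _ lm rn) mu_utp.
- exact: cl.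
- by move=> x h; exact: cr.
- exact: (braid_rho HT HT' cl cr cI).
- exact: (braid_sigma HT HT' cl cr cI).
exists F; split=> m n; last by rewrite FE; exact: cI.
rewrite FE [LHS]cE; apply: eq_sw => a x; apply: eq_sw => y b.
by rewrite P_L_PL P_R_PR.
Qed.

Definition braid_hom := projT1 (cid braid_hom_ex).

Lemma braid_homE m n : braid_hom (utp m n) =
  \sw_(a, x <- urho M m) \sw_(y, b <- usigma N n) utp (ul a (P_R y)) (ur (P_L x) b).
Proof. by have [e _] := projT2 (cid braid_hom_ex); exact: e. Qed.

Lemma braid_hom_inv m n : ulinv m -> urinv n -> braid_hom (utp m n) = utp n m.
Proof. by have [_ e] := projT2 (cid braid_hom_ex); exact: e. Qed.

Lemma braid_hom_iso : bijective (antipode H) -> exists G : bicov_hom (N ⊠ M) (M ⊠ N),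
  bicov_comp G braid_hom = bicov_id _ /\ bicov_comp braid_hom G = bicov_id _.
Proof.
move=> bS; have HT := utpP M N; have HT' := utpP N M.
have [d cK dK] := @braid_bij _ (untwist_hopf H) _ _ _ _ _ _ HT HT' braid_hom
  (@bhom_ul _ _ _ _ braid_hom) (@bhom_ur _ _ _ _ braid_hom) braid_hom_inv bS.
by have [G ? ?] := bhom_inv cK dK; exists G.
Qed.

End BraidHom.

(** Morphisms preserve invariants on either side, so both composites send [utp m n] to
    [utp (g n) (f m)] on generators. *)
Lemma braid_natural M M' N N' (f : bicov_hom M M') (g : bicov_hom N N') :
  bicov_comp (braid_hom M' N') (tens_hom f g) =
  bicov_comp (tens_hom g f) (braid_hom M N).
Proof.
apply: hom_gen => m n lm rn.
rewrite /= tens_homE !braid_hom_inv ?tens_homE //.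
  exact: ulinv_hom.
exact: urinv_hom.
Qed.

(** With [n] and [p] right invariant, so is [utp n p]; both composites then send the generator to
    [utp n (utp p m)]. *)
Lemma braid_hexagon1 M N P :
  bicov_comp (bicov_comp (assoc_fwd N P M) (braid_hom M (N ⊠ P))) (assoc_fwd M N P) =
  bicov_comp (bicov_comp (tens_hom (bicov_id N) (braid_hom M P)) (assoc_fwd N M P))
    (tens_hom (braid_hom M N) (bicov_id P)).
Proof.
apply: hom_gen_l => m n p lm rn rp /=.
rewrite assoc_fwdE tens_homE !braid_hom_inv //; last exact: urinv_utp.
by rewrite !assoc_fwdE tens_homE braid_hom_inv.
Qed.

(** With [m] and [n] left invariant, so is [utp m n]; both composites then send the generator to
    [utp (utp p m) n]. *)
Lemma braid_hexagon2 M N P :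
  bicov_comp (bicov_comp (assoc_bwd P M N) (braid_hom (M ⊠ N) P)) (assoc_bwd M N P) =
  bicov_comp (bicov_comp (tens_hom (braid_hom M P) (bicov_id N)) (assoc_bwd M P N))
    (tens_hom (bicov_id M) (braid_hom N P)).
Proof.
apply: hom_gen_r => m n p lm ln rp /=.
rewrite assoc_bwdE tens_homE !braid_hom_inv //; last exact: ulinv_utp.
by rewrite !assoc_bwdE tens_homE braid_hom_inv.
Qed.

Definition bicov_prebraiding : prebraiding (bicov_monoidal H).
Proof.
exact: (@Prebraiding (BicovCat H) _ _ (bicov_monoidal H) braid_hom braid_natural
  braid_hexagon1 braid_hexagon2).
Defined.

End Braiding.

Theorem theorem6p8 (k : comPzRingType) (H : homHopf k) :
  exists T : forall M N : bicov H, bicov_struct H (tensH M N),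
  let ten (M N : BicovCat H) : BicovCat H := Bicov (T M N) in
  exists (B : monoidal_on ten (unit_bicov H)) (c : prebraiding B),
    [/\ forall M N : bicov H, is_tensH_struct (T M N),
        (forall (M M' N N' : bicov H) (f : bicov_hom M M') (g : bicov_hom N N') m n,
           (tmor B f g : bicov_hom _ _) (m ⊗_[M, N] n) = f m ⊗_[M', N'] g n),
        (forall (M N P : bicov H) m n p,
           (fwd (assoc B M N P) : bicov_hom _ _)
             ((m ⊗_[M, N] n) ⊗_[ten M N, P] p)
           = mu M m ⊗_[M, ten N P] (n ⊗_[N, P] autV (mu P) p)),
        (forall (M : bicov H) h m,
           (fwd (lunit B M) : bicov_hom _ _) (h ⊗_[unit_bicov H, M] m) = h ▷ m) /\
        (forall (M : bicov H) m h,
           (fwd (runit B M) : bicov_hom _ _) (m ⊗_[M, unit_bicov H] h) = m ◁ h) &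
        (forall (M N : bicov H) m n,
           (braid c M N : bicov_hom _ _) (m ⊗_[M, N] n)
           = \sw_(a, x <- rho M m) \sw_(y, b <- sigma N n)
               ((a ▷ P_R y) ⊗_[N, M] (P_L x ◁ b)))]
    /\ (bijective (antipode H) -> is_braiding c).
Proof.
exists (@tensH_struct k H) => ten.
exists (bicov_monoidal H), (bicov_prebraiding H).
split; last by move=> bS M N; exact: braid_hom_iso.
split=> [M N | M M' N N' f g m n | M N P m n p | | M N m n].
- exact: tensH_structP.
- rewrite !tpureHE [LHS]tens_homE.
  by rewrite !bhom_mu.
(* Nesting on the left shifts [m] and [n] twice and [p] once; nesting on the right shifts [n] and
   [p] twice and [m] once. The [mu M m] and [autV (mu P) p] of the constraint make up for this. *)
- rewrite !tpureHE [LHS](_ : _ = assoc_fwd M N P (utp (mu (bicov_tens M N)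
    (utp (mu M m) (mu N n))) (mu P p))) // mu_utp assoc_fwdE autVK.
  by rewrite [in RHS]mu_utp.
- split=> [M h m | M m h].
  + by rewrite tpureHE [LHS]lunit_fwdE ul_alpha.
  + by rewrite tpureHE [LHS]runit_fwdE ur_alpha.
rewrite tpureHE [LHS]braid_homE.
have lL := @P_L_linear k H M; have lR := @P_R_linear k H N.
rewrite sw_urho_mu ?sw_urho; try by lin.
apply: eq_sw => a x; rewrite sw_usigma_mu ?sw_usigma; try by lin.
apply: eq_sw => y b.
by rewrite !P_L_mu !P_R_mu -mu_ul -mu_ur ul_alpha ur_alpha tpureHE.
Qed.
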